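(* Let $G$ be a connected graph with $m\ge 1$ edges, and let $\mathcal L(G)$ be its line graph. Then, for every real number $p\ge 2$, $$\mathcal E_p^+\bigl(\mathcal L(G)\bigr)\ge \mathcal E_p^+(P_m).$$
   Context: All graphs are finite, simple, undirected and unweighted. The line graph $\mathcal L(G)$ has vertex set $E(G)$, two distinct vertices being adjacent precisely when the corresponding edges of $G$ share an endpoint. For a graph $H$ and $p>0$, the positive adjacency $p$-energy is $\mathcal E_p^+(H)=\sum_{i:\lambda_i(H)>0}\lambda_i(H)^p$, where $\lambda_i(H)$ are the eigenvalues of the adjacency matrix of $H$ counted with multiplicity. $P_m$ denotes the path on $m$ vertices ($P_1$ is a single vertex). *)

(* Defs.v *)
From HB Require Import structures.
From mathcomp Require Import all_boot all_order all_algebra.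
From mathcomp Require Import polyrcf.
From mathcomp Require Import reals exp.
Set Implicit Arguments.
Unset Strict Implicit.
Unset Printing Implicit Defensive.
Import Order.TTheory GRing.Theory Num.Theory.
Local Open Scope ring_scope.

Record sgraph := SGraph {
  vertex :> finType;
  adj : rel vertex;
  adj_sym : symmetric adj;
  adj_irr : irreflexive adj
}.

Definition edges (G : sgraph) : {set {set G}} :=
  [set e : {set G} | [exists x, [exists y, adj x y && (e == [set x; y])]]].

Definition graph_connected (G : sgraph) : Prop :=
  (0 < #|G|)%N /\ forall x y : G, connect (@adj G) x y.

Section LineGraph.
Variable G : sgraph.

Definition line_adj : rel {e : {set G} | e \in edges G} :=
  fun e f => (e != f) && (val e :&: val f != set0).

Lemma line_adj_sym : symmetric line_adj.
Proof. by move=> e f; rewrite /line_adj /= [e == f]eq_sym setIC. Qed.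

Lemma line_adj_irr : irreflexive line_adj.
Proof. by move=> e; rewrite /line_adj /= eqxx. Qed.

Definition line_graph : sgraph := SGraph line_adj_sym line_adj_irr.
End LineGraph.

Section PathGraph.
Variable m : nat.

Definition path_adj : rel 'I_m :=
  fun i j => (i.+1 == j :> nat) || (j.+1 == i :> nat).

Lemma path_adj_sym : symmetric path_adj.
Proof. by move=> i j; rewrite /path_adj /= orbC. Qed.

Lemma path_adj_irr : irreflexive path_adj.
Proof. by move=> i; rewrite /path_adj /= orbb gtn_eqF. Qed.

Definition path_graph : sgraph := SGraph path_adj_sym path_adj_irr.
End PathGraph.

Definition adjmx (R : realType) (G : sgraph) : 'M[R]_#|G| :=
  \matrix_(i, j) (adj (enum_val i) (enum_val j))%:R.

(* The real roots of the characteristic polynomial, each repeated according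
   to its multiplicity; [rootsR q] lists the distinct real roots of [q]. *)
Definition eigenvalues (R : realType) (n : nat) (A : 'M[R]_n) : seq R :=
  flatten [seq nseq (mup x (char_poly A)) x | x <- rootsR (char_poly A)].

Definition pos_energy (R : realType) (p : R) (G : sgraph) : R :=
  \sum_(x <- eigenvalues (adjmx R G) | 0 < x) x `^ p.

(* Main.v *)
Require Import Defs.
From mathcomp Require Import all_boot all_order all_algebra.
From mathcomp Require Import reals.
Import Order.TTheory GRing.Theory Num.Theory.
Local Open Scope ring_scope.
From mathcomp Require Import complex polyrcf topology normedtype.
From mathcomp Require Import derive realfun exp trigo zify ring lra.
Import numFieldNormedType.Exports.
Set Implicit Arguments.
Unset Strict Implicit.
Unset Printing Implicit Defensive.

(** Write f(x) = max(x, 0)^p.  For a set X of edges of G that is connected in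
    the line graph, let E(X) be the energy of the graph it induces, and let
    alpha(n) be the energy of the path on n vertices.  The inequality
    alpha(|X|) <= E(X) holds for all such X, by induction on |X|
    ([connected_edge_set_energy]); the theorem is the case of all edges of G.

    Every comparison of spectra rests on the convexity of f.  By [peierls] the
    sum of f over the diagonal entries in an orthonormal basis is at most the
    energy.  Two consequences carry the argument: [pinching], which permits
    discarding all adjacencies between disjoint sets, and [klein], the first
    order bound E(b) >= E(a) + tr f'(a)(b - a).

    If every vertex of G lies on at most two edges of X, then X induces a path
    or a cycle, and explicit spectra compare the cycle with the path
    ([cycle_energy]).  Otherwise some vertex v lies on at least three edges of
    X, and there are three arguments.

    Suppose p >= 3, and let e be one of the edges at v.  The other edges at v
    lie in one component A of X - e, and what is left outside A is connected or
    empty, since it can reach e only through the other end of e.  Attaching e to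
    A creates a triangle and raises the energy by at least 2^p - 1
    ([attach_triangle]), whereas inserting one vertex between two paths raises
    the energy by at most that amount ([alpha_concat]).  The first estimate
    rotates the vector that couples e to the rest, starting from a
    configuration in which e is attached to an auxiliary vertex only; the energy
    cannot decrease on the way because f' has a convex derivative
    ([rotation_monotone]).  The second one removes two rank one terms from the
    square of the adjacency kernel of a path ([delete_vertex]).

    Suppose p < 3, and that some star with d >= 3 edges has two edges touching
    the same component of its complement.  Then there are fewer than d
    components.  Pinching leaves the star, a complete graph with top eigenvalue
    d - 1, and these components, and [star_numeric] compares the result with
    one path.

    Suppose finally that no such star exists.  The condition of having two edges
    that touch the same component passes from a vertex on two edges to the other
    ends of these edges, hence along X, so it holds at no vertex at all
    ([all_nonsep]).  In a breadth-first tree of X two adjacent elements are then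
    parent and child, or siblings ([adj_parent_or_sibling]).  The entries of
    f'(S) between siblings, S being the adjacency kernel of the tree, are
    nonnegative because f' is convex ([sibling_kcalc_ge0]), so by Klein's
    inequality the tree has at most the energy of X.

    It remains to compare the tree with the path.  A bipartite kernel has a
    symmetric spectrum, so twice its energy is the sum of y^(p/2) over its
    squared eigenvalues y.  For 1 < r < 2 the function y^r is a positive
    superposition of the functions s y - ln(1 + s y), so it is enough to compare
    the sums of the latter ([kappa_to_power]).  Their linear part is a trace,
    their logarithmic part the logarithm of a determinant which, for a forest,
    obeys the recursion of a matching polynomial; among forests of a given order
    the path maximises it ([forest_det]). *)

(** * The real spectral theorem *)

(** A complex eigenvalue exists, and comparing the two ways of evaluating the
    Hermitian form at an eigenvector shows that it equals its conjugate. *)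
Lemma symmetric_real_eigenvalue (R : rcfType) n (A : 'M[R]_n.+1) :
  A^T = A -> exists r, eigenvalue A r.
Proof.
move=> symA; pose AC := map_mx (real_complex R) A.
have [z ez] := eigenvalue_closed AC (ltn0Sn n).
have /eigenvalueP[v Ev v0] := ez.
have zreal : z \is Num.real.
  pose q := \sum_i v 0 i * (v 0 i)^*.
  have q0 : q != 0.
    apply: contra v0 => /eqP q0; apply/eqP/matrixP=> i j; rewrite ord1 mxE.
    have := psumr_eq0P (P := xpredT) (F := fun i => v 0 i * (v 0 i)^*).
    move/(_ (fun i _ => mul_conjC_ge0 _) q0 j isT) => /eqP.
    by rewrite mul_conjC_eq0 => /eqP.
  have e1 : \sum_i (v *m AC) 0 i * (v 0 i)^* = z * q.
    by rewrite Ev mulr_sumr; apply: eq_bigr => i _; rewrite mxE mulrA.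
  have e2 : \sum_i (v *m AC) 0 i * (v 0 i)^* = z^* * q.
    transitivity (\sum_i v 0 i * ((v *m AC) 0 i)^*).
      under eq_bigr do rewrite mxE mulr_suml.
      under [RHS]eq_bigr do rewrite mxE rmorph_sum /= mulr_sumr.
      rewrite exchange_big; apply: eq_bigr => i _; apply: eq_bigr => j _.
      rewrite rmorphM /= !mxE -mulrA; congr (_ * _); rewrite mulrC; congr (_ * _).
      have -> : A j i = A i j by rewrite -{1}symA mxE.
      by apply/esym/CrealP; rewrite complex_real.
    rewrite Ev mulr_sumr; apply: eq_bigr => i _.
    by rewrite mxE rmorphM /= mulrCA.
  by apply/CrealP/(mulIf q0); rewrite -e2.
have [r zr] : exists r, z = real_complex R r.
  by exists (complex.Re z); apply/esym/RRe_real.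
exists r; move: ez.
by rewrite !eigenvalue_root_char /AC -map_char_poly zr fmorph_root.
Qed.

Lemma row_sqnorm_eq0 (R : rcfType) n (z : 'rV[R]_n) :
  (z *m z^T) 0 0 = 0 -> z = 0.
Proof.
rewrite mxE => z0; apply/matrixP=> i j; rewrite ord1 [RHS]mxE.
have h k : true -> 0 <= z 0 k * z^T k 0 by rewrite mxE -expr2 sqr_ge0.
have /eqP := psumr_eq0P h z0 (isT : xpredT j).
by rewrite mxE mulf_eq0 orbb => /eqP.
Qed.

(** The reflection in the hyperplane orthogonal to [v - w] exchanges two unit
    vectors. *)
Lemma reflection_to_unit (R : rcfType) n (v w : 'rV[R]_n) :
  v *m v^T = 1%:M -> w *m w^T = 1%:M ->
  exists H : 'M[R]_n, [/\ H^T = H, H *m H = 1%:M & w *m H = v].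
Proof.
move=> v1 w1; have [->|vw] := eqVneq v w.
  by exists 1%:M; rewrite trmx1 !mulmx1.
pose z := v - w; pose k := (w *m v^T) 0 0.
have wv : w *m v^T = k%:M by rewrite [LHS]mx11_scalar.
have vw1 : v *m w^T = k%:M by rewrite -[LHS]trmxK trmx_mul trmxK wv tr_scalar_mx.
pose q := (1 - k) *+ 2.
have wz : w *m z^T = (- (q / 2))%:M.
  rewrite linearB /= mulmxBr wv w1 -raddfB; congr (_%:M).
  by rewrite /q -mulr_natr mulfK ?pnatr_eq0 // opprB.
have qE : z *m z^T = q%:M.
  rewrite linearB /= mulmxBr !mulmxBl v1 w1 wv vw1 -!raddfB; congr (_%:M).
  by rewrite /q mulr2n opprB.
have q0 : q != 0.
  apply: contra vw => /eqP q0; rewrite -subr_eq0 -/z.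
  by apply/eqP/row_sqnorm_eq0; rewrite qE q0 mxE mul0rn.
pose B := (2 / q) *: (z^T *m z).
have BB : B *m B = B + B.
  rewrite -scalemxAl -scalemxAr mulmxA -(mulmxA z^T) qE mul_mx_scalar -scalemxAl.
  by rewrite -scalerDl !scalerA divfK // mulrDr mulr1.
exists (1%:M - B); split.
- by rewrite linearB linearZ /= trmx1 trmx_mul trmxK.
- by rewrite mulmxBl mul1mx mulmxBr mulmx1 BB opprB addrK subrK.
- rewrite mulmxBr mulmx1 -scalemxAr mulmxA wz mul_scalar_mx scalerA.
  have -> : 2 / q * (- (q / 2)) = -1.
    by move: q q0 {qE wz B BB} => t t0; rewrite mulrN mulrA divfK ?divff ?pnatr_eq0.
  by rewrite scaleN1r opprK addrC subrK.
Qed.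

(** Induction on the size: a reflection moves a unit eigenvector to the first
    coordinate, after which symmetry makes the matrix block diagonal. *)
Lemma real_spectral (R : rcfType) n (A : 'M[R]_n) : A^T = A ->
  exists P : 'M[R]_n, exists d : 'rV[R]_n,
    P *m P^T = 1%:M /\ P *m A = diag_mx d *m P.
Proof.
elim: n A => [|n IH] A symA.
  by exists 0, 0; split; apply/matrixP=> -[].
have [r /eigenvalueP[v0 Ev0 v00]] := symmetric_real_eigenvalue symA.
pose q := (v0 *m v0^T) 0 0.
have qE : q = \sum_j v0 0 j * v0 0 j by rewrite /q mxE; apply: eq_bigr => j _; rewrite mxE.
have q0 : 0 < q.
  rewrite lt_def {2}qE sumr_ge0 ?andbT; last by move=> j _; rewrite -expr2 sqr_ge0.
  by apply: contra v00 => /eqP /row_sqnorm_eq0 ->.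
pose v := (Num.sqrt q)^-1 *: v0.
have sq0 : Num.sqrt q != 0 by rewrite gt_eqF ?sqrtr_gt0.
have Ev : v *m A = r *: v by rewrite -scalemxAl Ev0 scalerA mulrC -scalerA.
have v1 : v *m v^T = 1%:M.
  rewrite [LHS]mx11_scalar; congr (_%:M); rewrite mxE.
  transitivity ((Num.sqrt q)^-1 ^+ 2 * \sum_j v0 0 j * v0 0 j).
    by rewrite mulr_sumr; apply: eq_bigr => j _; rewrite !mxE mulrACA expr2.
  rewrite -qE.
  by rewrite exprVn sqr_sqrtr ?ltW // mulVf // gt_eqF.
pose w : 'rV[R]_n.+1 := delta_mx 0 0.
have w1 : w *m w^T = 1%:M.
  by rewrite trmx_delta mul_delta_mx [LHS]mx11_scalar mxE.
have [H [Hs HH wH]] := reflection_to_unit v1 w1.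
pose B : 'M[R]_(1 + n) := H *m A *m H.
have Bs : B^T = B by rewrite /B !trmx_mul Hs symA mulmxA.
have wB : w *m B = r *: w.
  by rewrite /B !mulmxA wH Ev -scalemxAl -wH -mulmxA HH mulmx1.
have B0 j : B 0 j = r * (j == 0)%:R.
  by move/matrixP/(_ 0 j): wB; rewrite -rowE !mxE eqxx.
have BD : H *m A *m H = B by [].
clearbody B.
have Bu : ursubmx B = 0.
  by apply/matrixP=> i j; rewrite !mxE ord1 lshift0 B0 eq_sym -val_eqE /= mulr0.
have Bl : dlsubmx B = 0 by rewrite -[LHS]trmxK trmx_dlsub Bs Bu trmx0.
have Bul : ulsubmx B = r%:M.
  by rewrite [LHS]mx11_scalar !mxE lshift0 B0 eqxx mulr1.
have Bds : (drsubmx B)^T = drsubmx B by rewrite trmx_drsub Bs.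
have [P [d [PP PB]]] := IH _ Bds.
pose Q : 'M[R]_(1 + n) := block_mx 1%:M 0 0 P.
pose e : 'rV[R]_(1 + n) := row_mx r%:M d.
have BE : B = block_mx r%:M 0 0 (drsubmx B).
  by rewrite -[LHS]submxK Bu Bl Bul.
have QQ : Q *m Q^T = 1%:M.
  rewrite tr_block_mx mulmx_block !trmx0 trmx1 PP !mulmx0 !mul0mx mul1mx !addr0 !add0r.
  by rewrite -scalar_mx_block.
have QB : Q *m B = diag_mx e *m Q.
  rewrite BE diag_mx_row !mulmx_block !mulmx0 !mul0mx !addr0 !add0r mul1mx mulmx1 PB.
  by congr (block_mx _ _ _ _); apply/matrixP=> i j; rewrite !ord1 !mxE.
exists (Q *m H), e; split.
  by rewrite trmx_mul Hs mulmxA -(mulmxA Q) HH mulmx1.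
rewrite mulmxA -QB -BD -!mulmxA HH mulmx1; congr (_ *m _).
Qed.

(** * Energies of symmetric kernels *)

Section Energy.
Variable R : realType.
Implicit Types T : finType.

Definition symmetric_kernel T (a : T -> T -> R) := forall x y, a x y = a y x.

Definition onb T (u : T -> T -> R) :=
  forall i j, \sum_x u i x * u j x = (i == j)%:R.

(** Rows [u i] are the orthonormal eigenvectors, indexed by the points of [T]
    themselves, so that bases on subsets of [T] can be glued. *)
Definition eigenbasis T (a u : T -> T -> R) (d : T -> R) :=
  onb u /\ forall i x, \sum_y a x y * u i y = d i * u i x.

Definition kernel_mx T (a : T -> T -> R) : 'M[R]_#|T| :=
  \matrix_(i, j) a (enum_val i) (enum_val j).

(** Functions [T -> T -> R] stand for matrices indexed by a finite type; the
    roots of the characteristic polynomial enter only through this definition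
    and [energyE]. *)
Definition energy T (f : R -> R) (a : T -> T -> R) : R :=
  \sum_(x <- eigenvalues (kernel_mx a)) f x.

(** The kernel keeps its index type, which adds zero eigenvalues; they are
    harmless as long as [f 0 = 0]. *)
Definition induced T (X : {set T}) (a : T -> T -> R) x y :=
  if (x \in X) && (y \in X) then a x y else 0.

Definition qform T (a : T -> T -> R) (v w : T -> R) : R :=
  \sum_x \sum_y v x * a x y * w y.

(** The kernel of phi(a) when [(u, d)] diagonalises [a]. *)
Definition kcalc T (phi : R -> R) (u : T -> T -> R) (d : T -> R) x y :=
  \sum_i phi (d i) * u i x * u i y.

Lemma sum_delta T (F : T -> R) x : \sum_y F y * (y == x)%:R = F x.
Proof.
by rewrite (bigD1 x) //= eqxx mulr1 big1 ?addr0 // => y /negPf->; rewrite mulr0.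
Qed.

Lemma sum_deltaC T (F : T -> R) x : \sum_y F y * (x == y)%:R = F x.
Proof. by under eq_bigr do rewrite eq_sym; rewrite sum_delta. Qed.

Lemma onb_dual T (u : T -> T -> R) : onb u ->
  forall x y, \sum_i u i x * u i y = (x == y)%:R.
Proof.
move=> ou x y.
have : kernel_mx u *m (kernel_mx u)^T = 1%:M.
  apply/matrixP=> i j; rewrite !mxE -(inj_eq enum_val_inj) -ou.
  rewrite (reindex (@enum_val T xpredT)) /=; last first.
    by apply: onW_bij; exact: enum_val_bij.
  by apply: eq_bigr => k _; rewrite !mxE.
move/mulmx1C/matrixP/(_ (enum_rank x) (enum_rank y)).
rewrite !mxE (inj_eq enum_rank_inj) => <-.
rewrite (reindex (@enum_val T xpredT)) /=; last by apply: onW_bij; exact: enum_val_bij.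
by apply: eq_bigr => k _; rewrite !mxE !enum_rankK.
Qed.

Lemma eigenbasis_exists T (a : T -> T -> R) : symmetric_kernel a ->
  exists u, exists d, eigenbasis a u d.
Proof.
move=> sa; have [|P [d [PP PA]]] := @real_spectral R _ (kernel_mx a).
  by apply/matrixP=> i j; rewrite !mxE sa.
exists (fun i x => P (enum_rank i) (enum_rank x)), (fun i => d 0 (enum_rank i)).
split=> [i j|i x].
  move/matrixP/(_ (enum_rank i) (enum_rank j)): PP.
  rewrite !mxE (inj_eq enum_rank_inj) => <-.
  rewrite (reindex (@enum_val T xpredT)) /=; last by apply: onW_bij; exact: enum_val_bij.
  by apply: eq_bigr => k _; rewrite !mxE !enum_valK.
move/matrixP/(_ (enum_rank i) (enum_rank x)): PA.
rewrite mul_diag_mx !mxE => <-.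
rewrite (reindex (@enum_val T xpredT)) /=; last by apply: onW_bij; exact: enum_val_bij.
by apply: eq_bigr => k _; rewrite !mxE !enum_valK enum_rankK sa mulrC.
Qed.

Lemma eigenvalues_perm n (A : 'M[R]_n) (s : seq R) :
  char_poly A = \prod_(x <- s) ('X - x%:P) -> perm_eq (eigenvalues A) s.
Proof.
move=> cA; rewrite /eigenvalues cA.
under eq_map do rewrite mu_prod_XsubC.
apply: perm_trans (perm_count_undup s).
apply: perm_flatten; apply: perm_map; apply: uniq_perm.
- by rewrite uniq_roots.
- exact: undup_uniq.
move=> x; rewrite mem_undup -(root_prod_XsubC s x).
have p0 : \prod_(x <- s) ('X - x%:P) != 0 :> {poly R}.
  by rewrite monic_neq0 // monic_prod_XsubC.
by have := roots_on_rootsR p0 x; rewrite in_itv /= => <-.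
Qed.

Lemma char_poly_diagonalized n (A P : 'M[R]_n) (d : 'rV[R]_n) :
  P *m P^T = 1%:M -> P *m A = diag_mx d *m P ->
  char_poly A = \prod_i ('X - (d 0 i)%:P).
Proof.
move=> PP PA; pose Q := map_mx polyC P.
have QQ : Q *m Q^T = 1%:M by rewrite /Q map_trmx -map_mxM PP map_mx1.
have e : Q *m char_poly_mx A = char_poly_mx (diag_mx d) *m Q.
  rewrite /char_poly_mx mulmxBr mulmxBl scalar_mxC; congr (_ - _).
  by rewrite -!map_mxM PA.
have dQ : \det Q * \det Q = 1 by rewrite -{2}det_tr -det_mulmx QQ det1.
have := congr1 (fun M => \det M * \det Q) e; rewrite /= !det_mulmx.
rewrite mulrAC dQ mul1r -mulrA dQ mulr1 => e'.
rewrite /char_poly e' -/(char_poly _) char_poly_trig ?diag_mx_is_trig //.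
by apply: eq_bigr => i _; rewrite mxE eqxx mulr1n.
Qed.

(** The characteristic polynomial is the product of the [X - d i], so the list
    of its roots with multiplicities is a permutation of the [d i]. *)
Lemma energyE T (f : R -> R) (a u : T -> T -> R) d : eigenbasis a u d ->
  symmetric_kernel a -> energy f a = \sum_i f (d i).
Proof.
move=> [ou au] sa.
have : perm_eq (eigenvalues (kernel_mx a)) [seq d i | i : T].
  apply: eigenvalues_perm; rewrite big_image /=.
  rewrite (@char_poly_diagonalized _ _ (kernel_mx u) (\row_i d (enum_val i))).
  - rewrite [RHS](reindex (@enum_val T xpredT)) /=; last by apply: onW_bij; exact: enum_val_bij.
    by apply: eq_bigr => i _; rewrite mxE.
  - apply/matrixP=> i j; rewrite !mxE -(inj_eq enum_val_inj) -ou.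
    rewrite [RHS](reindex (@enum_val T xpredT)) /=; last by apply: onW_bij; exact: enum_val_bij.
    by apply: eq_bigr => k _; rewrite !mxE.
  apply/matrixP=> i j; rewrite mul_diag_mx !mxE -au.
  rewrite [RHS](reindex (@enum_val T xpredT)) /=; last by apply: onW_bij; exact: enum_val_bij.
  by apply: eq_bigr => k _; rewrite !mxE sa mulrC.
by move=> pe; rewrite /energy (perm_big _ pe) /= big_image.
Qed.

Lemma eq_energy T (f : R -> R) (a b : T -> T -> R) : a =2 b -> energy f a = energy f b.
Proof.
move=> ab; rewrite /energy; congr (\sum_(x <- eigenvalues _) _).
by apply/matrixP=> i j; rewrite !mxE ab.
Qed.

Lemma eigenbasis_form T (a u : T -> T -> R) d : eigenbasis a u d ->
  forall i j, qform a (u i) (u j) = d i * (i == j)%:R.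
Proof.
move=> [ou au] i j; rewrite /qform.
transitivity (\sum_x d j * (u i x * u j x)).
  apply: eq_bigr => x _; under eq_bigr do rewrite -mulrA.
  by rewrite -mulr_sumr au mulrCA.
by rewrite -mulr_sumr ou; case: eqP => [->|] //; rewrite !mulr0.
Qed.

Lemma eigenbasis_kernel T (a u : T -> T -> R) d : eigenbasis a u d ->
  forall x y, a x y = \sum_i d i * u i x * u i y.
Proof.
move=> [ou au] x y; transitivity (\sum_z a x z * (z == y)%:R).
  by rewrite sum_delta.
under eq_bigr do rewrite -(onb_dual ou) mulr_sumr.
rewrite exchange_big; apply: eq_bigr => i _.
by rewrite -au mulr_suml; apply: eq_bigr => z _; rewrite mulrA.
Qed.

Lemma form_eigen T (a u : T -> T -> R) d v w : eigenbasis a u d ->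
  qform a v w = \sum_i d i * (\sum_x v x * u i x) * (\sum_y w y * u i y).
Proof.
move=> eb; rewrite /qform.
under eq_bigr => x _.
  under eq_bigr do rewrite (eigenbasis_kernel eb) mulr_sumr mulr_suml.
  rewrite exchange_big. over.
rewrite exchange_big; apply: eq_bigr => i _ /=.
rewrite -mulrA mulr_suml mulr_sumr; apply: eq_bigr => x _.
rewrite !mulr_sumr; apply: eq_bigr => y _; ring.
Qed.

Lemma sqnorm_coords T (v : T -> T -> R) (w : T -> R) : onb v ->
  \sum_j (\sum_x w x * v j x) ^+ 2 = \sum_x w x ^+ 2.
Proof.
move=> ov; under eq_bigr do rewrite expr2 mulr_suml.
rewrite exchange_big; apply: eq_bigr => x _ /=.
under eq_bigr do rewrite mulr_sumr.
rewrite exchange_big /=.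
transitivity (\sum_y w x * w y * (x == y)%:R).
  apply: eq_bigr => y _; rewrite -(onb_dual ov) mulr_sumr.
  by apply: eq_bigr => i _; ring.
by rewrite sum_deltaC expr2.
Qed.

(** Convexity in the form in which it is used: [g] supplies the slope of a
    supporting line of [f] at every point. *)
Definition tangent (f g : R -> R) := forall x y, f x + g x * (y - x) <= f y.

Lemma tangent_jensen (I : finType) (f g w e : I -> R) (F G : R -> R) : tangent F G ->
  (forall i, 0 <= w i) -> \sum_i w i = 1 ->
  F (\sum_i w i * e i) <= \sum_i w i * F (e i).
Proof.
move=> FG w0 w1; set m := \sum_i _.
have -> : F m = \sum_i w i * (F m + G m * (e i - m)).
  under eq_bigr do rewrite mulrDr mulrCA mulrBr.
  rewrite big_split /= -mulr_suml w1 mul1r -mulr_sumr sumrB -/m -mulr_suml w1.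
  by rewrite mul1r subrr mulr0 addr0.
by apply: ler_sum => i _; apply: ler_wpM2l.
Qed.

(** The squared coordinates of one orthonormal basis in another form a doubly
    stochastic matrix; Jensen's inequality applies row by row. *)
Lemma peierls T (f g : R -> R) (b u : T -> T -> R) : tangent f g ->
  symmetric_kernel b -> onb u ->
  \sum_i f (qform b (u i) (u i)) <= energy f b.
Proof.
move=> fg sb ou; have [v [e eb]] := eigenbasis_exists sb.
have [ov _] := eb; rewrite (energyE f eb sb).
pose w i j := (\sum_x u i x * v j x) ^+ 2.
have w1 i : \sum_j w i j = 1.
  rewrite /w sqnorm_coords //; under eq_bigr do rewrite expr2.
  by rewrite ou eqxx.
have w2 j : \sum_i w i j = 1.
  rewrite /w; under eq_bigr => i _ do under eq_bigr do rewrite mulrC.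
  rewrite sqnorm_coords //; under eq_bigr do rewrite expr2.
  by rewrite ov eqxx.
apply: (@le_trans _ _ (\sum_i \sum_j w i j * f (e j))); last first.
  rewrite exchange_big; apply: ler_sum => j _ /=.
  by rewrite -mulr_suml w2 mul1r.
apply: ler_sum => i _; rewrite (form_eigen _ _ eb).
have -> : \sum_i0 e i0 * (\sum_x u i x * v i0 x) * (\sum_y u i y * v i0 y) =
          \sum_j w i j * e j.
  by apply: eq_bigr => j _; rewrite /w; ring.
by apply: tangent_jensen (fg) _ _ => // j; rewrite /w sqr_ge0.
Qed.

(** Peierls' inequality in an eigenbasis of [a], followed by the tangent
    inequality at each eigenvalue of [a]. *)
Lemma klein T (f g : R -> R) (a b u : T -> T -> R) d : tangent f g ->
  symmetric_kernel a -> symmetric_kernel b -> eigenbasis a u d ->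
  energy f a + \sum_x \sum_y kcalc g u d x y * (b x y - a x y) <= energy f b.
Proof.
move=> fg sa sb eb; have [ou _] := eb.
apply: le_trans (peierls fg sb ou).
rewrite (energyE f eb sa).
have -> : \sum_x \sum_y kcalc g u d x y * (b x y - a x y) =
   \sum_i g (d i) * (qform b (u i) (u i) - d i).
  have -> : \sum_i g (d i) * (qform b (u i) (u i) - d i) =
    \sum_i g (d i) * (qform b (u i) (u i) - qform a (u i) (u i)).
    by apply: eq_bigr => i _; rewrite (eigenbasis_form eb) eqxx mulr1.
  rewrite /qform /kcalc.
  under eq_bigr => x _ do (under eq_bigr do rewrite mulr_suml; rewrite exchange_big).
  rewrite exchange_big; apply: eq_bigr => i _ /=.
  rewrite -sumrB mulr_sumr; apply: eq_bigr => x _.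
  rewrite -sumrB mulr_sumr; apply: eq_bigr => y _; ring.
by rewrite -big_split; apply: ler_sum => i _; exact: fg.
Qed.

End Energy.

(** * Induced kernels, pinching and partial eigenbases *)

Section Masks.
Variable R : realType.
Implicit Types T S : finType.

Lemma sum_injective S T (h : S -> T) (F : T -> R) : injective h ->
  (forall x, x \notin codom h -> F x = 0) -> \sum_x F x = \sum_s F (h s).
Proof.
move=> hi F0; rewrite [RHS](partition_big h xpredT) //=; apply: eq_bigr => x _.
have [/codomP[s ->]|nx] := boolP (x \in codom h).
  by rewrite (eq_bigl (pred1 s)) ?big_pred1_eq // => t; rewrite (inj_eq hi).
rewrite F0 // big_pred0 // => s; apply: contraNF nx => /eqP <-.
exact: codom_f.
Qed.

(** Outside the image of [h] the eigenbasis consists of coordinate vectors with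
    eigenvalue 0. *)
Lemma eigenbasis_injective S T (h : S -> T) (b u : S -> S -> R) d (a : T -> T -> R) :
  injective h -> symmetric_kernel a -> (forall s t, a (h s) (h t) = b s t) ->
  (forall x y, x \notin codom h -> a x y = 0) -> eigenbasis b u d ->
  exists U D, [/\ eigenbasis a U D,
     forall s, D (h s) = d s /\ (forall t, U (h s) (h t) = u s t),
     forall s x, x \notin codom h -> U (h s) x = 0 &
     forall i, i \notin codom h -> D i = 0 /\ U i =1 (fun x => (i == x)%:R)].
Proof.
move=> hi sa ab a0 [ou bu].
pose inv x := [pick s | h s == x].
have invh s : inv (h s) = Some s.
  by rewrite /inv; case: pickP => [t /eqP/hi->//|/(_ s)]; rewrite eqxx.
have invN x : x \notin codom h -> inv x = None.
  by rewrite /inv; case: pickP => // s /eqP <-; rewrite codom_f.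
pose U i x := match inv i, inv x with
  | Some s, Some t => u s t | Some _, None => 0 | None, _ => (i == x)%:R end.
pose D i := if inv i is Some s then d s else 0.
have Uh s t : U (h s) (h t) = u s t by rewrite /U !invh.
have UhN s x : x \notin codom h -> U (h s) x = 0 by move=> /invN e; rewrite /U invh e.
have UN i x : i \notin codom h -> U i x = (i == x)%:R by move=> /invN e; rewrite /U e.
exists U, D; split; first split.
- move=> i j.
  have [/codomP[s ->]|ni] := boolP (i \in codom h).
    rewrite (sum_injective hi); last by move=> x nx; rewrite UhN ?mul0r.
    have [/codomP[t ->]|nj] := boolP (j \in codom h).
      by rewrite (inj_eq hi) -ou; apply: eq_bigr => x _; rewrite !Uh.
    rewrite big1 => [|x _]; last first.
      by rewrite [X in _ * X]UN //; case: eqP nj => [->|]; rewrite ?codom_f ?mulr0.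
    by case: eqP nj => // <-; rewrite codom_f.
  under eq_bigr do rewrite UN // mulrC.
  rewrite sum_deltaC.
  have [/codomP[t ->]|nj] := boolP (j \in codom h).
    by rewrite UhN //; case: eqP ni => // ->; rewrite codom_f.
  by rewrite UN // eq_sym.
- move=> i x.
  have [/codomP[s ->]|ni] := boolP (i \in codom h).
    rewrite (sum_injective hi); last by move=> y ny; rewrite UhN ?mulr0.
    rewrite /D invh.
    have [/codomP[t ->]|nx] := boolP (x \in codom h).
      by rewrite Uh -bu; apply: eq_bigr => y _; rewrite Uh ab.
    rewrite UhN // mulr0 big1 // => y _; rewrite a0 ?mul0r //.
  under eq_bigr do rewrite UN //.
  by rewrite sum_deltaC sa a0 // /D invN // mul0r.
- by move=> s; split=> //; rewrite /D invh.
- by [].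
- by move=> i ni; split=> [|x]; rewrite ?UN // /D invN.
Qed.

Lemma energy_injective S T (h : S -> T) (b : S -> S -> R) (a : T -> T -> R) f :
  injective h -> symmetric_kernel a -> (forall s t, a (h s) (h t) = b s t) ->
  (forall x y, x \notin codom h -> a x y = 0) -> f 0 = 0 ->
  energy f a = energy f b.
Proof.
move=> hi sa ab a0 f0.
have sb : symmetric_kernel b by move=> s t; rewrite -!ab.
have [u [d eb]] := eigenbasis_exists sb.
have [U [D [EB Dh _ DN]]] := eigenbasis_injective hi sa ab a0 eb.
rewrite (energyE f EB sa) (energyE f eb sb) (sum_injective hi).
  by apply: eq_bigr => s _; have [-> _] := Dh s.
by move=> i /DN[-> _].
Qed.

Lemma induced_symmetric T (X : {set T}) (a : T -> T -> R) :
  symmetric_kernel a -> symmetric_kernel (induced X a).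
Proof. by move=> sa x y; rewrite /induced andbC sa. Qed.

(** An eigenbasis of an induced kernel can be chosen as one of the small kernel
    on [X] completed by the coordinate vectors off [X]. *)
Definition supported_basis T (X : {set T}) (a u : T -> T -> R) d :=
  [/\ eigenbasis (induced X a) u d, forall i x, i \in X -> x \notin X -> u i x = 0 &
      forall i, i \notin X -> d i = 0 /\ forall x, u i x = (i == x)%:R].

Lemma supported_basis_exists T (X : {set T}) (a : T -> T -> R) :
  symmetric_kernel a -> exists u d, supported_basis X a u d.
Proof.
move=> sa; pose h (s : {x | x \in X}) := val s.
pose b s t := a (h s) (h t).
have sb : symmetric_kernel b by move=> s t; rewrite /b.
have [u [d eb]] := eigenbasis_exists sb.
have cod x : (x \in codom h) = (x \in X).
  apply/codomP/idP => [[s ->]|xX]; first exact: (valP s).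
  by exists (exist _ x xX).
have [| | |U [D [EB Dh UhN DN]]] :=
  @eigenbasis_injective _ _ h b u d (induced X a) val_inj _ _ _ eb.
- exact: induced_symmetric.
- by move=> s t; rewrite /induced (valP s) (valP t).
- by move=> x y; rewrite cod /induced => /negPf->.
exists U, D; split=> // [k x kX xX|k kX].
  by rewrite -[k]/(h (exist _ k kX)) UhN ?cod.
by apply: DN; rewrite cod.
Qed.

Lemma supported_energy T (X : {set T}) (a u : T -> T -> R) d f :
  symmetric_kernel a -> f 0 = 0 -> supported_basis X a u d ->
  energy f (induced X a) = \sum_(i in X) f (d i).
Proof.
move=> sa f0 [eb _ dN]; rewrite (energyE f eb); last exact: induced_symmetric.
by rewrite [RHS]big_mkcond; apply: eq_bigr => i _; case: ifPn => // /dN[->].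
Qed.

Lemma form_induced T (A X : {set T}) (a : T -> T -> R) v : A \subset X ->
  (forall x, x \notin A -> v x = 0) -> qform (induced X a) v v = qform (induced A a) v v.
Proof.
move=> AX vA; apply: eq_bigr => x _; apply: eq_bigr => y _; rewrite /induced.
have [xA|/vA->] := boolP (x \in A); last by rewrite !mul0r.
have [yA|/vA->] := boolP (y \in A); last by rewrite !mulr0.
by rewrite !(subsetP AX).
Qed.

Lemma glued_basis T (A B : {set T}) (a b u v : T -> T -> R) d e :
  [disjoint A & B] -> supported_basis A a u d -> supported_basis B b v e ->
  onb (fun i => if i \in A then u i else if i \in B then v i else fun x => (i == x)%:R).
Proof.
move=> dAB [[ou _] uA _] [[ov _] vB _].
have nB i : i \in A -> i \notin B by move/disjointFr: dAB => h /h ->.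
have nA i : i \in B -> i \notin A by move/disjointFl: dAB => h /h ->.
set w := fun i => _.
have wA i : i \in A -> w i = u i by rewrite /w => ->.
have wB i : i \in B -> w i = v i by move=> iB; rewrite /w iB (negPf (nA _ iB)).
have wN i : i \notin A -> i \notin B -> w i = fun x => (i == x)%:R.
  by rewrite /w => /negPf-> /negPf->.
have sw i j : (\sum_x w i x * w j x == (i == j)%:R) = (\sum_x w j x * w i x == (j == i)%:R).
  by rewrite eq_sym [i == j]eq_sym; under eq_bigr do rewrite mulrC; rewrite eq_sym.
have AB i j : i \in A -> j \in B -> \sum_x w i x * w j x == (i == j)%:R.
  move=> iA jB; rewrite wA // wB // big1 => [|x _].
    by case: (i =P j) => [ij|_]; rewrite ?eqxx //; move: jB; rewrite -ij (negPf (nB _ iA)).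
  by have [/nB xB|xA] := boolP (x \in A); [rewrite vB ?mulr0|rewrite uA ?mul0r].
have NN i j : i \notin A -> i \notin B -> \sum_x w i x * w j x == (i == j)%:R.
  move=> iA iB; rewrite (wN i) //; under eq_bigr do rewrite mulrC.
  rewrite sum_deltaC.
  have [jA|jA] := boolP (j \in A).
    by rewrite wA // uA //; case: (i =P j) iA => [->|]; rewrite ?jA ?eqxx.
  have [jB|jB] := boolP (j \in B).
    by rewrite wB // vB //; case: (i =P j) iB => [->|]; rewrite ?jB ?eqxx.
  by rewrite wN // [j == i]eq_sym.
move=> i j; apply/eqP.
have [iA|iA] := boolP (i \in A).
  have [jA|jA] := boolP (j \in A); first by rewrite !wA // ou.
  have [jB|jB] := boolP (j \in B); first exact: AB.
  by rewrite sw NN.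
have [iB|iB] := boolP (i \in B); last exact: NN.
have [jA|jA] := boolP (j \in A); first by rewrite sw AB.
have [jB|jB] := boolP (j \in B); first by rewrite !wB // ov.
by rewrite sw NN.
Qed.

(** Peierls' inequality in the union of eigenbases of the two diagonal blocks;
    the remaining coordinate vectors contribute nonnegative terms. *)
Lemma pinching T (A B X : {set T}) (a : T -> T -> R) f g :
  symmetric_kernel a -> tangent f g -> f 0 = 0 -> (forall x, 0 <= f x) ->
  A \subset X -> B \subset X -> [disjoint A & B] ->
  energy f (induced A a) + energy f (induced B a) <= energy f (induced X a).
Proof.
move=> sa fg f0 fge AX BX dAB.
have [u [d sbA]] := supported_basis_exists A sa.
have [v [e sbB]] := supported_basis_exists B sa.
rewrite (supported_energy sa f0 sbA) (supported_energy sa f0 sbB).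
have nA i : i \in B -> i \in A = false by move/disjointFl: dAB => h /h ->.
have ow := glued_basis dAB sbA sbB.
have [ebA uA _] := sbA; have [ebB vB _] := sbB.
apply: le_trans (peierls fg (induced_symmetric X sa) ow).
rewrite [in leRHS](bigID [in A]) /=; apply: lerD.
  apply: ler_sum => i iA; rewrite iA (form_induced _ AX) => [|x]; last exact: uA.
  by rewrite (eigenbasis_form ebA) eqxx mulr1.
rewrite [in leRHS](bigID [in B]) /= -[leLHS]addr0; apply: lerD; last exact: sumr_ge0.
rewrite [leLHS](eq_bigl (fun i => (i \notin A) && (i \in B))); last first.
  by move=> i; case: (boolP (i \in B)) => [/nA->|]; rewrite ?andbF.
apply: ler_sum => i /andP[_ iB]; rewrite iB nA // (form_induced _ BX) => [|x]; last exact: vB.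
by rewrite (eigenbasis_form ebB) eqxx mulr1.
Qed.

Lemma energy_split T (A B : {set T}) (a : T -> T -> R) f :
  symmetric_kernel a -> f 0 = 0 -> [disjoint A & B] ->
  (forall x y, x \in A -> y \in B -> a x y = 0) ->
  energy f (induced (A :|: B) a) = energy f (induced A a) + energy f (induced B a).
Proof.
move=> sa f0 dAB a0.
have [u [d sbA]] := supported_basis_exists A sa.
have [v [e sbB]] := supported_basis_exists B sa.
rewrite (supported_energy sa f0 sbA) (supported_energy sa f0 sbB).
have nA i : i \in B -> i \in A = false by move/disjointFl: dAB => h /h ->.
have nB i : i \in A -> i \in B = false by move/disjointFr: dAB => h /h ->.
have ow := glued_basis dAB sbA sbB.
have [[_ au] uA uN] := sbA; have [[_ av] vB vN] := sbB.
have split_kernel x y : induced (A :|: B) a x y = induced A a x y + induced B a x y.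
  rewrite /induced !inE.
  have [xA|xA] := boolP (x \in A); have [yA|yA] := boolP (y \in A);
    rewrite ?(nB _ xA) ?(nB _ yA) /= ?andbF ?orbF ?addr0 ?add0r //.
    by case: ifP => // yB; rewrite a0.
  by case: ifP => // /andP[xB _]; rewrite sa a0.
have ew : eigenbasis (induced (A :|: B) a)
    (fun i => if i \in A then u i else if i \in B then v i else fun x => (i == x)%:R)
    (fun i => if i \in A then d i else if i \in B then e i else 0).
  split; first exact: ow.
  move=> i x; under eq_bigr do rewrite split_kernel mulrDl.
  rewrite big_split /=; case: ifP => [iA|/negbT niA]; last case: ifP => [iB|/negbT niB].
  - rewrite au big1 ?addr0 // => y _; rewrite /induced.
    by case: ifP => [/andP[_ yB]|_]; rewrite ?mul0r // uA ?mulr0 // nA.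
  - rewrite av big1 ?add0r // => y _; rewrite /induced.
    by case: ifP => [/andP[_ yA]|_]; rewrite ?mul0r // vB ?mulr0 // nB.
  rewrite mul0r !sum_deltaC /induced (negPf niA) (negPf niB) !andbF addr0 //.
rewrite (energyE f ew (induced_symmetric _ sa)).
rewrite (bigID [in A]) /=; congr (_ + _); first by apply: eq_bigr => i ->.
rewrite (bigID [in B]) /= [X in _ + X]big1 ?addr0 => [|i /andP[/negPf-> /negPf->]//].
rewrite (eq_bigl [in B]) => [|i]; last by case: (boolP (i \in B)) => [/nA->|]; rewrite ?andbF.
by apply: eq_bigr => i iB; rewrite nA ?iB.
Qed.

(** Normalised, the [v i] have squared coordinates [w i j] in an eigenbasis with
    row sums 1 and, by Bessel's inequality, column sums at most 1; and [w i j]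
    vanishes unless [l i] is the [j]-th eigenvalue. *)
Lemma energy_ge_orthogonal T (I : finType) (a : T -> T -> R) (v : I -> T -> R) l f :
  symmetric_kernel a -> (forall x, 0 <= f x) ->
  (forall i j, i != j -> \sum_x v i x * v j x = 0) ->
  (forall i, 0 < \sum_x v i x ^+ 2) ->
  (forall i x, \sum_y a x y * v i y = l i * v i x) ->
  \sum_i f (l i) <= energy f a.
Proof.
move=> sa fge ov vp av; have [u [d eb]] := eigenbasis_exists sa.
have [ou au] := eb; rewrite (energyE f eb sa).
pose c i j := \sum_x v i x * u j x; pose q i := \sum_x v i x ^+ 2.
pose w i j := c i j ^+ 2 / q i.
have w1 i : \sum_j w i j = 1.
  by rewrite -mulr_suml sqnorm_coords // divff // gt_eqF.
have w2 j : \sum_i w i j <= 1.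
  pose r x := u j x - \sum_i (c i j / q i) * v i x.
  have : 0 <= \sum_x r x ^+ 2 by apply: sumr_ge0 => x _; exact: sqr_ge0.
  have -> : \sum_x r x ^+ 2 = 1 - \sum_i w i j; last by rewrite subr_ge0.
  pose s x := \sum_i (c i j / q i) * v i x.
  have e1 : \sum_x u j x * s x = \sum_i w i j.
    under eq_bigr do rewrite mulr_sumr.
    rewrite exchange_big; apply: eq_bigr => i _; rewrite /w /=.
    transitivity (c i j / q i * \sum_x v i x * u j x); last by rewrite -/(c i j) mulrAC expr2.
    by rewrite mulr_sumr; apply: eq_bigr => x _; ring.
  have e2 : \sum_x s x * s x = \sum_i w i j.
    transitivity (\sum_i c i j / q i * \sum_x v i x * s x).
      under eq_bigr do rewrite {1}/s mulr_suml.
      rewrite exchange_big; apply: eq_bigr => i _ /=.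
      by rewrite mulr_sumr; apply: eq_bigr => x _; rewrite mulrA.
    apply: eq_bigr => i _.
    have -> : \sum_x v i x * s x = c i j.
      under eq_bigr do rewrite mulr_sumr.
      rewrite exchange_big /= (bigD1 i) //= [X in _ + X]big1 => [|k ki].
        transitivity (c i j / q i * \sum_x v i x ^+ 2); last by rewrite divfK // gt_eqF ?vp.
        by rewrite addr0 mulr_sumr; apply: eq_bigr => x _; ring.
      transitivity (c k j / q k * \sum_x v i x * v k x); last first.
        by rewrite ov ?mulr0 // eq_sym.
      by rewrite mulr_sumr; apply: eq_bigr => x _; ring.
    by rewrite /w mulrAC expr2.
  transitivity (\sum_x (u j x * u j x - u j x * s x *+ 2 + s x * s x)).
    by apply: eq_bigr => x _; rewrite /r -/(s x) mulr2n; move: (u j x) (s x) => p t; ring.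
  rewrite big_split sumrB sumrMnl /= e1 e2 ou eqxx mulr2n (_ : true%:R = 1) //.
  move: (\sum_i w i j) => t; ring.
have w0 i j : 0 <= w i j by rewrite divr_ge0 ?sqr_ge0 // ltW ?vp.
have wl i j : w i j * f (l i) = w i j * f (d j).
  have [->//|ne] := eqVneq (d j) (l i).
  suff -> : w i j = 0 by rewrite !mul0r.
  rewrite /w (_ : c i j = 0) ?expr0n ?mul0r //.
  have : d j * c i j = l i * c i j.
    transitivity (qform a (v i) (u j)).
      rewrite /qform /c mulr_sumr; apply: eq_bigr => x _.
      by rewrite mulrCA -au mulr_sumr; apply: eq_bigr => y _; rewrite mulrA.
    rewrite /qform /c mulr_sumr exchange_big; apply: eq_bigr => y _ /=.
    by rewrite mulrA -av mulr_suml; apply: eq_bigr => x _; rewrite sa [v i x * _]mulrC.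
  move/eqP; rewrite -subr_eq0 -mulrBl mulf_eq0 subr_eq0 (negPf ne) /=.
  by move/eqP.
have -> : \sum_i f (l i) = \sum_j (\sum_i w i j) * f (d j).
  transitivity (\sum_i \sum_j w i j * f (d j)).
    apply: eq_bigr => i _; rewrite -[LHS]mul1r -(w1 i) mulr_suml.
    by apply: eq_bigr => j _; rewrite wl.
  by rewrite exchange_big; apply: eq_bigr => j _; rewrite mulr_suml.
by apply: ler_sum => j _; rewrite -[leRHS]mul1r ler_wpM2r.
Qed.

(** The diagonal sign matrix conjugates [a] to [- a]; for a bipartite graph [s]
    is the 2-colouring. *)
Lemma energy_signed T (a : T -> T -> R) (s : T -> R) f :
  symmetric_kernel a -> (forall x, s x * s x = 1) ->
  (forall x y, s x * s y * a x y = - a x y) ->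
  energy f a = energy (fun x => f (- x)) a.
Proof.
move=> sa s1 sN; have [u [d eb]] := eigenbasis_exists sa.
have [ou au] := eb; rewrite (energyE (fun x => f (- x)) eb sa).
apply: (@energyE _ _ f a (fun i x => s x * u i x) (fun i => - d i)) => //; split.
  move=> i j; rewrite -ou; apply: eq_bigr => x _.
  by rewrite mulrACA s1 mul1r.
move=> i x; transitivity (- s x * \sum_y a x y * u i y); last by rewrite au; ring.
rewrite mulr_sumr; apply: eq_bigr => y _.
have -> : a x y * (s y * u i y) = s x * (s x * s y * a x y) * u i y.
  by rewrite -[LHS]mul1r -(s1 x); ring.
by rewrite sN; ring.
Qed.

(** The vector [w] fails to be an eigenvector only at the coordinate [e].
    Expanding in the eigenbasis turns the defect [(a - l) w = c delta_e] into
    the divided difference of [phi] with base point [l]. *)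
Lemma slope_engine T (a u : T -> T -> R) d (w : T -> R) (l c : R) e k phi (psi : R -> R) :
  eigenbasis a u d -> symmetric_kernel a -> w k = 0 ->
  (forall x, \sum_y a x y * w y = l * w x + c * (x == e)%:R) ->
  (forall t, psi t * (t - l) = phi t - phi l) ->
  \sum_y kcalc phi u d k y * w y = c * kcalc psi u d k e.
Proof.
move=> [ou au] sa wk aw psiE; rewrite /kcalc.
pose z i := \sum_y u i y * w y.
have zE i : (d i - l) * z i = c * u i e.
  rewrite mulrBl /z; apply/eqP; rewrite subr_eq; apply/eqP.
  transitivity (\sum_x u i x * \sum_y a x y * w y).
    under [RHS]eq_bigr do rewrite mulr_sumr.
    rewrite exchange_big mulr_sumr; apply: eq_bigr => y _ /=.
    rewrite mulrA -au mulr_suml; apply: eq_bigr => x _; rewrite sa; ring.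
  under eq_bigr do rewrite aw mulrDr.
  rewrite big_split /= addrC; congr (_ + _).
    transitivity (\sum_x c * u i x * (x == e)%:R); last by rewrite sum_delta.
    by apply: eq_bigr => x _; ring.
  by rewrite mulr_sumr; apply: eq_bigr => x _; ring.
have z0 : \sum_i u i k * z i = 0.
  rewrite -[RHS]wk -[RHS](sum_deltaC w k) /z.
  under eq_bigr do rewrite mulr_sumr.
  rewrite exchange_big; apply: eq_bigr => y _ /=.
  rewrite -(onb_dual ou) mulr_sumr; apply: eq_bigr => i _; ring.
transitivity (\sum_i phi (d i) * u i k * z i).
  under eq_bigr do rewrite mulr_suml.
  rewrite exchange_big; apply: eq_bigr => i _ /=.
  by rewrite /z mulr_sumr; apply: eq_bigr => y _; ring.
transitivity (\sum_i (phi (d i) - phi l) * u i k * z i).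
  under [RHS]eq_bigr do rewrite !mulrBl -[X in _ - X]mulrA.
  by rewrite sumrB -mulr_sumr z0 mulr0 subr0.
rewrite mulr_sumr; apply: eq_bigr => i _; rewrite -psiE.
transitivity (psi (d i) * u i k * ((d i - l) * z i)); first by ring.
by rewrite zE; ring.
Qed.

End Masks.

(** * Powers of the positive part and divided differences *)

Section Powers.
Variable R : realType.

Implicit Types (p x y l s t : R) (phi dphi : R -> R).

(** The power function extended by 0 to the nonpositive reals, which turns the
    positive energy into a sum over all eigenvalues. *)
Definition posp (p x : R) : R := if 0 < x then x `^ p else 0.
Definition dposp (p x : R) : R := p * posp (p - 1) x.

Lemma posp0 p : posp p 0 = 0. Proof. by rewrite /posp ltxx. Qed.
Lemma pospE p x : 0 < x -> posp p x = x `^ p. Proof. by rewrite /posp => ->. Qed.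
Lemma posp_neg p x : x <= 0 -> posp p x = 0. Proof. by rewrite /posp ltNge => ->. Qed.
Lemma posp_ge0 p x : 0 <= posp p x.
Proof. by rewrite /posp; case: ifP => // _; exact: powR_ge0. Qed.

(** Young's inequality for the product of [t] and 1 with conjugate exponents [r]
    and [r / (r - 1)]. *)
Lemma powR_bernoulli (r t : R) : 1 <= r -> 0 <= t -> 1 + r * (t - 1) <= t `^ r.
Proof.
move=> r1 t0; have [->|rn1] := eqVneq r 1; first by rewrite powRr1 // mul1r addrC subrK.
have r1' : 1 < r by rewrite lt_def rn1.
have r0 : 0 < r by apply: lt_le_trans r1.
have rr : r - 1 != 0 by rewrite subr_eq0.
have := @conjugate_powR R t 1 r (r / (r - 1)) t0 ler01 r0.
rewrite divr_gt0 ?subr_gt0 // => /(_ isT).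
rewrite invf_div powR1 mulr1.
have -> : r^-1 + (r - 1) / r = 1 by field; rewrite gt_eqF.
move/(_ erefl) => h.
have : t * r <= (t `^ r / r + 1 * ((r - 1) / r)) * r by rewrite ler_pM2r.
have -> : (t `^ r / r + 1 * ((r - 1) / r)) * r = t `^ r + r - 1.
  by field; rewrite gt_eqF.
by move=> h'; lra.
Qed.

Lemma powR_tangent (r x y : R) : 1 <= r -> 0 < x -> 0 <= y ->
  x `^ r + r * x `^ (r - 1) * (y - x) <= y `^ r.
Proof.
move=> r1 x0 y0; have r0 : 0 < r by apply: lt_le_trans r1.
have -> : y `^ r = x `^ r * (y / x) `^ r.
  by rewrite -powRM ?(divr_ge0 y0) // ?(ltW x0) // mulrCA divff ?mulr1 // gt_eqF.
have := powR_bernoulli r1 (divr_ge0 y0 (ltW x0)).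
move/(ler_wpM2l (powR_ge0 x r)); apply: le_trans.
rewrite le_eqVlt; apply/orP; left; apply/eqP.
rewrite -(mulr_powRB1 (ltW x0) r0); move: (x `^ (r - 1)) => z.
by field; rewrite gt_eqF.
Qed.

Lemma posp_tangent (p : R) : 1 <= p -> tangent (posp p) (dposp p).
Proof.
move=> p1 x y; have p0 : 0 < p by apply: lt_le_trans p1.
have [x0|x0] := leP x 0.
  by rewrite /dposp !(posp_neg _ x0) mulr0 mul0r addr0 posp_ge0.
rewrite /dposp !(pospE _ x0); have [y0|y0] := leP y 0; last first.
  by rewrite (pospE _ y0) powR_tangent // ltW.
rewrite posp_neg // -(mulr_powRB1 (ltW x0) p0).
have z0 := powR_ge0 x (p - 1); move: (x `^ _) z0 => z z0.
have -> : x * z + p * z * (y - x) = z * (p * y - (p - 1) * x) by ring.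
have h1 : p * y <= 0 by rewrite mulr_ge0_le0 // ltW.
have h2 : 0 <= (p - 1) * x by rewrite mulr_ge0 ?subr_ge0 // ltW.
by apply: mulr_ge0_le0 => //; lra.
Qed.

Lemma dposp_tangent (p : R) : 2 <= p -> tangent (dposp p) (fun x => p * dposp (p - 1) x).
Proof.
move=> p2 x y; rewrite /dposp -mulrA -mulrDr ler_pM2l; last by lra.
by apply: posp_tangent; lra.
Qed.

Lemma ddposp_tangent (p : R) : 3 <= p ->
  tangent (fun x => p * dposp (p - 1) x) (fun x => p * ((p - 1) * dposp (p - 1 - 1) x)).
Proof.
move=> p3 x y; rewrite -mulrA -mulrDr ler_pM2l; last by lra.
by apply: dposp_tangent; lra.
Qed.

Lemma posp_euler p x : 1 <= p -> dposp p x * x = p * posp p x.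
Proof.
move=> p1; rewrite /dposp /posp; case: ifP => [x0|_]; last by rewrite !mulr0 mul0r.
by rewrite -mulrA [_ * x]mulrC mulr_powRB1 ?ltW //; lra.
Qed.

Lemma posp_le (p x y : R) : 0 <= p -> x <= y -> posp p x <= posp p y.
Proof.
move=> p0 xy; have [x0|x0] := leP x 0; first by rewrite (posp_neg _ x0) posp_ge0.
have y0 : 0 < y by apply: lt_le_trans xy.
by rewrite !pospE // ge0_ler_powR ?nnegrE // ltW.
Qed.

Lemma dposp_ge0 p x : 0 <= p -> 0 <= dposp p x.
Proof. by move=> p0; rewrite mulr_ge0 ?posp_ge0. Qed.

Lemma posp_sqr (p x : R) : 0 < x -> posp (p / 2) (x ^+ 2) = posp p x.
Proof.
move=> x0; rewrite !pospE ?exprn_gt0 //.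
rewrite -powR_mulrn ?ltW // -powRrM; congr (_ `^ _).
by rewrite mulrCA divff ?mulr1 // pnatr_eq0.
Qed.

Definition adjk (G : sgraph) (x y : G) : R := (adj x y)%:R.

Lemma adjk_symmetric (G : sgraph) : symmetric_kernel (@adjk G).
Proof. by move=> x y; rewrite /adjk adj_sym. Qed.

Lemma pos_energyE p (G : sgraph) : pos_energy p G = energy (posp p) (@adjk G).
Proof.
rewrite /pos_energy big_mkcond /energy.
by have -> : kernel_mx (@adjk G) = adjmx R G by [].
Qed.

Lemma ler_rearrange (a b c d : R) : d - c = b - a -> a <= b -> c <= d.
Proof. by move=> e; rewrite -subr_ge0 -e subr_ge0. Qed.

(** The divided difference of [phi] with nodes [l] and [t], continued by [dphi]
    on the diagonal. *)
Definition slope (phi dphi : R -> R) (l t : R) : R :=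
  if t == l then dphi l else (phi t - phi l) / (t - l).

Lemma slopeE phi dphi l t : slope phi dphi l t * (t - l) = phi t - phi l.
Proof.
rewrite /slope; case: eqVneq => [->|tl]; first by rewrite !subrr mulr0.
by rewrite divfK // subr_eq0.
Qed.

Lemma slopeC phi dphi l t : slope phi dphi l t = slope phi dphi t l.
Proof.
rewrite /slope eq_sym; case: eqVneq => [->//|tl].
by rewrite -opprB -[t - l]opprB invrN mulrNN.
Qed.

Lemma tangent_mono phi dphi : tangent phi dphi -> forall x y, x <= y -> dphi x <= dphi y.
Proof.
move=> h x y; rewrite le_eqVlt => /orP[/eqP->//|xy].
have := lerD (h x y) (h y x) => {}h.
have : (dphi x - dphi y) * (y - x) <= 0 by lra.
by rewrite pmulr_lle0 ?subr_gt0 // subr_le0.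
Qed.

Lemma slope_bounds phi dphi l t : tangent phi dphi -> l <= t ->
  dphi l <= slope phi dphi l t <= dphi t.
Proof.
move=> h lt; rewrite /slope; case: eqVneq => [->|tl]; first by rewrite lexx.
have ltt : 0 < t - l by rewrite subr_gt0 lt_def tl.
rewrite ler_pdivlMr // ler_pdivrMr //; have := h l t; have := h t l.
by move=> h1 h2; apply/andP; split; lra.
Qed.

(** Three-chord inequality: in each relative position of [s], [t] and [l],
    combine the tangent inequalities at one of the points. *)
Lemma slope_mono phi dphi l : tangent phi dphi -> forall s t, s <= t ->
  slope phi dphi l s <= slope phi dphi l t.
Proof.
move=> h s t st.
have [sl|ls] := leP s l.
  have [lt|tl] := leP l t.
    have /andP[h1 h2] := slope_bounds h lt.
    by have /andP[] := slope_bounds h sl; rewrite slopeC => _ /le_trans; apply.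
  have ls : 0 < l - s by rewrite subr_gt0 (le_lt_trans st).
  have tl' : 0 < l - t by rewrite subr_gt0.
  rewrite (slopeC _ _ l s) (slopeC _ _ l t) /slope !gt_eqF ?(le_lt_trans st) //.
  rewrite ler_pdivrMr // mulrAC ler_pdivlMr //.
  have st' : 0 <= t - s by rewrite subr_ge0.
  have h1 := ler_wpM2r (ltW tl') (h t s); have h2 := ler_wpM2r st' (h t l).
  apply: ler_rearrange (lerD h1 h2); ring.
have lt := lt_le_trans ls st.
rewrite /slope !gt_eqF // ler_pdivrMr ?subr_gt0 // mulrAC ler_pdivlMr ?subr_gt0 //.
have tl' : 0 <= t - s by rewrite subr_ge0.
have sl' : 0 <= s - l by rewrite subr_ge0 ltW.
have h1 := ler_wpM2r sl' (h s t); have h2 := ler_wpM2r tl' (h s l).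
apply: ler_rearrange (lerD h1 h2); ring.
Qed.

End Powers.

(** * Rotating a coupling vector *)

Section Rotation.
Variable R : realType.
Implicit Types (phi dphi ddphi f g : R -> R).

Lemma norm_sin_le (x : R) : 0 <= x -> `|sin x| <= x.
Proof.
move=> x0; have [|c _] := @MVT_segment R sin cos 0 x x0 (fun y _ => is_derive_sin y).
  by apply/continuous_subspaceT => y; exact: continuous_sin.
rewrite sin0 !subr0 => ->.
by rewrite normrM (ger0_norm x0) ler_piMl // cos_max.
Qed.

Lemma one_sub_cos_le (x : R) : 0 <= x -> 1 - cos x <= x ^+ 2 / 2.
Proof.
move=> x0; have x20 : 0 <= x / 2 by rewrite divr_ge0.
have -> : cos x = 1 - 2 * sin (x / 2) ^+ 2.
  rewrite {1}(_ : x = (x / 2) *+ 2); last by rewrite -mulr_natr divfK ?pnatr_eq0.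
  by rewrite cos_mulr2n cos2sin2 mulr2n; ring.
have s1 := norm_sin_le x20.
have : sin (x / 2) ^+ 2 <= (x / 2) ^+ 2.
  by rewrite -[leLHS]real_normK ?num_real // ler_pXn2r ?nnegrE ?normr_ge0.
by rewrite expr_div_n; lra.
Qed.

Lemma ler_vanishing (x y c : R) : (forall N : nat, x <= y + c / N.+1%:R) -> x <= y.
Proof.
move=> h; rewrite leNgt; apply/negP => yx.
have d0 : 0 < x - y by rewrite subr_gt0.
(* The archimedean property gives an index at which the error is smaller than
   the gap. *)
pose N := Num.Def.truncn (`|c| / (x - y)).
have hN : `|c| / (x - y) < N.+1%:R by rewrite truncnS_gt.
have N0 : 0 < N.+1%:R :> R by rewrite ltr0Sn.
have := h N; apply/negP; rewrite -ltNge -ltrBrDl ltr_pdivrMr //.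
rewrite ltr_pdivrMr // mulrC in hN; apply: le_lt_trans hN; exact: ler_norm.
Qed.

(** Riemann sum of the integral representation of the divided difference as a
    mean of [dphi] over the segment from [x] to [l]. *)
Definition riemann_slope dphi (N : nat) (x l : R) : R :=
  (\sum_(k < N.+1) dphi (x + (k%:R / N.+1%:R) * (l - x))) / N.+1%:R.

(** On each subinterval the increment of [phi] lies between the values of [dphi]
    at the ends times the length, and these bounds telescope. *)
Lemma riemann_slopeP phi dphi N x l : tangent phi dphi ->
  `|slope phi dphi l x - riemann_slope dphi N x l| <= `|dphi l - dphi x| / N.+1%:R.
Proof.
move=> h; have N0 : 0 < N.+1%:R :> R by rewrite ltr0Sn.
set r := riemann_slope _ _ _ _.
pose y (k : nat) := x + (k%:R / N.+1%:R) * (l - x).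
pose s := (l - x) / N.+1%:R.
have ys k : y k.+1 = y k + s by rewrite /y /s -natr1 !mulrDl mul1r addrA [_ / _ + _]addrC; ring.
have y0 : y 0%N = x by rewrite /y mul0r mul0r addr0.
have yN : y N.+1 = l by rewrite /y divff ?gt_eqF // mul1r addrC subrK.
have rE : r * (l - x) = \sum_(k < N.+1) dphi (y k) * s.
  by rewrite /r /riemann_slope -mulr_suml /s mulrAC mulrA.
have tel (F : R -> R) : \sum_(k < N.+1) (F (y k.+1) - F (y k)) = F l - F x.
  by rewrite -yN -y0 -(telescope_sumr (fun k => F (y k))) // big_mkord.
have lo : r * (l - x) <= phi l - phi x.
  rewrite rE -tel; apply: ler_sum => k _; rewrite ys.
  by have := h (y k) (y k + s); rewrite addrAC subrr add0r; lra.
have hi : phi l - phi x <= r * (l - x) + (dphi l - dphi x) * s.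
  rewrite rE -!tel mulr_suml -big_split /=; apply: ler_sum => k _; rewrite ys.
  have := h (y k + s) (y k); rewrite opprD addrA subrr add0r => h1.
  rewrite -mulrDl [dphi (y k) + _]addrC subrK; lra.
have [lx|xl] := eqVneq l x.
  rewrite /r /riemann_slope /slope lx eqxx !subrr normr0 mul0r.
  under eq_bigr do rewrite mulr0 addr0.
  by rewrite sumr_const card_ord -[X in X / _]mulr_natr mulfK ?gt_eqF // subrr normr0.
have d0 : 0 < `|l - x| by rewrite normr_gt0 subr_eq0.
rewrite -(ler_pM2r d0) -normrM mulrBl.
have -> : slope phi dphi l x * (l - x) = phi l - phi x by rewrite slopeC slopeE.
rewrite [leRHS]mulrAC -[leRHS]/(_ * _ / _) -(normrM (dphi l - dphi x)).
rewrite ger0_norm ?subr_ge0 //.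
apply: le_trans (_ : (dphi l - dphi x) * s <= _); first by rewrite lerBlDl.
by rewrite /s mulrA ler_pM2r ?invr_gt0 // ler_norm.
Qed.

(** If [dphi] is convex then so is the divided difference as a function of one
    node, being a mean of values of [dphi] at points that depend affinely on it.
    Riemann sums replace the integral. *)
Lemma slope_jensen (I : finType) (w e : I -> R) phi dphi ddphi x :
  tangent phi dphi -> tangent dphi ddphi ->
  (forall i, 0 <= w i) -> \sum_i w i = 1 ->
  slope phi dphi (\sum_i w i * e i) x <= \sum_i w i * slope phi dphi (e i) x.
Proof.
move=> h1 h2 w0 w1; set m := \sum_i w i * e i.
apply: (@ler_vanishing _ _ (`|dphi m - dphi x| + \sum_i w i * `|dphi (e i) - dphi x|)).
move=> N; have N0 : 0 < N.+1%:R :> R by rewrite ltr0Sn.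
have := riemann_slopeP N x m h1; rewrite ler_norml => /andP[_ hm].
have {}hm : slope phi dphi m x <= riemann_slope dphi N x m + `|dphi m - dphi x| / N.+1%:R.
  by rewrite -lerBlDl.
apply: le_trans hm _; rewrite mulrDl addrCA [leLHS]addrC lerD2l.
have hj : riemann_slope dphi N x m <= \sum_i w i * riemann_slope dphi N x (e i).
  rewrite /riemann_slope; under [leRHS]eq_bigr do rewrite mulrA mulr_sumr.
  rewrite -mulr_suml ler_pM2r ?invr_gt0 // exchange_big; apply: ler_sum => k _ /=.
  have -> : x + k%:R / N.+1%:R * (m - x) = \sum_i w i * (x + k%:R / N.+1%:R * (e i - x)).
    transitivity (\sum_i (w i * (x - k%:R / N.+1%:R * x) + k%:R / N.+1%:R * (w i * e i))).
      rewrite big_split /= -mulr_suml w1 mul1r -mulr_sumr -/m; ring.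
    by apply: eq_bigr => i _; ring.
  exact: tangent_jensen h2 w0 w1.
apply: le_trans hj _; rewrite mulr_suml -big_split; apply: ler_sum => i _ /=.
rewrite -mulrA -mulrDr ler_wpM2l //.
have := riemann_slopeP N x (e i) h1; rewrite ler_norml => /andP[+ _].
by rewrite lerBrDr addrC -lerBrDr opprK addrC.
Qed.

Section Step.
Variables (T : finType) (K0 : T -> T -> R) (e : T) (n m : T -> R) (kap M : R).
Hypothesis sK0 : symmetric_kernel K0.
Hypothesis K0e : forall x, K0 e x = 0.
Hypotheses (ne : n e = 0) (me : m e = 0).
Hypothesis K0m : forall x, \sum_y K0 x y * m y = M * m x.
Hypotheses (n2 : \sum_x n x ^+ 2 = kap) (m2 : \sum_x m x ^+ 2 = kap) (kap0 : 0 < kap).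
Hypothesis nm : \sum_x n x * m x = 0.
Hypothesis nKn : qform K0 n n = kap * M.

(** The kernel [K0], in which [e] is isolated, with [e] attached through the
    vector [v]. *)
Definition coupled (v : T -> R) x y : R :=
  K0 x y + ((x == e)%:R * v y + v x * (y == e)%:R).

Lemma coupled_symmetric v : symmetric_kernel (coupled v).
Proof. by move=> x y; rewrite /coupled sK0; ring. Qed.

Lemma coupled_apply v w x : w e = 0 ->
  \sum_y coupled v x y * w y = \sum_y K0 x y * w y + (\sum_y v y * w y) * (x == e)%:R.
Proof.
move=> we; under eq_bigr do rewrite /coupled mulrDl.
rewrite big_split /=; congr (_ + _).
transitivity (\sum_y ((x == e)%:R * (v y * w y) + v x * w y * (y == e)%:R)).
  by apply: eq_bigr => y _; ring.
by rewrite big_split /= sum_delta we mulr0 addr0 -mulr_sumr mulrC.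
Qed.

Variables (f phi dphi ddphi : R -> R).
Hypotheses (tphi : tangent phi dphi) (tdphi : tangent dphi ddphi).

(** The derivative of the energy as the coupling turns from [m] towards [n].  In
    an eigenbasis of [K0] each eigenvector satisfies the hypothesis of
    [slope_engine], so only diagonal entries of divided differences of [phi] at
    the eigenvalues [l i] occur.  The vector [m] sees only the eigenvalue [M],
    while [n] sees a distribution of eigenvalues with mean [M]: Jensen's
    inequality for the divided difference decides the sign. *)
Lemma coupled_derivative_ge0 (c s : R) (u : T -> T -> R) d : 0 <= c -> 0 <= s ->
  eigenbasis (coupled (fun x => s * n x + c * m x)) u d ->
  0 <= \sum_y kcalc phi u d e y * (c * n y - s * m y).
Proof.
move=> c0 s0; set v := fun x => _; move=> eb.
have [w [l [ebw wsup _]]] := supported_basis_exists (~: [set e]) sK0.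
(* As [e] is isolated in [K0], the eigenbasis splits into [e] itself and vectors
   vanishing at [e]. *)
have K0E : induced (~: [set e]) K0 =2 K0.
  move=> x y; rewrite /induced !inE; have [->|_] := eqVneq x e; first by rewrite K0e.
  by have [->|_] := eqVneq y e; rewrite ?andbF // sK0 K0e.
have [ow K0w] := ebw.
have {}K0w i x : \sum_y K0 x y * w i y = l i * w i x.
  by rewrite -K0w; apply: eq_bigr => y _; rewrite K0E.
have we i : i != e -> w i e = 0 by move=> ie; apply: wsup; rewrite !inE ?eqxx.
have wne x : x != e -> w e x = 0.
  move=> xe; have := onb_dual ow e e; rewrite eqxx (bigD1 e) //= big1 ?addr0; last first.
    by move=> i ie; rewrite we // mul0r.
  move=> /eqP wee.
  have wee0 : w e e != 0.
    by apply/negP=> /eqP w0; move: wee; rewrite w0 mul0r eq_sym oner_eq0.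
  have := onb_dual ow e x; rewrite eq_sym (negPf xe) (bigD1 e) //= big1 ?addr0; last first.
    by move=> i ie; rewrite we // mul0r.
  by move/eqP; rewrite mulf_eq0 (negPf wee0) /= => /eqP.
pose co (z : T -> R) i := \sum_x z x * w i x.
have coe z : z e = 0 -> co z e = 0.
  move=> ze; rewrite /co (bigD1 e) //= ze mul0r add0r big1 // => x xe.
  by rewrite wne ?mulr0.
pose H x := kcalc (slope phi dphi x) u d e e.
have Hw z : z e = 0 ->
    \sum_y kcalc phi u d e y * z y = \sum_i co z i * co v i * H (l i).
  move=> ze.
  have zE y : z y = \sum_i co z i * w i y.
    rewrite -[LHS](sum_delta z y) /co.
    under [RHS]eq_bigr do rewrite mulr_suml.
    rewrite [RHS]exchange_big; apply: eq_bigr => x _ /=.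
    by rewrite -(onb_dual ow) mulr_sumr; apply: eq_bigr => i _; ring.
  under eq_bigr do rewrite zE mulr_sumr.
  rewrite exchange_big; apply: eq_bigr => i _ /=.
  have [->|ie] := eqVneq i e.
    by rewrite coe // !mul0r big1 // => y _; rewrite mul0r mulr0.
  transitivity (co z i * \sum_y kcalc phi u d e y * w i y).
    by rewrite mulr_sumr; apply: eq_bigr => y _; ring.
  rewrite (slope_engine (e := e) (l := l i) (c := co v i) (psi := slope phi dphi (l i)) eb).
  - by rewrite mulrA.
  - exact: coupled_symmetric.
  - exact: we.
  - by move=> x; rewrite coupled_apply ?we // K0w.
  - by move=> t; rewrite slopeE.
have ve : v e = 0 by rewrite /v ne me !mulr0 addr0.
rewrite Hw; last by rewrite ne me !mulr0 subrr.
have colin a b i : co (fun x => a * n x + b * m x) i = a * co n i + b * co m i.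
  rewrite /co !mulr_sumr -big_split; apply: eq_bigr => x _ /=; ring.
have cov i : co v i = s * co n i + c * co m i by rewrite colin.
have coz i : co (fun y => c * n y - s * m y) i = c * co n i - s * co m i.
  rewrite -mulNr -colin; apply: eq_bigr => x _; rewrite mulNr //.
(* [m] is an eigenvector of [K0], so it has components only at the eigenvalue
   [M]. *)
have mM i : co m i * H (l i) = co m i * H M.
  have [->//|lM] := eqVneq (l i) M.
  suff -> : co m i = 0 by rewrite !mul0r.
  have : l i * co m i = M * co m i.
    rewrite /co !mulr_sumr.
    transitivity (\sum_x \sum_y K0 x y * w i y * m x).
      by apply: eq_bigr => x _; rewrite -mulr_suml K0w; ring.
    rewrite exchange_big; apply: eq_bigr => y _ /=.
    rewrite mulrA -K0m mulr_suml; apply: eq_bigr => x _; rewrite sK0; ring.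
  by move/eqP; rewrite -subr_eq0 -mulrBl mulf_eq0 subr_eq0 (negPf lM) => /eqP.
have sumnm : \sum_i co n i * co m i = 0.
  transitivity (\sum_x n x * m x); last exact: nm.
  rewrite /co; under eq_bigr do rewrite mulr_suml.
  rewrite exchange_big; apply: eq_bigr => x _ /=.
  transitivity (\sum_y n x * m y * (x == y)%:R); last by rewrite sum_deltaC.
  under eq_bigr do rewrite mulr_sumr.
  rewrite exchange_big; apply: eq_bigr => y _ /=.
  rewrite -(onb_dual ow) mulr_sumr; apply: eq_bigr => i _; ring.
have summ : \sum_i co m i ^+ 2 = kap by rewrite sqnorm_coords.
have sumn : \sum_i co n i ^+ 2 = kap by rewrite sqnorm_coords.
have -> : \sum_i co (fun y => c * n y - s * m y) i * co v i * H (l i) =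
  c * s * (\sum_i co n i ^+ 2 * H (l i) - kap * H M).
  rewrite -summ mulr_suml -sumrB mulr_sumr.
  transitivity (\sum_i (c * s * (co n i ^+ 2 * H (l i) - co m i ^+ 2 * H M)) +
     (c ^+ 2 - s ^+ 2) * H M * \sum_i co n i * co m i).
    rewrite mulr_sumr -big_split; apply: eq_bigr => i _ /=.
    rewrite coz cov.
    transitivity (c * s * co n i ^+ 2 * H (l i) - s * c * co m i * (co m i * H (l i)) +
      (c ^+ 2 - s ^+ 2) * co n i * (co m i * H (l i))); first by ring.
    by rewrite mM; ring.
  by rewrite sumnm mulr0 addr0.
apply: mulr_ge0; first exact: mulr_ge0.
rewrite subr_ge0.
pose W i := co n i ^+ 2 / kap.
have W0 i : 0 <= W i by rewrite divr_ge0 ?sqr_ge0 // ltW.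
have W1 : \sum_i W i = 1 by rewrite -mulr_suml sumn divff // gt_eqF.
have WM : \sum_i W i * l i = M.
  transitivity (qform K0 n n / kap); last by rewrite nKn mulrC mulrA mulVf ?mul1r ?gt_eqF.
  have -> : qform K0 n n = qform (induced (~: [set e]) K0) n n.
    by apply: eq_bigr => x _; apply: eq_bigr => y _; rewrite K0E.
  rewrite (form_eigen _ _ ebw) mulr_suml; apply: eq_bigr => i _.
  by rewrite /W -/(co n i); ring.
have -> : \sum_i co n i ^+ 2 * H (l i) = kap * \sum_i W i * H (l i).
  by rewrite mulr_sumr; apply: eq_bigr => i _; rewrite /W mulrA mulrCA divff ?mulr1 ?gt_eqF.
rewrite ler_pM2l // /H /kcalc.
under [leRHS]eq_bigr do rewrite mulr_sumr.
rewrite exchange_big; apply: ler_sum => j _ /=.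
have -> : \sum_i W i * (slope phi dphi (l i) (d j) * u j e * u j e) =
  (\sum_i W i * slope phi dphi (l i) (d j)) * (u j e * u j e).
  by rewrite mulr_suml; apply: eq_bigr => i _; ring.
rewrite -mulrA ler_wpM2r -?expr2 ?sqr_ge0 //.
by rewrite -{1}WM; apply: slope_jensen W1.
Qed.

Variable p : R.
Hypotheses (p0 : 0 <= p) (tf : tangent f phi) (fge : forall x, 0 <= f x).
Hypothesis euler : forall x, phi x * x = p * f x.

(** Homogeneity of [f] bounds the part of the first order term that comes from
    the shortening of the chord. *)
Lemma coupled_euler v (u : T -> T -> R) d : v e = 0 -> eigenbasis (coupled v) u d ->
  \sum_y kcalc phi u d e y * v y <= p * energy f (coupled v).
Proof.
move=> ve eb; have [ou au] := eb.
rewrite (energyE f eb (coupled_symmetric v)) mulr_sumr.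
have -> : \sum_y kcalc phi u d e y * v y = \sum_i p * f (d i) * u i e ^+ 2.
  transitivity (\sum_y kcalc phi u d e y * coupled v e y).
    by apply: eq_bigr => y _; rewrite /coupled eqxx ve K0e /=; ring.
  under eq_bigr do rewrite mulr_suml.
  rewrite exchange_big; apply: eq_bigr => i _ /=.
  rewrite -euler; transitivity (phi (d i) * u i e * (d i * u i e)); last by ring.
  by rewrite -au mulr_sumr; apply: eq_bigr => y _; ring.
apply: ler_sum => i _; rewrite -[leRHS]mulr1 ler_wpM2l ?mulr_ge0 //.
have : \sum_x u i x * u i x = 1 by rewrite ou eqxx.
rewrite (bigD1 e) //= -expr2 => <-.
by rewrite lerDl sumr_ge0 // => x _; rewrite -expr2 sqr_ge0.
Qed.

Let Theta c s := energy f (coupled (fun x => s * n x + c * m x)).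

Lemma energy_ge0 (U : finType) (a : U -> U -> R) : 0 <= energy f a.
Proof. by rewrite /energy sumr_ge0. Qed.

(** Klein's inequality for a rotation by the angle with cosine [C] and sine [S].
    The chord between the two coupling vectors is [S] times the tangent
    direction minus [1 - C] times the vector itself. *)
Lemma rotation_step (c s C S : R) : 0 <= c -> 0 <= s -> 0 <= S -> C <= 1 ->
  Theta c s * (1 - 2 * p * (1 - C)) <= Theta (c * C - s * S) (s * C + c * S).
Proof.
move=> c0 s0 S0 C1; rewrite /Theta.
set v := fun x => s * n x + c * m x.
set v' := fun x => (s * C + c * S) * n x + _.
have ve : v e = 0 by rewrite /v ne me !mulr0 addr0.
have [u [d eb]] := eigenbasis_exists (coupled_symmetric v).
have := klein tf (coupled_symmetric v) (coupled_symmetric v') eb.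
apply: le_trans.
have -> : \sum_x \sum_y kcalc phi u d x y * (coupled v' x y - coupled v x y) =
  2 * \sum_y kcalc phi u d e y * (v' y - v y).
  have sG x y : kcalc phi u d x y = kcalc phi u d y x by apply: eq_bigr => i _; rewrite mulrAC.
  transitivity (\sum_x \sum_y (kcalc phi u d x y * (v' y - v y) * (x == e)%:R +
      kcalc phi u d y x * (v' x - v x) * (y == e)%:R)).
    by apply: eq_bigr => x _; apply: eq_bigr => y _; rewrite (sG y x) /coupled;
      move: (kcalc _ _ _ _ _) (v x) (v' x) (v y) (v' y) => G a b a' b'; ring.
  under eq_bigr do rewrite big_split /= sum_delta.
  rewrite big_split /= mulrDl mul1r; congr (_ + _).
  rewrite exchange_big /=; apply: eq_bigr => y _.
  by rewrite sum_delta.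
have -> : \sum_y kcalc phi u d e y * (v' y - v y) =
   S * \sum_y kcalc phi u d e y * (c * n y - s * m y) -
   (1 - C) * \sum_y kcalc phi u d e y * v y.
  rewrite !mulr_sumr -sumrB; apply: eq_bigr => y _; rewrite /v /v'; ring.
have C0 : 0 <= 1 - C by rewrite subr_ge0.
have combine E P Q : 0 <= S * P -> Q <= p * E ->
    E * (1 - 2 * p * (1 - C)) <= E + 2 * (S * P - (1 - C) * Q).
  move=> h1 /(ler_wpM2l C0) h2; have := lerD (ler_wpM2l (ler0n R 2) h1) (ler_wpM2l (ler0n R 2) h2).
  by apply: ler_rearrange; ring.
apply: combine; first exact: mulr_ge0 S0 (coupled_derivative_ge0 c0 s0 eb).
exact: coupled_euler ve eb.
Qed.

(** A quarter turn in [N + 1] equal steps loses a factor [1 - O(1 / N^2)] in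
    each step, hence nothing in the limit. *)
Lemma rotation_monotone : Theta 1 0 <= Theta 0 1.
Proof.
apply: (@ler_vanishing _ _ (Theta 1 0 * p * (pi / 2) ^+ 2)) => N.
pose D : R := pi / 2 / N.+1%:R.
have N0 : 0 < N.+1%:R :> R by rewrite ltr0Sn.
have D0 : 0 <= D by rewrite divr_ge0 ?divr_ge0 ?pi_ge0.
pose q := 2 * p * (1 - cos D).
have q0 : 0 <= q by rewrite !mulr_ge0 // subr_ge0 cos_le1.
have DN k : (k <= N.+1)%N -> k%:R * D <= pi / 2.
  move=> kN; rewrite /D mulrA ler_pdivrMr // [leRHS]mulrC ler_wpM2r ?ler_nat //.
  by rewrite divr_ge0 ?pi_ge0.
have h k : (k <= N.+1)%N -> Theta 1 0 * (1 - k%:R * q) <= Theta (cos (k%:R * D)) (sin (k%:R * D)).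
  elim: k => [|k IH] kN; first by rewrite !mul0r cos0 sin0 subr0 mulr1.
  (* For a coarse subdivision the claimed lower bound is negative. *)
  have [q1|q1] := ltP 1 q.
    apply: le_trans (energy_ge0 _); rewrite mulr_ge0_le0 ?energy_ge0 // subr_le0.
    by rewrite (le_trans (ltW q1)) // ler_peMl // ler1n.
  rewrite -natr1 (mulrDl _ _ D) mul1r cosD sinD.
  have kD := DN _ (ltnW kN).
  have kD0 : 0 <= k%:R * D by rewrite mulr_ge0.
  have Dpi : D <= pi / 2 by have := DN 1%N isT; rewrite mul1r.
  have ck : 0 <= cos (k%:R * D).
    by rewrite cos_ge0_pihalf // kD (le_trans _ kD0) // oppr_le0 divr_ge0 ?pi_ge0.
  have pi2 : pi / 2 <= pi :> R by rewrite ler_pdivrMr // ler_peMr ?pi_ge0 // ler1n.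
  have sk : 0 <= sin (k%:R * D) by rewrite sin_ge0_pi // kD0 (le_trans kD).
  have sD : 0 <= sin D by rewrite sin_ge0_pi // D0 (le_trans Dpi).
  apply: le_trans (rotation_step ck sk sD (cos_le1 D)).
  have q1' : 0 <= 1 - q by rewrite subr_ge0.
  apply: le_trans (ler_wpM2r q1' (IH (ltnW kN))).
  rewrite -mulrA ler_wpM2l ?energy_ge0 // -subr_ge0.
  have -> : (1 - k%:R * q) * (1 - q) - (1 - (k%:R + 1) * q) = k%:R * q * q by ring.
  by apply: mulr_ge0 => //; apply: mulr_ge0.
have := h N.+1 (leqnn _).
have -> : N.+1%:R * D = pi / 2 by rewrite /D mulrC divfK // gt_eqF.
rewrite cos_pihalf sin_pihalf mulrBr mulr1 lerBlDr => /le_trans; apply.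
rewrite lerD2l -!mulrA ler_wpM2l ?energy_ge0 //.
have hc : 1 - cos D <= D ^+ 2 / 2 by exact: one_sub_cos_le.
have -> : N.+1%:R * q = p * (N.+1%:R * ((1 - cos D) * 2)) by rewrite /q; ring.
rewrite ler_wpM2l //.
apply: le_trans (_ : N.+1%:R * (D ^+ 2 / 2 * 2) <= _).
  by rewrite ler_wpM2l ?(ltW N0) // ler_wpM2r.
rewrite divfK ?pnatr_eq0 // le_eqVlt; apply/orP; left; apply/eqP; rewrite /D.
by field; rewrite addrC natr1 gt_eqF.
Qed.

End Step.
End Rotation.

(** * Attaching a vertex *)

Section Attach.
Variable R : realType.

Lemma sum_option (T : finType) (F : option T -> R) :
  \sum_z F z = F None + \sum_x F (Some x).
Proof.
rewrite (bigD1 None) //=; congr (_ + _).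
rewrite (reindex_omap Some id) /=; last by case.
by apply: eq_bigl => x; rewrite eqxx.
Qed.

Lemma energy_option_sum (T : finType) (a : T -> T -> R) (b : option T -> option T -> R) f :
  symmetric_kernel a -> symmetric_kernel b ->
  (forall x y, b (Some x) (Some y) = a x y) -> (forall x, b None (Some x) = 0) ->
  energy f b = f (b None None) + energy f a.
Proof.
move=> sa sb ba b0; have [u [d eb]] := eigenbasis_exists sa; have [ou au] := eb.
rewrite (energyE f eb sa).
pose U (i z : option T) : R := match i, z with
  | Some i, Some x => u i x | None, None => 1 | _, _ => 0 end.
pose D (i : option T) : R := if i is Some i then d i else b None None.
rewrite (@energyE _ _ f b U D) ?sum_option //; split.
  move=> i j; rewrite sum_option.
  case: i j => [i|] [j|] /=.
  - by rewrite mul0r add0r ou.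
  - by rewrite mul0r add0r big1 // => x _; rewrite mulr0.
  - by rewrite mulr0 add0r big1 // => x _; rewrite mul0r.
  - by rewrite mulr1 big1 ?addr0 // => x _; rewrite mulr0.
move=> i z; rewrite sum_option.
case: i z => [i|] [x|] /=.
- rewrite mulr0 add0r -au; apply: eq_bigr => y _; by rewrite ba.
- by rewrite !mulr0 add0r big1 // => y _; rewrite b0 mul0r.
- by rewrite sb b0 mul0r mulr0 add0r big1 // => y _; rewrite mulr0.
- by rewrite big1 ?addr0 // => y _; rewrite mulr0.
Qed.

Variables (T : finType) (a : T -> T -> R) (A : {set T}) (e : T) (p lam : R).
Hypotheses (sa : symmetric_kernel a) (eA : e \notin A) (aee : a e e = 0) (p3 : 3 <= p).

Let kap := \sum_(x in A) a e x ^+ 2.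
Let M := (\sum_(x in A) \sum_(y in A) a e x * a x y * a y e) / kap.

(** An auxiliary point [None] carries a loop of weight [M], the mean value of
    [a] in the direction of the row of [e].  Coupled to it with the full weight
    [sqrt kap], the point [e] forms a two by two block with top eigenvalue
    [lam], separate from [A].  Turning the coupling vector until it is the row
    of [e] over [A] leaves [None] isolated with eigenvalue [M]. *)
Lemma attach_gain : 0 < kap -> lam ^+ 2 = M * lam + kap ->
  energy (posp p) (induced A a) + posp p lam <=
  energy (posp p) (induced (e |: A) a) + posp p M.
Proof.
move=> kap0 lamE; set f := posp p.
pose K0 (x y : option T) : R := match x, y with
  | Some x, Some y => induced A a x y | None, None => M | _, _ => 0 end.
pose n (x : option T) : R := if x is Some x then (if x \in A then a e x else 0) else 0.
pose m (x : option T) : R := if x is Some _ then 0 else Num.sqrt kap.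
have sK0 : symmetric_kernel K0.
  by move=> [x|] [y|] //=; rewrite induced_symmetric.
have K0e x : K0 (Some e) x = 0 by case: x => [x|] //=; rewrite /induced (negPf eA).
have ne : n (Some e) = 0 by rewrite /= (negPf eA).
have me : m (Some e) = 0 by [].
have K0m x : \sum_y K0 x y * m y = M * m x.
  rewrite sum_option big1 ?addr0; last by move=> y _; rewrite mulr0.
  by case: x => [x|] //=; rewrite mulr0 mul0r.
have n2 : \sum_x n x ^+ 2 = kap.
  rewrite sum_option /= expr0n add0r /kap [RHS]big_mkcond; apply: eq_bigr => x _.
  by case: ifP => _ //; rewrite expr0n.
have m2 : \sum_x m x ^+ 2 = kap.
  rewrite sum_option /= sqr_sqrtr ?ltW // big1 ?addr0 // => x _; by rewrite expr0n.
have nm : \sum_x n x * m x = 0.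
  by rewrite big1 // => -[x|] _ /=; rewrite ?mulr0 ?mul0r.
have nKn : qform K0 n n = kap * M.
  rewrite /M mulrC divfK ?gt_eqF // /qform sum_option big1 ?add0r; last first.
    by move=> y _; rewrite mul0r mul0r.
  rewrite [RHS]big_mkcond; apply: eq_bigr => x _.
  rewrite sum_option mulr0 add0r /= /induced; case: ifP => [xA|_]; last first.
    by rewrite big1 // => y _; rewrite !mul0r.
  rewrite [RHS]big_mkcond; apply: eq_bigr => y _ /=; case: ifP => yA; rewrite ?mulr0 //.
  by rewrite [a y e]sa.
have p1 : 1 <= p by move: p3 => h3; lra.
have tf := posp_tangent p1.
have td : tangent (dposp p) (fun x => p * dposp (p - 1) x) by apply: dposp_tangent; move: p3 => h3; lra.
have tdd := ddposp_tangent p3.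
have p0 : 0 <= p by lra.
have pp0 := posp0 p.
have eul x : dposp p x * x = p * posp p x by apply: posp_euler; lra.
(* The coupling turns from [m], supported at [None], to [n], the row of [e]. *)
have := @rotation_monotone _ _ K0 (Some e) n m kap M sK0 K0e ne me K0m n2 m2 kap0 nm nKn
  (posp p) (dposp p) _ _ td tdd p p0 tf (@posp_ge0 _ p) eul.
set K1 := coupled _ _ _; set K2 := coupled _ _ _ => mono.
have s1 : symmetric_kernel K1 by exact: coupled_symmetric.
have s2 : symmetric_kernel K2 by exact: coupled_symmetric.
have E2 : energy f K2 = f M + energy f (induced (e |: A) a).
  rewrite (@energy_option_sum _ (induced (e |: A) a)) //.
  - by congr (f _ + _); rewrite /K2 /coupled /=; ring.
  - exact: induced_symmetric.
  - move=> x y; rewrite /K2 /coupled /= /induced !inE !mul1r !mul0r !addr0.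
    rewrite -[Some x == _]/(x == e) -[Some y == _]/(y == e).
    have [->|xe] := eqVneq x e; have [->|ye] := eqVneq y e;
      rewrite ?(negPf eA) /= ?andbF ?andbT ?aee ?mulr0 ?mul0r ?mulr1 ?mul1r ?addr0 ?add0r //.
    by rewrite sa.
  - by move=> x; rewrite /K2 /coupled /=; ring.
rewrite [leRHS]addrC -E2; apply: le_trans mono.
pose A' := [set Some x | x in A]; pose B' := [set Some e; None].
have dis : [disjoint A' & B'].
  rewrite -setI_eq0; apply/eqP/setP=> z; rewrite !inE.
  apply/negP=> /andP[/imsetP[x xA ->]]; rewrite orbF => /eqP[xe].
  by rewrite xe (negPf eA) in xA.
have := pinching s1 tf (posp0 p) (posp_ge0 p) (subsetT A') (subsetT B') dis.
have -> : energy f (induced [set: option T] K1) = energy f K1.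
  by apply: eq_energy => x y; rewrite /induced !inE.
apply: le_trans; apply: lerD.
  rewrite le_eqVlt; apply/orP; left; apply/eqP/esym.
  have inA' x : (Some x \in A') = (x \in A) by rewrite mem_imset // => ? ? [].
  apply: (@energy_injective _ _ _ Some); first by move=> ? ? [].
  - exact: induced_symmetric.
  - move=> x y; rewrite /induced !inA' /K1 /coupled /= /induced.
    by case: ifP => // xy; rewrite !(mul0r, mulr0, add0r, addr0) ?xy.
  - move=> [x|] y; first by rewrite codom_f.
    by rewrite /induced; have -> : None \in A' = false by apply/imsetP=> -[].
  - exact: posp0.
pose v (_ : unit) (z : option T) : R :=
  if z is Some x then Num.sqrt kap * (x == e)%:R else lam.
have := @energy_ge_orthogonal R _ unit (induced B' K1) v (fun _ => lam) f.
rewrite big_const card_unit /= addr0; apply.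
- exact: induced_symmetric.
- exact: posp_ge0.
- by [].
- move=> i; rewrite sum_option /= ltr_wpDl ?sqr_ge0 //.
  rewrite (bigD1 e) //= eqxx mulr1 sqr_sqrtr ?ltW // ltr_wpDr // sumr_ge0 // => x _.
  exact: sqr_ge0.
- move=> i x; rewrite sum_option /=.
  have B'S y : (Some y \in B') = (y == e) by rewrite !inE orbF.
  have B'N : None \in B' by rewrite !inE.
  have K1e : K1 (Some e) None = Num.sqrt kap.
    by rewrite /K1 /coupled /= eqxx !(mul0r, mulr0, add0r, addr0, mul1r, mulr1).
  have K1n : K1 None None = M by rewrite /K1 /coupled /= !(mul0r, mulr0, add0r, addr0, mul1r, mulr1).
  have K1ee : K1 (Some e) (Some e) = 0.
    by rewrite /K1 /coupled /= /induced (negPf eA) eqxx /= !(mul0r, mulr0, add0r, addr0, mul1r, mulr1).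
  have K1ne : K1 None (Some e) = Num.sqrt kap by rewrite s1.
  rewrite (bigD1 e) //= big1 ?addr0; last first.
    by move=> y ye; rewrite (negPf ye) !mulr0.
  rewrite eqxx mulr1 /induced !B'S B'N eqxx.
  case: x => [x|] /=; last first.
    rewrite ?B'N K1n K1ne -[X in _ + X]expr2 sqr_sqrtr ?ltW //.
  rewrite B'S; have [->|xe] := eqVneq x e; last by rewrite !mul0r !mulr0 addr0.
  by rewrite K1e K1ee mul0r addr0 mulr1 mulrC.
Qed.

End Attach.

(** * Squares of bipartite kernels and deletion of a vertex *)

Section Gram.
Variable R : realType.
Implicit Types (T : finType) (f g F G phi dphi : R -> R).

(** The diagonal of a Gram matrix is majorised by its spectrum, which up to
    zeros is the spectrum of [Q]; the terms in [phi 0] account for these zeros.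
    *)
Lemma gram_jensen (I T : finType) (z : I -> T -> R) (Q v : T -> T -> R) q phi dphi :
  (forall x y, Q x y = \sum_i z i x * z i y) -> eigenbasis Q v q -> tangent phi dphi ->
  \sum_i phi (\sum_x z i x ^+ 2) + #|T|%:R * phi 0 <= \sum_l phi (q l) + #|I|%:R * phi 0.
Proof.
move=> QE eb tphi; have [ov Qv] := eb.
pose c i l := \sum_x z i x * v l x.
have QF w : qform Q w w = \sum_i (\sum_x z i x * w x) ^+ 2.
  rewrite /qform; under eq_bigr => x _.
    under eq_bigr do rewrite QE mulr_sumr mulr_suml.
    rewrite exchange_big. over.
  rewrite exchange_big; apply: eq_bigr => i _ /=.
  rewrite expr2 mulr_suml; apply: eq_bigr => x _; rewrite mulr_sumr.
  by apply: eq_bigr => y _; ring.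
have qE l : \sum_i c i l ^+ 2 = q l.
  by transitivity (qform Q (v l) (v l)); [rewrite QF|rewrite (eigenbasis_form eb) eqxx mulr1].
have c0 i l : q l = 0 -> c i l = 0.
  move=> ql; have h := @psumr_eq0P _ _ xpredT (fun i => c i l ^+ 2) (fun i _ => sqr_ge0 _).
  by move: (h (etrans (qE l) ql) i isT) => /eqP; rewrite sqrf_eq0 => /eqP.
have q0 l : 0 <= q l by rewrite -qE sumr_ge0 // => i _; rewrite sqr_ge0.
pose W i l := c i l ^+ 2 / q l.
have W0 i l : 0 <= W i l by rewrite divr_ge0 ?sqr_ge0.
have Wq i l : W i l * q l = c i l ^+ 2.
  rewrite /W; have [ql|ql] := eqVneq (q l) 0; last by rewrite divfK.
  by rewrite ql mulr0 c0 // expr0n.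
have zi i : \sum_l W i l * q l = \sum_x z i x ^+ 2.
  by rewrite -(sqnorm_coords _ ov); apply: eq_bigr => l _; rewrite Wq.
(* Strict inequality is possible when the [z i] are linearly dependent; the
   missing mass is placed at the eigenvalue 0. *)
have s1 i : \sum_l W i l <= 1.
  set s := \sum_l W i l.
  have s0 : 0 <= s by rewrite sumr_ge0.
  suff : s ^+ 2 <= s.
    have [s00|s00] := ltP 0 s; last by move=> _; rewrite (le_trans s00).
    by rewrite expr2 -[leRHS]mulr1 ler_pM2l.
  pose x y := \sum_l (c i l / q l) * v l y.
  have zx j : \sum_y z j y * x y = \sum_l c j l * (c i l / q l).
    under eq_bigr do rewrite mulr_sumr.
    rewrite exchange_big; apply: eq_bigr => l _ /=.
    transitivity ((\sum_y z j y * v l y) * (c i l / q l)); last by [].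
    by rewrite mulr_suml; apply: eq_bigr => y _; rewrite mulrA mulrAC.
  have Qx : qform Q x x = s.
    rewrite (form_eigen _ _ eb); apply: eq_bigr => l _.
    have -> : \sum_y x y * v l y = c i l / q l.
      under eq_bigr do rewrite mulr_suml.
      rewrite exchange_big /= (bigD1 l) //= [X in _ + X]big1 ?addr0 => [|k kl].
        transitivity (c i l / q l * \sum_y v l y * v l y); last by rewrite ov eqxx mulr1.
        by move: (c i l / q l) => t; rewrite mulr_sumr; apply: eq_bigr => y _; rewrite mulrA.
      transitivity (c i k / q k * \sum_y v k y * v l y).
        by move: (c i l / q l) => t; rewrite mulr_sumr; apply: eq_bigr => y _; rewrite mulrA.
      by rewrite ov (negPf kl) mulr0.
    rewrite /W; have [ql|ql] := eqVneq (q l) 0; last by field.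
    by rewrite ql !mul0r c0 // expr0n mul0r.
  rewrite -[leRHS]Qx QF (bigD1 i) //= zx.
  have -> : \sum_l c i l * (c i l / q l) = s.
    by apply: eq_bigr => l _; rewrite /W mulrA expr2.
  by rewrite lerDl sumr_ge0 // => j _; rewrite sqr_ge0.
have jen i : phi (\sum_x z i x ^+ 2) <= \sum_l W i l * (phi (q l) - phi 0) + phi 0.
  rewrite -zi; set M := \sum_l _; have ME : \sum_l W i l * q l = M by [].
  clearbody M.
  have -> : \sum_l W i l * (phi (q l) - phi 0) + phi 0 =
    \sum_l W i l * phi (q l) + (1 - \sum_l W i l) * phi 0.
    under eq_bigr do rewrite mulrBr.
    by rewrite sumrB -mulr_suml mulrBl mul1r addrAC addrA.
  have h l : W i l * (phi M + dphi M * (q l - M)) <= W i l * phi (q l).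
    by rewrite ler_wpM2l.
  have h0 : (1 - \sum_l W i l) * (phi M + dphi M * (0 - M)) <= (1 - \sum_l W i l) * phi 0.
    by rewrite ler_wpM2l // subr_ge0.
  apply: le_trans (lerD (ler_sum _ (fun l _ => h l)) h0).
  have -> : \sum_l W i l * (phi M + dphi M * (q l - M)) =
      (\sum_l W i l) * (phi M - dphi M * M) + dphi M * M.
    transitivity ((\sum_l W i l) * (phi M - dphi M * M) + dphi M * (\sum_l W i l * q l)).
      rewrite mulr_suml mulr_sumr -big_split; apply: eq_bigr => l _ /=.
      by move: (q l) (W i l) => ? ?; ring.
    by rewrite ME.
  by move: (\sum_l W i l) => ?; rewrite le_eqVlt; apply/orP; left; apply/eqP; ring.
have : \sum_i phi (\sum_x z i x ^+ 2) <=
   \sum_i (\sum_l W i l * (phi (q l) - phi 0) + phi 0) by apply: ler_sum.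
rewrite big_split /= sumr_const exchange_big /=.
have -> : \sum_l \sum_i W i l * (phi (q l) - phi 0) = \sum_l (phi (q l) - phi 0).
  apply: eq_bigr => l _; rewrite -mulr_suml /W -mulr_suml qE.
  have [->|ql] := eqVneq (q l) 0; first by rewrite subrr mulr0.
  by rewrite divff // mul1r.
rewrite sumrB sumr_const -[phi 0 *+ _]mulr_natl -[phi 0 *+ #|_|]mulr_natl.
by rewrite addrAC lerBrDr.
Qed.

(** Write [L - B0] as the Gram sum of [c] and of the scaled eigenvectors of [L -
    B], and apply [gram_jensen] to the convex function [F (L - x)]. *)
Lemma rank_one_update T (B B0 : T -> T -> R) (c : T -> R) L F G :
  symmetric_kernel B0 -> (forall x y, B x y = B0 x y + c x * c y) ->
  (forall w, qform B w w <= L * \sum_x w x ^+ 2) -> tangent F G ->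
  energy F B + F (L - \sum_x c x ^+ 2) <= energy F B0 + F L.
Proof.
move=> sB0 BE psd tF.
have sB : symmetric_kernel B by move=> x y; rewrite !BE sB0 [c x * _]mulrC.
have [u [mu eu]] := eigenbasis_exists sB; have [ou Bu] := eu.
have [v [nu ev]] := eigenbasis_exists sB0; have [ov Bv] := ev.
have mu4 i : mu i <= L.
  have := psd (u i); rewrite (eigenbasis_form eu) eqxx mulr1.
  by under eq_bigr do rewrite expr2; rewrite ou eqxx mulr1.
pose z (i : option T) x : R := if i is Some i then Num.sqrt (L - mu i) * u i x else c x.
pose Q x y := L * (x == y)%:R - B0 x y.
have Qv : eigenbasis Q v (fun l => L - nu l).
  split=> // i x; rewrite mulrBl -Bv.
  have -> : \sum_y Q x y * v i y = \sum_y (L * v i y * (x == y)%:R - B0 x y * v i y).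
    by apply: eq_bigr => y _; rewrite /Q; ring.
  by rewrite sumrB sum_deltaC.
have QE x y : Q x y = \sum_i z i x * z i y.
  rewrite sum_option /=.
  have -> : \sum_i Num.sqrt (L - mu i) * u i x * (Num.sqrt (L - mu i) * u i y) =
    \sum_i (L * (u i x * u i y) - mu i * u i x * u i y).
    apply: eq_bigr => i _.
    transitivity (Num.sqrt (L - mu i) ^+ 2 * u i x * u i y); first by ring.
    by rewrite sqr_sqrtr ?subr_ge0 //; ring.
  rewrite sumrB -(eigenbasis_kernel eu) BE -mulr_sumr (onb_dual ou) /Q; ring.
pose phi x := F (L - x).
have tphi : tangent phi (fun x => - G (L - x)).
  by move=> x y; have := tF (L - x) (L - y); rewrite /phi; apply: ler_rearrange; ring.
have := gram_jensen QE Qv tphi.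
rewrite card_option -natr1 mulrDl mul1r sum_option /=.
have -> : \sum_i phi (\sum_x (Num.sqrt (L - mu i) * u i x) ^+ 2) = energy F B.
  rewrite (energyE F eu sB); apply: eq_bigr => i _.
  have -> : \sum_x (Num.sqrt (L - mu i) * u i x) ^+ 2 = L - mu i.
    under eq_bigr do rewrite exprMn sqr_sqrtr ?subr_ge0 // expr2.
    by rewrite -mulr_sumr ou eqxx mulr1.
  by rewrite /phi opprB addrC subrK.
have -> : \sum_l phi (L - nu l) = energy F B0.
  rewrite (energyE F ev sB0); apply: eq_bigr => l _.
  by rewrite /phi opprB addrC subrK.
rewrite /phi subr0; move: (F (L - _)) (F L) (energy F B) (energy F B0) (#|T|%:R) => a b c1 d t h.
by apply: ler_rearrange h; ring.
Qed.

(** Peierls' inequality for [b] in an eigenbasis of [a], together with the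
    monotonicity of [f]. *)
Lemma energy_le_psd T (a b : T -> T -> R) f g :
  symmetric_kernel a -> symmetric_kernel b -> tangent f g -> (forall x, 0 <= g x) ->
  (forall w, qform a w w <= qform b w w) -> energy f a <= energy f b.
Proof.
move=> sa sb tf g0 ab; have [u [d eb]] := eigenbasis_exists sa; have [ou _] := eb.
apply: le_trans (peierls tf sb ou); rewrite (energyE f eb sa).
apply: ler_sum => i _; apply: le_trans (tf (d i) _); rewrite lerDl mulr_ge0 // subr_ge0.
by have := ab (u i); rewrite (eigenbasis_form eb) eqxx mulr1.
Qed.

Definition square T (a : T -> T -> R) x y := \sum_t a x t * a t y.

Lemma square_symmetric T (a : T -> T -> R) : symmetric_kernel a -> symmetric_kernel (square a).
Proof. by move=> sa x y; apply: eq_bigr => t _; rewrite mulrC sa [a t x]sa. Qed.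

Lemma square_eigenbasis T (a u : T -> T -> R) d : eigenbasis a u d ->
  eigenbasis (square a) u (fun i => d i ^+ 2).
Proof.
move=> [ou au]; split=> // i x; rewrite /square; under eq_bigr do rewrite mulr_suml.
rewrite exchange_big /=; transitivity (\sum_t a x t * (d i * u i t)).
  by apply: eq_bigr => t _; rewrite -au mulr_sumr; apply: eq_bigr => y _; rewrite mulrA.
transitivity (d i * \sum_t a x t * u i t); last by rewrite au expr2 mulrA.
by rewrite mulr_sumr; apply: eq_bigr => t _; rewrite mulrCA.
Qed.

(** The positive and the negative eigenvalues of a bipartite kernel contribute
    equally to its square. *)
Lemma energy_square T (a : T -> T -> R) (s : T -> R) p :
  symmetric_kernel a -> (forall x, s x * s x = 1) ->
  (forall x y, s x * s y * a x y = - a x y) ->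
  energy (posp (p / 2)) (square a) = 2 * energy (posp p) a.
Proof.
move=> sa s1 sN; have [u [d eb]] := eigenbasis_exists sa.
rewrite (energyE _ (square_eigenbasis eb) (square_symmetric sa)).
rewrite mulrDl mul1r {2}(energy_signed _ sa s1 sN) !(energyE _ eb sa) -big_split.
apply: eq_bigr => i _ /=; have [di|di|->] := ltgtP (d i) 0.
- by rewrite -sqrrN posp_sqr ?oppr_gt0 // (posp_neg _ (ltW di)) add0r.
- by rewrite posp_sqr // [posp p (- _)]posp_neg ?oppr_le0 ?ltW // addr0.
- by rewrite expr0n oppr0 !posp0 addr0.
Qed.

Lemma qform_square T (a : T -> T -> R) w : symmetric_kernel a ->
  qform (square a) w w = \sum_x (\sum_y a x y * w y) ^+ 2.
Proof.
move=> sa; rewrite /qform /square.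
under eq_bigr => x _.
  under eq_bigr do rewrite mulr_sumr mulr_suml.
  rewrite exchange_big. over.
rewrite exchange_big; apply: eq_bigr => t _ /=.
rewrite expr2 mulr_suml; apply: eq_bigr => x _; rewrite mulr_sumr.
by apply: eq_bigr => y _; rewrite [a t x]sa; ring.
Qed.

(** Let [n] be the row of [z].  Removing the rank one term of [n] from the
    square of [H], then the one of the resulting row [g] of [z], leaves the
    square of [H0] minus a positive rank one term.  Each removal costs at most
    [F 4] minus a value of [F]; for [n] this value is at least [F 2 >= 2], which
    gives the term [- 1]. *)
Lemma delete_vertex T (H : T -> T -> R) (s : T -> R) z p : 2 <= p ->
  symmetric_kernel H -> (forall x, s x * s x = 1) ->
  (forall x y, s x * s y * H x y = - H x y) ->
  (forall w, \sum_x (\sum_y H x y * w y) ^+ 2 <= 4 * \sum_x w x ^+ 2) ->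
  H z z = 0 -> 0 < \sum_x H z x ^+ 2 <= 2 ->
  energy (posp p) H <= energy (posp p) (induced (~: [set z]) H) + (2 `^ p - 1).
Proof.
move=> p2 sH s1 sN bH Hzz /andP[]; set kap := \sum_x _ => kap0 kap2.
set H0 := induced _ H; pose n x := H z x.
have sH0 : symmetric_kernel H0 by exact: induced_symmetric.
have HE x y : H x y = H0 x y + ((x == z)%:R * n y + n x * (y == z)%:R).
  rewrite /H0 /induced !inE /n; have [->|xz] := eqVneq x z; have [->|yz] := eqVneq y z => /=;
    rewrite ?Hzz ?mulr0 ?mul0r ?mulr1 ?mul1r ?addr0 ?add0r //.
have H0z x : H0 x z = 0 by rewrite /H0 /induced !inE eqxx andbF.
have nz : n z = 0 by rewrite /n.
pose k x := \sum_t H0 x t * n t.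
have kz : k z = 0 by rewrite /k big1 // => t _; rewrite sH0 H0z mul0r.
(* The square of [H] in terms of the kernel with [z] deleted, of the row [n] and
   of its image [k]. *)
have H2E x y : square H x y = square H0 x y + (k x * (y == z)%:R + (x == z)%:R * k y)
   + (kap * ((x == z)%:R * (y == z)%:R) + n x * n y).
  rewrite /square.
  transitivity (\sum_t (H0 x t * H0 t y + (H0 x t * n t * (y == z)%:R + (x == z)%:R * (H0 y t * n t))
     + (n t ^+ 2 * ((x == z)%:R * (y == z)%:R))
     + (H0 x t * n y + (x == z)%:R * n t * n y + n x * H0 t y + n x * n t * (y == z)%:R + n x * n y) * (t == z)%:R)).
    apply: eq_bigr => t _; rewrite !(HE x t) (HE t y) [H0 y t]sH0.
    have [->|tz] := eqVneq t z; last by rewrite /=; ring.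
    by rewrite nz H0z (sH0 z) H0z /=; ring.
  rewrite !big_split /= sum_delta !H0z (sH0 z) H0z nz -!mulr_suml -!mulr_sumr -/(k x) -/(k y).
  have -> : \sum_i n i ^+ 2 = kap by [].
  by ring.
pose c := Num.sqrt kap.
have c0 : c != 0 by rewrite gt_eqF // sqrtr_gt0.
have cc : c ^+ 2 = kap by rewrite sqr_sqrtr // ltW.
(* The row of [z] in [B1], divided by the square root of its diagonal entry. *)
pose g x := k x / c + c * (x == z)%:R.
pose B1 x y := square H x y - n x * n y.
pose B2 x y := B1 x y - g x * g y.
have B2E x y : B2 x y = square H0 x y - k x / c * (k y / c).
  rewrite /B2 /B1 H2E -cc /g; field.
  exact: c0.
have sB1 : symmetric_kernel B1 by move=> x y; rewrite /B1 square_symmetric // mulrC.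
have sB2 : symmetric_kernel B2 by move=> x y; rewrite /B2 sB1 [g x * _]mulrC.
pose F := posp (p / 2).
have tF : tangent F (dposp (p / 2)).
  by apply: posp_tangent; rewrite ler_pdivlMr ?mul1r // ltr0n.
have u1 : energy F (square H) + F (4 - kap) <= energy F B1 + F 4.
  apply: (rank_one_update (c := n) sB1 _ _ tF) => [x y|w]; first by rewrite subrK.
  by rewrite qform_square.
have u2 : energy F B1 + F (4 - \sum_x g x ^+ 2) <= energy F B2 + F 4.
  apply: (rank_one_update sB2 _ _ tF) => [x y|w]; first by rewrite subrK.
  apply: le_trans (bH w); rewrite -qform_square // /qform.
  rewrite -subr_ge0 -sumrB.
  have -> : \sum_x (\sum_y w x * square H x y * w y - \sum_y w x * B1 x y * w y) =
    (\sum_x w x * n x) ^+ 2.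
    rewrite expr2 mulr_suml; apply: eq_bigr => x _; rewrite -sumrB mulr_sumr.
    by apply: eq_bigr => y _; rewrite /B1; ring.
  exact: sqr_ge0.
have u3 : energy F B2 <= energy F (square H0).
  apply: (energy_le_psd sB2 (square_symmetric sH0) tF) => [x|w].
    by apply: dposp_ge0; move: p2; clear; lra.
  rewrite /qform -subr_ge0 -sumrB.
  have -> : \sum_x (\sum_y w x * square H0 x y * w y - \sum_y w x * B2 x y * w y) =
    (\sum_x w x * (k x / c)) ^+ 2.
    rewrite expr2 mulr_suml; apply: eq_bigr => x _; rewrite -sumrB mulr_sumr.
    by apply: eq_bigr => y _; rewrite B2E; ring.
  exact: sqr_ge0.
have sN0 x y : s x * s y * H0 x y = - H0 x y.
  by rewrite /H0 /induced; case: ifP => _; rewrite ?sN // mulr0 oppr0.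
rewrite (energy_square _ sH s1 sN) in u1.
rewrite (energy_square _ sH0 s1 sN0) in u3.
have F4 : F 4 = 2 `^ p.
  by rewrite /F (_ : 4 = 2 ^+ 2) ?posp_sqr ?pospE //; ring.
have F2 : 2 <= F (4 - kap).
  apply: (@le_trans _ _ (F 2)); last by apply: posp_le; move: p2 kap2; clear; lra.
  rewrite /F pospE ?ltr0n // le1r_powR ?ler1n //.
  by rewrite ler_pdivlMr ?mul1r // ltr0n.
have F0 := @posp_ge0 R (p / 2) (4 - \sum_x g x ^+ 2).
rewrite -/F in F0; rewrite -F4; move: u1 u2 u3 F0 F2; lra.
Qed.

End Gram.

(** * Paths and triangles *)

Section Paths.
Variable R : realType.
Implicit Types (p : R).

Definition alpha p m : R := energy (posp p) (@adjk R (path_graph m)).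

(** The increment of a convex function over a unit interval grows with the
    interval; the interval ending at 2 has increment [2 `^ p - 1]. *)
Lemma posp_unit_increment p M lam : 1 <= p -> 2 <= lam -> M + 1 <= lam ->
  posp p M + (2 `^ p - 1) <= posp p lam.
Proof.
move=> p1 lam2 lamM; have p0 : 0 <= p by lra.
have p2 : posp p 2 = 2 `^ p by rewrite pospE.
have p11 : posp p 1 = 1 by rewrite pospE // powR1.
have [M1|M1] := leP M 1.
  have h1 := posp_le p0 M1; have h2 := posp_le p0 lam2.
  by rewrite p11 in h1; rewrite p2 in h2; lra.
have h := posp_le p0 lamM; apply: le_trans h; rewrite addrC -lerBrDr.
have tf := posp_tangent p1.
have s1 : slope (posp p) (dposp p) 1 2 <= slope (posp p) (dposp p) 1 (M + 1).
  by apply: slope_mono tf _ _ _; lra.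
have s2 : slope (posp p) (dposp p) (M + 1) 1 <= slope (posp p) (dposp p) (M + 1) M.
  by apply: slope_mono tf _ _ _; lra.
rewrite slopeC in s2.
have e1 := slopeE (posp p) (dposp p) 1 2; have e2 := slopeE (posp p) (dposp p) M (M + 1).
rewrite p2 p11 in e1; rewrite slopeC in e2.
have d1 : 2 - 1 = 1 :> R by ring.
have d2 : M + 1 - M = 1 by ring.
by rewrite -e1 -e2 d1 d2 !mulr1; apply: le_trans s2.
Qed.

(** In [attach_gain] the neighbours of [e] number [kap >= 2] and span a subgraph
    with mean degree [M], between [2 / kap], because of one edge, and [kap - 1];
    these bounds make the top eigenvalue [lam] of the two by two block at least
    2 and at least [M + 1]. *)
Lemma attach_triangle (L : sgraph) (A : {set L}) (e x0 y0 : L) p : 3 <= p ->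
  e \notin A -> x0 \in A -> y0 \in A -> adj e x0 -> adj e y0 -> adj x0 y0 ->
  energy (posp p) (induced A (@adjk R L)) + (2 `^ p - 1) <=
  energy (posp p) (induced (e |: A) (@adjk R L)).
Proof.
move=> p3 eA xA yA ex ey xy.
pose a := @adjk R L; have sa : symmetric_kernel a by exact: adjk_symmetric.
have aee : a e e = 0 by rewrite /a /adjk adj_irr.
pose N := [set x in A | adj e x].
pose S := \sum_(x in N) \sum_(y in N) a x y.
have kapE : \sum_(x in A) a e x ^+ 2 = #|N|%:R.
  rewrite -sum1_card natr_sum [LHS]big_mkcond [RHS]big_mkcond; apply: eq_bigr => x _.
  by rewrite inE /a /adjk; case: (x \in A) => //=; case: (adj e x); rewrite ?expr1n ?expr0n.
have SE : \sum_(x in A) \sum_(y in A) a e x * a x y * a y e = S.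
  rewrite /S [LHS]big_mkcond [RHS]big_mkcond; apply: eq_bigr => x _.
  rewrite inE {1}/a /adjk; case: (x \in A) => //=.
  case: (adj e x); last by rewrite big1 // => y _; rewrite !mul0r.
  rewrite [LHS]big_mkcond [RHS]big_mkcond; apply: eq_bigr => y _.
  rewrite inE [a y e]sa {2}/a /adjk; case: (y \in A) => //=.
  by case: (adj e y); rewrite ?mulr1 ?mulr0 ?mul1r.
have a01 x y : 0 <= a x y <= 1 by rewrite /a /adjk; case: (adj _ _); rewrite ?lexx ?ler01.
have xN : x0 \in N by rewrite inE xA.
have yN : y0 \in N by rewrite inE yA.
have xy0 : x0 != y0 by apply: contraTneq xy => ->; rewrite adj_irr.
pose k : R := #|N|%:R.
have k0 : 0 < k by rewrite ltr0n; apply/card_gt0P; exists x0.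
have S2 : 2 <= S.
  have row1 x y : y \in N -> adj x y -> 1 <= \sum_(z in N) a x z.
    move=> yN' xy'; rewrite (bigD1 y) //= {1}/a /adjk xy' lerDl.
    by apply: sumr_ge0 => z _; have /andP[] := a01 x z.
  have rx := row1 _ _ yN xy; have := row1 y0 x0 xN; rewrite adj_sym => /(_ xy) ry.
  have yx0 : (y0 \in N) && (y0 != x0) by rewrite yN eq_sym.
  rewrite /S (bigD1 x0) //= (bigD1 y0 yx0) /=.
  rewrite addrA -[leLHS]addr0; apply: lerD; first by lra.
  by apply: sumr_ge0 => i _; apply: sumr_ge0 => j _; have /andP[] := a01 i j.
have Sk : S <= k * (k - 1).
  have -> : k * (k - 1) = \sum_(x in N) (k - 1) by rewrite sumr_const -mulr_natl.
  apply: ler_sum => x xN'; rewrite (bigD1 x) //= {1}/a /adjk adj_irr add0r.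
  have -> : k - 1 = \sum_(y in N | y != x) 1.
    by rewrite /k -sum1_card natr_sum (bigD1 x) //= addrAC subrr add0r.
  by apply: ler_sum => y _; have /andP[] := a01 x y.
pose M := S / k.
pose lam := (M + Num.sqrt (M ^+ 2 + 4 * k)) / 2.
have D0 : 0 <= M ^+ 2 + 4 * k by rewrite addr_ge0 ?sqr_ge0 ?mulr_ge0 // ltW.
have sq := sqr_sqrtr D0.
have sq0 := sqrtr_ge0 (M ^+ 2 + 4 * k).
have lamE : lam ^+ 2 = M * lam + k.
  move: sq; rewrite /lam; move: (Num.sqrt _) => r rE.
  have -> : k = (r ^+ 2 - M ^+ 2) / 4 by rewrite rE; field.
  by field.
have M0 : 0 <= M by rewrite divr_ge0 ?ltW //; lra.
have lam0 : 0 <= lam by rewrite divr_ge0 ?addr_ge0.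
have kM : M * k = S by rewrite /M divfK // gt_eqF.
have lam_ge t : 0 <= t -> t ^+ 2 <= M * t + k -> t <= lam.
  move=> t0 ht; rewrite leNgt; apply/negP => lt.
  have : 0 < (t - lam) * (t + lam - M).
    apply: mulr_gt0; first by rewrite subr_gt0.
    suff : M <= lam by lra.
    rewrite /lam ler_pdivlMr //; suff : M <= Num.sqrt (M ^+ 2 + 4 * k) by lra.
    rewrite -[leLHS]ger0_norm // -sqrtr_sqr ler_sqrt // lerDl mulr_ge0 // ltW //.
  have -> : (t - lam) * (t + lam - M) = (t ^+ 2 - M * t) - (lam ^+ 2 - M * lam) by ring.
  by rewrite lamE; lra.
have lam2 : 2 <= lam.
  apply: lam_ge => //; rewrite -(ler_pM2r k0).
  have -> : (M * 2 + k) * k = 2 * (M * k) + k ^+ 2 by ring.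
  rewrite kM; have := sqr_ge0 (k - 2).
  have -> : (k - 2) ^+ 2 = k ^+ 2 - 2 ^+ 2 * k + 4 by ring.
  lra.
have lamM : M + 1 <= lam.
  apply: lam_ge; first by lra.
  have -> : (M + 1) ^+ 2 = M * (M + 1) + (M + 1) by ring.
  rewrite lerD2l -(ler_pM2r k0) mulrDl kM mul1r.
  by move: Sk; rewrite mulrBr mulr1; lra.
have gain := @posp_unit_increment p M lam _ lam2 lamM.
have /gain {}gain : 1 <= p by lra.
have := @attach_gain R L a A e p lam sa eA aee p3.
rewrite kapE SE -/k -/M => /(_ k0 lamE).
move: gain; rewrite -/a; lra.
Qed.

(** Schur test: Cauchy-Schwarz with the nonnegative weights [h x y] in each row.
    *)
Lemma degree_two_bound (T : finType) (h : T -> T -> R) (w : T -> R) :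
  symmetric_kernel h -> (forall x y, 0 <= h x y) -> (forall x, \sum_y h x y <= 2) ->
  \sum_x (\sum_y h x y * w y) ^+ 2 <= 4 * \sum_x w x ^+ 2.
Proof.
move=> sh h0 h2.
have cs x : (\sum_y h x y * w y) ^+ 2 <= 2 * \sum_y h x y * w y ^+ 2.
  apply: (@le_trans _ _ ((\sum_y h x y) * \sum_y h x y * w y ^+ 2)); last first.
    by rewrite ler_wpM2r // sumr_ge0 // => y _; rewrite mulr_ge0 ?sqr_ge0.
  have : 0 <= \sum_y \sum_z h x y * h x z * (w y - w z) ^+ 2.
    by apply: sumr_ge0 => y _; apply: sumr_ge0 => z _; rewrite mulr_ge0 ?sqr_ge0 // mulr_ge0.
  have -> : \sum_y \sum_z h x y * h x z * (w y - w z) ^+ 2 =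
     2 * ((\sum_y h x y) * (\sum_y h x y * w y ^+ 2)) - 2 * (\sum_y h x y * w y) ^+ 2.
    transitivity (\sum_y \sum_z (h x y * w y ^+ 2 * h x z + h x y * (h x z * w z ^+ 2)
       - 2 * (h x y * w y) * (h x z * w z))).
      by apply: eq_bigr => y _; apply: eq_bigr => z _; ring.
    under eq_bigr do rewrite sumrB big_split /= -!mulr_sumr.
    rewrite sumrB big_split /= -!mulr_suml -mulr_sumr; ring.
  lra.
apply: le_trans (ler_sum _ (fun x _ => cs x)) _.
rewrite -mulr_sumr exchange_big /=.
have -> : 4 * \sum_x w x ^+ 2 = 2 * \sum_x 2 * w x ^+ 2 by rewrite -mulr_sumr; ring.
rewrite ler_pM2l //; apply: ler_sum => y _.
rewrite -mulr_suml ler_wpM2r ?sqr_ge0 //; apply: le_trans (h2 y).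
by rewrite le_eqVlt; apply/orP; left; apply/eqP; apply: eq_bigr => x _.
Qed.

Lemma path_row_sum m (i : path_graph m) : \sum_j @adjk R (path_graph m) i j <= 2.
Proof.
have ge0 : forall P : pred 'I_m, (#|[pred j | P j]| <= 1)%N -> \sum_j (P j)%:R <= 1 :> R.
  move=> P; rewrite -sum1_card => h.
  have -> : \sum_j (P j)%:R = (\sum_(j in P) 1)%:R :> R.
    by rewrite natr_sum [RHS]big_mkcond; apply: eq_bigr => j _; rewrite unfold_in; case: (P j).
  by rewrite -[leRHS]/(1%:R) ler_nat.
apply: (@le_trans _ _ (\sum_(j < m) (i.+1 == j :> nat)%:R + \sum_(j < m) (j.+1 == i :> nat)%:R)).
  rewrite -big_split; apply: ler_sum => j _.
  rewrite /adjk /= /path_adj; case: (i.+1 == j :> nat); case: (j.+1 == i :> nat);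
  by rewrite /= ?addr0 ?add0r ?lexx // lerDl.
by apply: lerD; apply: ge0; apply/card_le1_eqP => j k; rewrite !inE => /eqP hj /eqP hk;
  apply/val_inj => /=; lia.
Qed.

Lemma path_sign m (i j : path_graph m) :
  (-1) ^+ i * (-1) ^+ j * @adjk R (path_graph m) i j = - @adjk R (path_graph m) i j.
Proof.
have ss k : (-1) ^+ k * (-1) ^+ k = 1 :> R by rewrite -expr2 sqrr_sign.
rewrite /adjk /= /path_adj; have [/eqP<-|_] /= := boolP (i.+1 == j :> nat).
  by rewrite exprS mulrCA ss !mulr1.
have [/eqP<-|_] /= := boolP (j.+1 == i :> nat); last by rewrite mulr0 oppr0.
by rewrite exprS -(mulrA (-1)) ss !mulr1.
Qed.

Lemma path_interval m (A : {set path_graph m}) c n p :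
  (forall i : path_graph m, (i \in A) = (c <= i < c + n)%N) -> (c + n <= m)%N ->
  energy (posp p) (induced A (@adjk R (path_graph m))) = alpha p n.
Proof.
move=> AE cn.
have hlt (i : 'I_n) : (c + i < m)%N by apply: leq_trans cn; rewrite ltn_add2l.
pose h (i : path_graph n) : path_graph m := Ordinal (hlt i).
apply: (@energy_injective R _ _ h).
- by move=> i j /(congr1 val) /= /addnI /val_inj.
- by apply: induced_symmetric; exact: adjk_symmetric.
- move=> i j; rewrite /induced !AE /= !leq_addr !ltn_add2l !ltn_ord /= /adjk /= /path_adj /=.
  by rewrite -!addnS !eqn_add2l.
- move=> i j ic; rewrite /induced; case: ifP => // /andP[iA _]; case/negP: ic.
  move: iA; rewrite AE => /andP[ci icn].
  have il : (i - c < n)%N by rewrite ltn_subLR.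
  apply/codomP; exists (Ordinal il); apply/val_inj => /=; by rewrite subnKC.
- exact: posp0.
Qed.

(** [delete_vertex] at the vertex that separates the first [a] vertices from the
    last [b]. *)
Lemma alpha_concat p a b : 2 <= p -> (0 < a)%N ->
  alpha p (a + b.+1) <= alpha p a + alpha p b + (2 `^ p - 1).
Proof.
move=> p2 a0; have am : (a < a + b.+1)%N by rewrite -addn1 leq_add2l.
pose z : path_graph (a + b.+1) := Ordinal am.
pose H := @adjk R (path_graph (a + b.+1)).
have sH : symmetric_kernel H by exact: adjk_symmetric.
have H0 x y : 0 <= H x y by rewrite /H /adjk.
have bH w := @degree_two_bound _ H w sH H0 (@path_row_sum _).
have Hzz : H z z = 0 by rewrite /H /adjk adj_irr.
have Hsq x : H z x ^+ 2 = H z x by rewrite /H /adjk; case: (adj _ _); rewrite ?expr1n ?expr0n.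
have := @delete_vertex R _ H (fun i => (-1) ^+ i) z p p2 sH _ (@path_sign _) bH Hzz.
have s1 (x : path_graph (a + b.+1)) : (-1) ^+ x * (-1) ^+ x = 1 :> R.
  by rewrite -expr2 sqrr_sign.
move=> /(_ s1); under eq_bigr do rewrite Hsq.
have pm : (a.-1 < a + b.+1)%N by lia.
have -> /= : 0 < \sum_i H z i <= 2.
  rewrite path_row_sum andbT (bigD1 (Ordinal pm : path_graph _)) //=.
  apply: ltr_wpDr; first by apply: sumr_ge0 => j _.
  by rewrite /H /adjk /= /path_adj /= prednK // eqxx orbT.
suff -> : energy (posp p) (induced (~: [set z]) H) = alpha p a + alpha p b by apply.
pose A : {set path_graph (a + b.+1)} := [set i : path_graph (a + b.+1) | (i < a)%N].
pose B : {set path_graph (a + b.+1)} := [set i : path_graph (a + b.+1) | (a < i)%N].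
have -> : ~: [set z] = A :|: B.
  by apply/setP=> i; rewrite !inE -val_eqE /=; case: ltngtP.
rewrite energy_split //.
- congr (_ + _).
    by apply: (@path_interval _ _ 0) => [i|]; rewrite ?inE //; lia.
  apply: (@path_interval _ _ a.+1) => [i|]; rewrite ?inE; last by lia.
  by have := ltn_ord i; lia.
- exact: posp0.
- by rewrite -setI_eq0; apply/eqP/setP=> i; rewrite !inE; case: ltngtP.
move=> x y; rewrite !inE /H /adjk /= /path_adj => xa ay.
have -> : (x.+1 == y :> nat) = false by apply/eqP; lia.
by have -> : (y.+1 == x :> nat) = false by apply/eqP; lia.
Qed.

End Paths.

(** * Determinants of skew kernels *)

Section KernelDet.
Variable R : realType.
Implicit Types (T : finType).

Definition kdet T (a : T -> T -> R) : R := \det (kernel_mx a).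

Lemma eq_kdet T (a b : T -> T -> R) : a =2 b -> kdet a = kdet b.
Proof. by move=> ab; congr (\det _); apply/matrixP=> i j; rewrite !mxE ab. Qed.

Lemma kdet_tr T (a : T -> T -> R) : kdet (fun x y => a y x) = kdet a.
Proof. by rewrite /kdet -det_tr; congr (\det _); apply/matrixP=> i j; rewrite !mxE. Qed.

Lemma kdet_delta T : kdet (fun x y : T => (x == y)%:R) = 1.
Proof.
transitivity (\det (1%:M : 'M[R]_#|T|)); last exact: det1.
congr (\det _); apply/matrixP=> i j.
by rewrite !mxE (inj_eq enum_val_inj).
Qed.

Lemma kdet_row_linear T (a b c : T -> T -> R) v k :
  (forall y, a v y = b v y + k * c v y) ->
  (forall x y, x != v -> a x y = b x y) -> (forall x y, x != v -> a x y = c x y) ->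
  kdet a = kdet b + k * kdet c.
Proof.
move=> av ab ac.
rewrite /kdet (@determinant_multilinear _ _ (kernel_mx a) (kernel_mx b) (kernel_mx c)
  (enum_rank v) 1 k) ?mul1r //.
- by apply/matrixP=> i j; rewrite !mxE enum_rankK av mul1r.
- by apply/matrixP=> i j; rewrite !mxE ab // -(inj_eq enum_rank_inj) enum_valK eq_sym neq_lift.
- by apply/matrixP=> i j; rewrite !mxE ac // -(inj_eq enum_rank_inj) enum_valK eq_sym neq_lift.
Qed.

Lemma kdet_alternate T (a : T -> T -> R) u v : u != v -> a u =1 a v -> kdet a = 0.
Proof.
move=> uv auv; apply: (@determinant_alternate _ _ _ (enum_rank u) (enum_rank v)).
  by rewrite (inj_eq enum_rank_inj).
by move=> j; rewrite !mxE !enum_rankK auv.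
Qed.

(** Laplace expansion along that row leaves the minor that omits the
    corresponding column. *)
Lemma kdet_unit_row T (a b : T -> T -> R) v :
  (forall y, a v y = (v == y)%:R) -> (forall y, b v y = (v == y)%:R) ->
  (forall x y, y != v -> a x y = b x y) -> kdet a = kdet b.
Proof.
move=> av bv ab.
have ev c : (forall y, c v y = (v == y)%:R) ->
    kdet c = cofactor (kernel_mx c) (enum_rank v) (enum_rank v).
  move=> cv; rewrite /kdet (expand_det_row _ (enum_rank v)) (bigD1 (enum_rank v)) //=.
  rewrite !mxE enum_rankK cv eqxx mul1r big1 ?addr0 // => j jv.
  rewrite !mxE enum_rankK cv; case: eqP => [vj|_]; last by rewrite mul0r.
  by rewrite vj enum_valK eqxx in jv.
rewrite !ev // /cofactor; congr (_ * \det _); apply/matrixP=> i j; rewrite !mxE ab //.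
by rewrite -(inj_eq enum_rank_inj) enum_valK eq_sym neq_lift.
Qed.

Lemma kdet_unit_col T (a b : T -> T -> R) v :
  (forall x, a x v = (x == v)%:R) -> (forall x, b x v = (x == v)%:R) ->
  (forall x y, x != v -> a x y = b x y) -> kdet a = kdet b.
Proof.
move=> av bv ab; rewrite -kdet_tr -[RHS]kdet_tr.
apply: (kdet_unit_row (v := v)) => [y|y|x y yv]; rewrite ?av ?bv 1?eq_sym //.
exact: ab.
Qed.

Section Skew.
Variables (T : finType) (K : T -> T -> R) (t : R).
Hypothesis skew : forall x y, K x y = - K y x.

(** The identity plus the skew kernel scaled by [t] and restricted to [Y], so
    that its determinant is the one of the block on [Y]. *)
Definition idk (Y : {set T}) x y : R := (x == y)%:R + t * induced Y K x y.

Let Kxx x : K x x = 0.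
Proof. by have h := skew x x; lra. Qed.

Lemma kdet_isolated (Y : {set T}) v : v \in Y -> (forall x, x \in Y -> K v x = 0) ->
  kdet (idk Y) = kdet (idk (Y :\ v)).
Proof.
move=> vY Kv; apply: eq_kdet => x y; rewrite /idk; congr (_ + _ * _).
rewrite /induced !inE; have [->|xv] := eqVneq x v; have [->|yv] := eqVneq y v => //=.
- by rewrite vY Kxx.
- by case: ifP => // /andP[_ yY]; rewrite Kv.
- by rewrite andbF; case: ifP => // /andP[xY _]; rewrite skew Kv // oppr0.
Qed.

(** Adding a multiple of the row of the leaf [v] to the row of its neighbour [u]
    clears the column of [v], at the price of raising the diagonal entry at [u];
    skew symmetry makes the increment a square. *)
Lemma kdet_leaf (Y : {set T}) v u : v \in Y -> u \in Y -> u != v ->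
  (forall x, x \in Y -> x != u -> K v x = 0) ->
  kdet (idk Y) = kdet (idk (Y :\ v)) + (t * K v u) ^+ 2 * kdet (idk (Y :\ v :\ u)).
Proof.
move=> vY uY uv Kv.
have uvF : (u == v) = false by apply/negbTE.
have vuF : (v == u) = false by rewrite eq_sym.
pose M := idk Y.
have Mv y : M v y = (v == y)%:R + t * K v u * (u == y)%:R.
  rewrite /M /idk /induced vY /=; congr (_ + _); rewrite -mulrA; congr (_ * _).
  have [<-|yu] := eqVneq u y; first by rewrite uY mulr1.
  by rewrite mulr0; case: ifP => // yY; rewrite Kv // eq_sym.
have Mc x : M x v = (x == v)%:R - t * K v u * (x == u)%:R.
  rewrite /M /idk /induced vY andbT; congr (_ + _); rewrite -mulrA -mulrN; congr (_ * _).
  have [->|xu] := eqVneq x u; first by rewrite uY mulr1 skew.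
  by rewrite mulr0 oppr0; case: ifP => // xY; rewrite skew Kv // oppr0.
pose M1 x y := if x == u then M u y + t * K v u * M v y else M x y.
have e1 : kdet M1 = kdet M.
  rewrite (@kdet_row_linear _ M1 M (fun x y => if x == u then M v y else M x y) u (t * K v u)).
  - rewrite [X in _ + _ * X](_ : _ = 0) ?mulr0 ?addr0 //.
    by apply: (kdet_alternate uv) => y; rewrite eqxx vuF.
  - by move=> y; rewrite /M1 eqxx.
  - by move=> x y xu; rewrite /M1 (negPf xu).
  - by move=> x y xu; rewrite /M1 (negPf xu).
pose M2 x y := if x == v then (v == y)%:R else M1 x y.
have e2 : kdet M1 = kdet M2.
  apply: (kdet_unit_col (v := v)).
  - move=> x; rewrite /M1; have [->|xu] := eqVneq x u; last by rewrite Mc (negPf xu) mulr0 subr0.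
    by rewrite Mc Mv !eqxx uvF /=; ring.
  - move=> x; rewrite /M2; have [_|xv] := eqVneq x v; [by rewrite eqxx|rewrite /M1].
    have [_|xu] := eqVneq x u; last by rewrite Mc (negPf xu) (negPf xv) mulr0 subr0.
    by rewrite Mc Mv !eqxx uvF /=; ring.
  - by move=> x y xv; rewrite /M2 (negPf xv).
pose M3 x y := if x == u then (u == y)%:R else idk (Y :\ v) x y.
have e3 : kdet M2 = kdet (idk (Y :\ v)) + (t * K v u) ^+ 2 * kdet M3.
  apply: (kdet_row_linear (v := u)).
  - move=> y; rewrite /M2 /M3 uvF eqxx /M1 eqxx Mv {1}/M /idk /induced !inE uY uvF /=.
    have [->|yv] := eqVneq y v.
      by rewrite /= uvF vY (skew u v) /=; ring.
    by rewrite /=; ring.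
  - move=> x y xu; rewrite /M2 /M1 (negPf xu) /M /idk /induced !inE.
    have [->|xv] /= := eqVneq x v; first by rewrite mulr0 addr0.
    have [->|yv] //= := eqVneq y v; rewrite andbF mulr0.
    by case: ifP => [/andP[xY _]|_]; rewrite ?mulr0 // skew Kv // oppr0 mulr0.
  - move=> x y xu; rewrite /M2 /M3 /M1 (negPf xu) /M /idk /induced !inE.
    have [->|xv] /= := eqVneq x v; first by rewrite mulr0 addr0.
    have [->|yv] //= := eqVneq y v; rewrite andbF mulr0.
    by case: ifP => [/andP[xY _]|_]; rewrite ?mulr0 // skew Kv // oppr0 mulr0.
rewrite -/M -e1 e2 e3; congr (_ + _ * _).
apply: (kdet_unit_row (v := u)).
- by move=> y; rewrite /M3 eqxx.
- by move=> y; rewrite /idk /induced !inE eqxx mulr0 addr0.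
- move=> x y yu; rewrite /M3; have [->|xu] := eqVneq x u.
    by rewrite /idk /induced !inE eqxx mulr0 addr0.
  by rewrite /idk /induced !inE (negPf yu) (negPf xu).
Qed.

Lemma kdet_idk0 : kdet (idk set0) = 1.
Proof.
by rewrite -(kdet_delta T); apply: eq_kdet => x y; rewrite /idk /induced inE mulr0 addr0.
Qed.

End Skew.

Lemma kdet_mul T (a b : T -> T -> R) :
  kdet (fun x y => \sum_z a x z * b z y) = kdet a * kdet b.
Proof.
rewrite /kdet -det_mulmx; congr (\det _); apply/matrixP=> i j; rewrite !mxE.
rewrite (reindex (@enum_val T xpredT)) /=; last by apply: onW_bij; exact: enum_val_bij.
by apply: eq_bigr => k _; rewrite !mxE.
Qed.

Lemma kdet_eigen T (a u : T -> T -> R) d (f : R -> R) : eigenbasis a u d ->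
  kdet (fun x y => \sum_i f (d i) * u i x * u i y) = \prod_i f (d i).
Proof.
move=> [ou au].
have uu : kdet u * kdet u = 1.
  rewrite -{2}kdet_tr -kdet_mul -(kdet_delta T).
  by apply: eq_kdet => x y; exact: ou.
have -> : kdet (fun x y => \sum_i f (d i) * u i x * u i y) =
   kdet (fun x i => f (d i) * u i x) * kdet u.
  by rewrite -kdet_mul; apply: eq_kdet.
have -> : kdet (fun x i => f (d i) * u i x) =
   kdet u * kdet (fun i j => (i == j)%:R * f (d i)).
  rewrite -(kdet_tr u) -kdet_mul; apply: eq_kdet => x i.
  transitivity (\sum_z u z x * f (d z) * (z == i)%:R); first by rewrite sum_delta mulrC.
  by apply: eq_bigr => z _; ring.
rewrite mulrAC uu mul1r /kdet.
have -> : kernel_mx (fun i j : T => (i == j)%:R * f (d i)) =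
   diag_mx (\row_i f (d (enum_val i))).
  apply/matrixP=> i j; rewrite !mxE (inj_eq enum_val_inj).
  by case: eqP; rewrite ?mul1r ?mul0r.
rewrite det_diag; rewrite [RHS](reindex (@enum_val T xpredT)) /=; last first.
  by apply: onW_bij; exact: enum_val_bij.
by apply: eq_bigr => i _; rewrite mxE.
Qed.

(** The skew kernel [K = j S] satisfies [(1 + t K) (1 - t K) = 1 + t^2 S^2], and
    the two factors are transposes of each other. *)
Lemma bipartite_det_square T (S : T -> T -> R) (j : T -> R) (t : R) u d (X : {set T}) :
  symmetric_kernel S -> (forall x, j x * j x = 1) ->
  (forall x y, j x * j y * S x y = - S x y) ->
  eigenbasis (induced X S) u d ->
  \prod_i (1 + t ^+ 2 * d i ^+ 2) = kdet (idk (fun x y => j x * S x y) t X) ^+ 2.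
Proof.
move=> sS j1 jS eb; have [ou au] := eb.
pose K x y := j x * S x y.
have skew x y : K x y = - K y x.
  rewrite /K (sS y x) -[S x y in LHS]opprK -jS mulrN; congr (- _).
  by rewrite mulrA mulrA j1 mul1r.
pose SX := induced X S.
have KX x y : induced X K x y = j x * SX x y.
  by rewrite /SX /induced; case: ifP => _; rewrite ?mulr0.
have skX x y : induced X K x y = - induced X K y x.
  by rewrite /induced andbC; case: ifP => _; rewrite ?oppr0 // skew.
have dd := kdet_tr (idk K t X).
rewrite -/K [RHS]expr2 -{2}dd -kdet_mul.
rewrite -(kdet_eigen (fun z => 1 + t ^+ 2 * z ^+ 2) eb).
apply: eq_kdet => x y.
under eq_bigr do rewrite -mulrA mulrDl mul1r -mulrA.
rewrite big_split /= (onb_dual ou) -mulr_sumr.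
have -> : \sum_i d i ^+ 2 * (u i x * u i y) = square SX x y.
  rewrite (eigenbasis_kernel (square_eigenbasis eb)).
  by apply: eq_bigr => i _; rewrite mulrA.
transitivity (\sum_z ((x == z)%:R * (y == z)%:R + t * (induced X K x y * (y == z)%:R)
     + t * (induced X K y x * (x == z)%:R) + t ^+ 2 * (induced X K x z * induced X K y z)));
  last first.
  apply: eq_bigr => z _; rewrite /idk.
  have -> : induced X K x y * (y == z)%:R = induced X K x z * (y == z)%:R.
    by case: eqP => [->|]; rewrite ?mulr0.
  have -> : induced X K y x * (x == z)%:R = induced X K y z * (x == z)%:R.
    by case: eqP => [->|]; rewrite ?mulr0.
  by ring.
have s1 (z : T) : \sum_i (z == i)%:R = 1 :> R.
  by rewrite -[RHS](sum_deltaC (fun=> 1) z); apply: eq_bigr => i _; rewrite mul1r.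
rewrite !big_split /= -!mulr_sumr !sum_deltaC !s1 !mulr1 skX mulrN subrK.
congr (_ + _ * _).
have jSX x' y' : j x' * j y' * SX x' y' = - SX x' y'.
  by rewrite /SX /induced; case: ifP => _; rewrite ?jS // mulr0 oppr0.
apply: eq_bigr => z _; rewrite !KX [SX z y](induced_symmetric X sS).
rewrite -[LHS]mulrNN -(jSX x z) -(jSX y z).
by rewrite -[RHS]mulr1 -(j1 z); ring.
Qed.

End KernelDet.

(** * Matching polynomials of forests *)

Section Matchings.
Variable R : realType.
Implicit Types (T : finType) (s t : R).

(** The matching polynomial of the path on [n] vertices, with weight [s] per
    edge. *)
Fixpoint pmatch s n : R :=
  if n is n1.+1 then if n1 is n2.+1 then pmatch s n1 + s * pmatch s n2 else 1 else 1.

Lemma pmatchSS s n : pmatch s n.+2 = pmatch s n.+1 + s * pmatch s n.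
Proof. by []. Qed.

Lemma pmatch_gt0 s n : 0 < s -> 0 < pmatch s n.
Proof.
move=> s0; suff : 0 < pmatch s n /\ 0 < pmatch s n.+1 by case.
elim: n => [|n [IH1 IH2]]; first by rewrite ltr01.
by split=> //; rewrite pmatchSS addr_gt0 // mulr_gt0.
Qed.

Lemma pmatch_mono s n : 0 < s -> pmatch s n <= pmatch s n.+1.
Proof.
move=> s0; case: n => [|n]; first exact: lexx.
by rewrite pmatchSS lerDl mulr_ge0 ?ltW // pmatch_gt0.
Qed.

(** For a squared spectrum the linear part sums to a trace and the logarithmic
    part to a determinant. *)
Definition kappa s y : R := s * y - ln (1 + s * y).

Lemma kappa_bipartite T (S : T -> T -> R) (j : T -> R) s u d (X : {set T}) :
  0 < s -> symmetric_kernel S -> (forall x, j x * j x = 1) ->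
  (forall x y, j x * j y * S x y = - S x y) ->
  eigenbasis (induced X S) u d ->
  0 < kdet (idk (fun x y => j x * S x y) (Num.sqrt s) X) ->
  \sum_i kappa s (d i ^+ 2) = s * (\sum_(x in X) \sum_(y in X) S x y ^+ 2) -
     2 * ln (kdet (idk (fun x y => j x * S x y) (Num.sqrt s) X)).
Proof.
move=> s0 sS j1 jS eb D0; have [ou au] := eb.
have := bipartite_det_square (Num.sqrt s) sS j1 jS eb; rewrite sqr_sqrtr ?ltW //.
move=> detE; rewrite sumrB; congr (_ - _).
  rewrite -mulr_sumr; congr (_ * _).
  transitivity (\sum_x square (induced X S) x x).
    under [RHS]eq_bigr do rewrite (eigenbasis_kernel (square_eigenbasis eb)).
    rewrite exchange_big; apply: eq_bigr => i _ /=.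
    transitivity (d i ^+ 2 * \sum_x u i x * u i x); first by rewrite ou eqxx mulr1.
    by rewrite mulr_sumr; apply: eq_bigr => x _; rewrite mulrA.
  rewrite [RHS]big_mkcond; apply: eq_bigr => x _; rewrite /square.
  case: ifP => xX; last by rewrite big1 // => y _; rewrite /induced xX mul0r.
  rewrite [RHS]big_mkcond; apply: eq_bigr => y _; rewrite /induced xX /= andbT.
  by case: ifP => _; rewrite ?mul0r // [S y x]sS expr2.
have -> : 2 * ln (kdet (idk (fun x y => j x * S x y) (Num.sqrt s) X)) =
   ln (\prod_i (1 + s * d i ^+ 2)).
  by rewrite detE lnXn // mulr_natl.
have pos (r : seq T) : 0 < \prod_(i <- r) (1 + s * d i ^+ 2).
  by apply: prodr_gt0 => i _; rewrite ltr_wpDr // mulr_ge0 ?sqr_ge0 // ltW.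
elim: (index_enum T) => [|i r IH]; first by rewrite !big_nil ln1.
rewrite !big_cons lnM ?posrE //; first by rewrite IH.
by rewrite ltr_wpDr // mulr_ge0 ?sqr_ge0 // ltW.
Qed.

(** A vertex of maximal level in [Y] is a leaf of [Y] or isolated.  Deleting it
    yields the recursion of the path, with weight at most [t ^+ 2] on the last
    edge. *)
Lemma forest_det T (S : T -> T -> R) (j : T -> R) (lev : T -> nat) (par : T -> T) t (X : {set T}) :
  0 < t -> symmetric_kernel S -> (forall x, j x * j x = 1) ->
  (forall x y, j x * j y * S x y = - S x y) -> (forall x y, S x y ^+ 2 <= 1) ->
  (forall x y, x \in X -> y \in X -> (lev y <= lev x)%N -> S x y != 0 -> y = par x) ->
  forall Y : {set T}, Y \subset X ->
  0 < kdet (idk (fun x y => j x * S x y) t Y) <= pmatch (t ^+ 2) #|Y|.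
Proof.
move=> t0 sS j1 jS S1 Spar Y.
have skew x y : j x * S x y = - (j y * S y x).
  rewrite (sS y x) -[S x y in LHS]opprK -jS mulrN; congr (- _).
  by rewrite mulrA mulrA j1 mul1r.
have s0 : 0 < t ^+ 2 by rewrite exprn_gt0.
have S0 x : S x x = 0.
  by have := jS x x; rewrite j1 mul1r => h; lra.
have [n] := ubnP #|Y|; elim: n Y => // n IH Y Yn YX.
have [->|[x0 x0Y]] := set_0Vmem Y; first by rewrite kdet_idk0 cards0 ltr01 lexx.
pose v := [arg max_(x > x0 in Y) lev x]%N.
have [vY vmax] : v \in Y /\ forall y, y \in Y -> (lev y <= lev v)%N.
  by rewrite /v; case: arg_maxnP => //.
have cY : #|Y| = #|Y :\ v|.+1 by rewrite (cardsD1 v) vY.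
have Y1X : Y :\ v \subset X by apply: subset_trans YX; exact: subsetDl.
have Y1n : (#|Y :\ v| < n)%N by move: Yn; rewrite cY.
have /andP[h1 h2] := IH _ Y1n Y1X.
have [/existsP[u /andP[uY Su]]|] := boolP [exists u, (u \in Y) && (S v u != 0)]; last first.
  rewrite negb_exists => /forallP iso.
  rewrite (kdet_isolated _ skew vY); last first.
    by move=> x xY; have := iso x; rewrite xY /= negbK => /eqP->; rewrite mulr0.
  by rewrite h1 cY (le_trans h2) ?pmatch_mono.
have uv : u != v by apply: contraNneq Su => ->; rewrite S0.
have uE : u = par v by apply: Spar => //; [exact: (subsetP YX)|exact: (subsetP YX)|exact: vmax].
rewrite (kdet_leaf t skew vY uY uv); last first.
  move=> x xY xu; have [->|Sx] := eqVneq (S v x) 0; first by rewrite mulr0.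
  case/eqP: xu; rewrite uE; apply: Spar Sx => //; [exact: (subsetP YX)|exact: (subsetP YX)|].
  exact: vmax.
have uY1 : u \in Y :\ v by rewrite !inE uv.
have cY1 : #|Y :\ v| = #|Y :\ v :\ u|.+1 by rewrite (cardsD1 u) uY1.
have Y2X : Y :\ v :\ u \subset X by apply: subset_trans Y1X; exact: subsetDl.
have Y2n : (#|Y :\ v :\ u| < n)%N by apply: ltn_trans Y1n; rewrite cY1.
have /andP[k1 k2] := IH _ Y2n Y2X.
have tS : (t * (j v * S v u)) ^+ 2 = t ^+ 2 * S v u ^+ 2.
  by rewrite !exprMn [j v ^+ 2]expr2 j1 mul1r.
rewrite tS; apply/andP; split.
  apply: ltr_wpDr => //; apply: mulr_ge0; last exact: ltW.
  by apply: mulr_ge0; [exact: ltW|exact: sqr_ge0].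
rewrite cY cY1 pmatchSS -cY1; apply: lerD => //.
rewrite -mulrA ler_wpM2l ?(ltW s0) //; apply: le_trans k2.
by rewrite ler_piMl // ltW.
Qed.

Lemma path_det m t : 0 < t ->
  kdet (idk (fun x y => (-1) ^+ (x : path_graph m) * @adjk R (path_graph m) x y) t setT) =
  pmatch (t ^+ 2) m.
Proof.
move=> t0; set K := fun x y => _.
have sS : symmetric_kernel (@adjk R (path_graph m)) by exact: adjk_symmetric.
have j1 (x : path_graph m) : (-1) ^+ x * (-1) ^+ x = 1 :> R by rewrite -expr2 sqrr_sign.
have skew x y : K x y = - K y x.
  rewrite /K (sS y x) -[adjk _ x y in LHS]opprK -path_sign mulrN; congr (- _).
  by rewrite mulrA mulrA j1 mul1r.
pose Y n : {set path_graph m} := [set i : path_graph m | (i < n)%N].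
have -> : setT = Y m by apply/setP=> i; rewrite !inE ltn_ord.
suff h n : (n <= m)%N -> kdet (idk K t (Y n)) = pmatch (t ^+ 2) n /\
    ((n < m)%N -> kdet (idk K t (Y n.+1)) = pmatch (t ^+ 2) n.+1).
  by have [] := h m (leqnn m).
elim: n => [|n IH] nm.
  have Y0 : Y 0%N = set0 by apply/setP=> i; rewrite !inE.
  split=> [|m0]; first by rewrite Y0 kdet_idk0.
  pose v : path_graph m := Ordinal m0.
  rewrite (kdet_isolated t skew (v := v)) ?inE //; last first.
    by move=> x; rewrite !inE => x0; rewrite /K /adjk /= /path_adj /=;
       case: (nat_of_ord x) x0 => //=; rewrite mulr0.
  have -> : Y 1%N :\ v = set0; last by rewrite kdet_idk0.
  by apply/setP=> i; rewrite !inE -val_eqE /=; case: (nat_of_ord i).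
have [h1 h2] := IH (ltnW nm); have {}h2 := h2 nm.
split=> // n1m.
pose v : path_graph m := Ordinal n1m; pose u : path_graph m := Ordinal nm.
have uv : u != v by rewrite -val_eqE /= neq_ltn ltnSn.
rewrite (kdet_leaf t skew (v := v) (u := u)) ?inE //=; last first.
  move=> x; rewrite !inE -val_eqE /= => xn xu; rewrite /K /adjk /= /path_adj /=.
  have -> : (n.+2 == x :> nat) = false by apply/eqP; lia.
  have -> : (x.+1 == n.+1) = false by apply/eqP; move/eqP: xu; lia.
  by rewrite mulr0.
have -> : Y n.+2 :\ v = Y n.+1.
  by apply/setP=> i; rewrite !inE -val_eqE /=; lia.
have -> : Y n.+1 :\ u = Y n.
  by apply/setP=> i; rewrite !inE -val_eqE /=; lia.
rewrite h1 h2 -[RHS]/(pmatch (t ^+ 2) n.+1 + t ^+ 2 * pmatch (t ^+ 2) n); congr (_ + _ * _).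
rewrite /K /adjk /= /path_adj /= eqxx orbT mulr1 exprMn.
by rewrite sqrr_sign mulr1.
Qed.

Lemma path_trace m : \sum_(x in [set: path_graph m]) \sum_(y in [set: path_graph m])
   @adjk R (path_graph m) x y ^+ 2 = 2 * (m.-1)%:R.
Proof.
transitivity (\sum_(x < m) \sum_(y < m) ((x.+1 == y :> nat)%:R + (y.+1 == x :> nat)%:R : R)).
  apply: eq_big => [x|x _]; first by rewrite inE.
  apply: eq_big => [y|y _]; first by rewrite inE.
  rewrite /adjk /= /path_adj; have [/eqP h|_] /= := boolP (x.+1 == y :> nat).
    by have -> : (y.+1 == x :> nat) = false; [apply/eqP; lia|rewrite addr0 expr1n].
  by rewrite add0r; case: (_ == _); rewrite ?expr1n ?expr0n.
under eq_bigr do rewrite big_split /=.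
rewrite big_split /= [X in _ + X]exchange_big /= mulrDl mul1r.
suff -> : \sum_(x < m) \sum_(y < m) (x.+1 == y :> nat)%:R = (m.-1)%:R :> R by [].
case: m => [|m]; first by rewrite big_ord0.
rewrite big_ord_recr /= [X in _ + X]big1 ?addr0 => [|y _]; last first.
  by have -> : (m.+1 == y :> nat) = false; [apply/eqP; have := ltn_ord y; lia|].
rewrite -[RHS](_ : \sum_(x < m) 1 = _); last by rewrite sumr_const card_ord.
apply: eq_bigr => x _.
have xm : (x.+1 < m.+1)%N by rewrite ltnS.
rewrite (bigD1 (Ordinal xm)) //= eqxx big1 ?addr0 // => y.
by rewrite -val_eqE /= eq_sym => /negPf->.
Qed.

Lemma path_kappa m s u d : 0 < s -> eigenbasis (@adjk R (path_graph m)) u d ->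
  \sum_i kappa s (d i ^+ 2) = 2 * s * (m.-1)%:R - 2 * ln (pmatch s m).
Proof.
move=> s0 [ou au].
have eb : eigenbasis (induced setT (@adjk R (path_graph m))) u d.
  by split=> // i x; rewrite -au; apply: eq_bigr => y _; rewrite /induced !inE.
have t0 : 0 < Num.sqrt s by rewrite sqrtr_gt0.
have detE := path_det m t0; rewrite sqr_sqrtr ?ltW // in detE.
rewrite (kappa_bipartite s0 _ _ (@path_sign _ _) eb).
- by rewrite path_trace detE; ring.
- exact: adjk_symmetric.
- by move=> x; rewrite -expr2 sqrr_sign.
- by rewrite detE pmatch_gt0.
Qed.

End Matchings.

(** * From logarithmic kernels to powers *)

Section KernelToPower.
Variable R : realType.
Implicit Types (s y : R).

Lemma ln_le_sub1 (t : R) : 0 < t -> ln t <= t - 1.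
Proof.
move=> t0; have := @le_ln1Dx R (t - 1); rewrite (_ : 1 + (t - 1) = t); last by ring.
by apply; lra.
Qed.

Lemma kappa_scale s c y : kappa s (c * y) = kappa (s * c) y.
Proof. by rewrite /kappa mulrA. Qed.

Lemma kappa_le_lin s y : 0 <= s -> 0 <= y -> kappa s y <= s * y.
Proof.
by move=> s0 y0; rewrite /kappa lerBlDr lerDl ln_ge0 // lerDl mulr_ge0.
Qed.

Lemma kappa_ge0 s y : 0 <= s -> 0 <= y -> 0 <= kappa s y.
Proof.
move=> s0 y0; rewrite /kappa subr_ge0 le_ln1Dx //.
by apply: lt_le_trans (mulr_ge0 s0 y0); rewrite oppr_lt0.
Qed.

Lemma kappa_mono s y z : 0 <= s -> 0 <= y -> y <= z -> kappa s y <= kappa s z.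
Proof.
move=> s0 y0 yz; rewrite /kappa.
have a0 : 0 <= s * y by exact: mulr_ge0.
have ab : s * y <= s * z by exact: ler_wpM2l.
move: (s * y) (s * z) a0 ab => a b a0 ab.
have pa : 0 < 1 + a by lra.
have pb : 0 < 1 + b by lra.
have : ln ((1 + b) / (1 + a)) <= (1 + b) / (1 + a) - 1.
  by apply: ln_le_sub1; rewrite divr_gt0.
rewrite lnM ?posrE ?invr_gt0 // lnV ?posrE // => h.
have h2 : (1 + b) / (1 + a) - 1 <= b - a.
  rewrite lerBlDr ler_pdivrMr // -subr_ge0.
  have -> : (b - a + 1) * (1 + a) - (1 + b) = (b - a) * a by ring.
  by rewrite mulr_ge0 // subr_ge0.
lra.
Qed.

Lemma kappa_le_sqr s y : 0 <= s -> 0 <= y -> kappa s y <= (s * y) ^+ 2.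
Proof.
move=> s0 y0; rewrite /kappa; have := mulr_ge0 s0 y0; move: (s * y) => a a0.
have pa : 0 < 1 + a by lra.
have : ln (1 + a)^-1 <= (1 + a)^-1 - 1.
  by apply: ln_le_sub1; rewrite invr_gt0.
rewrite lnV ?posrE // => h.
have h2 : (1 + a)^-1 - 1 <= a ^+ 2 - a.
  rewrite lerBlDr -[leLHS]mul1r ler_pdivrMr // -subr_ge0.
  have -> : (a ^+ 2 - a + 1) * (1 + a) - 1 = a ^+ 2 * a by ring.
  by rewrite mulr_ge0 // sqr_ge0.
lra.
Qed.

Lemma kappa11_gt0 : 0 < kappa (1 : R) 1.
Proof.
rewrite /kappa mulr1; have -> : 1 + 1 = (1 + 3^-1) * (1 + 2^-1) :> R by field.
have p2 : 0 < 2^-1 :> R by rewrite invr_gt0.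
have p3 : 0 < 3^-1 :> R by rewrite invr_gt0.
rewrite lnM ?posrE; [|by lra|by lra].
have h1 : ln (1 + 3^-1) <= 3^-1 :> R by apply: le_ln1Dx; lra.
have h2 : ln (1 + 2^-1) <= 2^-1 :> R by apply: le_ln1Dx; lra.
lra.
Qed.

Lemma geometric_bound (x : R) N : 0 <= x < 1 -> \sum_(k < N) x ^+ k <= (1 - x)^-1.
Proof.
move=> /andP[x0 x1]; have p : 0 < 1 - x by rewrite subr_gt0.
rewrite -[leRHS]mul1r ler_pdivlMr // mulrC.
have -> : (1 - x) * \sum_(k < N) x ^+ k = 1 - x ^+ N.
  by rewrite -opprB mulNr -subrX1 opprB.
by rewrite lerBlDr lerDl exprn_ge0.
Qed.

Lemma gt1_ltr_powR (x : R) : 1 < x -> {homo powR x : a b / a < b}.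
Proof.
move=> x1 a b ab; have x0 : 0 < x by apply: lt_trans x1.
have ba : 0 < b - a by rewrite subr_gt0.
rewrite -[b](subrK a) powRD; last by rewrite (gt_eqF x0) implybT.
rewrite ltr_pMl ?powR_gt0 //.
have := @gt0_ltr_powR R _ ba 1 x; rewrite !nnegrE powR1; apply=> //.
exact: ltW.
Qed.

Section Scale.
Variables (q r : R).
Hypotheses (q1 : 1 < q) (r12 : 1 < r < 2).
Let b := q `^ r.
Let a := b^-1.

Let q0 : 0 < q. Proof. exact: lt_trans q1. Qed.
Let b0 : 0 < b. Proof. exact: powR_gt0. Qed.
Let a0 : 0 < a. Proof. by rewrite invr_gt0. Qed.

Let aq : 0 <= a * q < 1.
Proof.
rewrite mulr_ge0 ?ltW //= /a mulrC ltr_pdivrMr // mul1r /b.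
rewrite -{1}(powRr1 (ltW q0)); apply: gt1_ltr_powR => //.
by case/andP: r12.
Qed.

Let bq : 0 <= b / q ^+ 2 < 1.
Proof.
have q2 : 0 < q ^+ 2 by rewrite exprn_gt0.
rewrite divr_ge0 ?ltW //= ltr_pdivrMr // mul1r -powR_mulrn ?ltW //.
by apply: gt1_ltr_powR => //; case/andP: r12.
Qed.

Let qX m : 0 <= q ^+ m. Proof. by rewrite exprn_ge0 // ltW. Qed.
Let qV m : 0 <= q ^- m. Proof. by rewrite invr_ge0. Qed.
Let aX m : 0 <= a ^+ m. Proof. by rewrite exprn_ge0 // ltW. Qed.
Let bX m : 0 <= b ^+ m. Proof. by rewrite exprn_ge0 // ltW. Qed.

(** Together with [downsum] a discrete form of the integral of [s^(-r) kappa s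
    y] with respect to ds/s over all scales [s = q ^ k].  The large scales
    converge as [kappa] grows at most linearly and [r > 1], the small ones as it
    vanishes to second order and [r < 2]. *)
Definition upsum N y := \sum_(k < N) a ^+ k * kappa (q ^+ k) y.
Definition downsum N y := \sum_(k < N) b ^+ k.+1 * kappa (q ^- k.+1) y.
Definition scalesum N y := upsum N y + downsum N y.

Lemma scalesum_mono N N' y : 0 <= y -> (N <= N')%N -> scalesum N y <= scalesum N' y.
Proof.
move=> y0 NN; apply: lerD.
  rewrite /upsum -(subnKC NN) big_split_ord /= lerDl sumr_ge0 // => k _.
  by rewrite mulr_ge0 ?aX // kappa_ge0 ?qX.
rewrite /downsum -(subnKC NN) big_split_ord /= lerDl sumr_ge0 // => k _.
by rewrite mulr_ge0 ?bX // kappa_ge0 ?qV.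
Qed.

Lemma scalesum_bounded y : 0 <= y -> exists c, forall N, scalesum N y <= c.
Proof.
move=> y0; exists (y * (1 - a * q)^-1 + y ^+ 2 * (1 - b / q ^+ 2)^-1) => N.
apply: lerD.
  apply: le_trans (_ : y * \sum_(k < N) (a * q) ^+ k <= _).
    rewrite mulr_sumr; apply: ler_sum => k _.
    rewrite exprMn mulrCA ler_wpM2l ?exprn_ge0 ?(ltW a0) // mulrC.
    by apply: kappa_le_lin => //; rewrite exprn_ge0 // ltW.
  by rewrite ler_wpM2l // geometric_bound.
apply: le_trans (_ : y ^+ 2 * \sum_(k < N.+1) (b / q ^+ 2) ^+ k <= _); last first.
  by rewrite ler_wpM2l ?sqr_ge0 // geometric_bound.
rewrite big_ord_recl mulrDr; apply: ler_wpDl.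
  by rewrite expr0 mulr1 sqr_ge0.
rewrite mulr_sumr; apply: ler_sum => k _; rewrite /= /bump /= add1n.
have -> : y ^+ 2 * (b / q ^+ 2) ^+ k.+1 = b ^+ k.+1 * (q ^- k.+1 * y) ^+ 2.
  rewrite !exprMn !exprVn -!exprM [(2 * _)%N]mulnC; ring.
rewrite ler_wpM2l ?exprn_ge0 ?(ltW b0) //.
by apply: kappa_le_sqr => //; rewrite invr_ge0 exprn_ge0 // ltW.
Qed.

(** Multiplying the argument by [q] shifts the scales by one, hence multiplies
    the two-sided sum by [b = q `^ r] up to the terms at its ends. *)
Lemma scalesum_shift N y : 0 <= y ->
  b * scalesum N y <= scalesum N.+1 (q * y) <= b * scalesum N.+2 y.
Proof.
move=> y0.
have ab : b * a = 1 by rewrite divff // gt_eqF.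
have qn0 : q != 0 by rewrite gt_eqF.
have upE M : b * upsum M.+1 y = b * kappa 1 y + upsum M (q * y).
  rewrite /upsum big_ord_recl mulrDr !expr0 mul1r; congr (_ + _).
  rewrite mulr_sumr; apply: eq_bigr => k _; rewrite /= /bump /= add1n.
  by rewrite kappa_scale -exprSr exprS !mulrA ab mul1r.
have downE M : downsum M.+1 (q * y) = b * kappa 1 y + b * downsum M y.
  rewrite /downsum big_ord_recl mulr_sumr; congr (_ + _).
    by rewrite kappa_scale !expr1 mulVf.
  apply: eq_bigr => k _; rewrite /= /bump /= add1n kappa_scale.
  have -> : q ^- k.+2 * q = q ^- k.+1.
    by rewrite exprS invfM mulrAC mulVf ?mul1r.
  by rewrite exprS mulrA.
have key : scalesum N.+1 (q * y) = b * (upsum N.+2 y + downsum N y).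
  by rewrite /scalesum mulrDr upE downE addrA [upsum _ _ + _]addrC.
have dm M M' : (M <= M')%N -> downsum M y <= downsum M' y.
  move=> MM; rewrite /downsum -(subnKC MM) big_split_ord /= lerDl sumr_ge0 // => k _.
  by rewrite mulr_ge0 ?bX // kappa_ge0 ?qV.
have um M M' : (M <= M')%N -> upsum M y <= upsum M' y.
  move=> MM; rewrite /upsum -(subnKC MM) big_split_ord /= lerDl sumr_ge0 // => k _.
  by rewrite mulr_ge0 ?aX // kappa_ge0 ?qX.
rewrite key !ler_pM2l // /scalesum; apply/andP; split; apply: lerD => //.
- by apply: um; rewrite ltnW.
- by apply: dm; rewrite ltnW.
Qed.

Definition scalelim y := sup (fun z => exists N, z = scalesum N y).

Lemma scalelim_has_sup y : 0 <= y -> classical_sets.has_sup (fun z => exists N, z = scalesum N y).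
Proof.
move=> y0; split; first by exists (scalesum 0 y), 0%N.
have [c h] := scalesum_bounded y0.
by exists c => z [N ->].
Qed.

Lemma scalesum_le_lim N y : 0 <= y -> scalesum N y <= scalelim y.
Proof.
move=> y0; apply: ub_le_sup; first by case: (scalelim_has_sup y0).
by exists N.
Qed.

Lemma scalelim_le y c : 0 <= y -> (forall N, scalesum N y <= c) -> scalelim y <= c.
Proof.
move=> y0 h; apply: ge_sup; first by case: (scalelim_has_sup y0).
by move=> z [N ->].
Qed.

Lemma scalelim_homogeneous y : 0 <= y -> scalelim (q * y) = b * scalelim y.
Proof.
move=> y0; have qy0 : 0 <= q * y by rewrite mulr_ge0 // ltW.
apply/eqP; rewrite eq_le; apply/andP; split.
  apply: scalelim_le => // N; apply: le_trans (scalesum_mono qy0 (leqnSn N)) _.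
  have /andP[_ h] := scalesum_shift N y0; apply: le_trans h _.
  by rewrite ler_pM2l // scalesum_le_lim.
rewrite mulrC -ler_pdivlMr //; apply: scalelim_le => // N.
rewrite ler_pdivlMr // mulrC.
have /andP[h _] := scalesum_shift N y0; apply: le_trans h _.
exact: scalesum_le_lim.
Qed.

Lemma scalelim_homogeneousX n y : 0 <= y -> scalelim (q ^+ n * y) = b ^+ n * scalelim y.
Proof.
move=> y0; elim: n => [|n IH]; first by rewrite !expr0 !mul1r.
by rewrite !exprS -!mulrA scalelim_homogeneous ?IH // mulr_ge0 // exprn_ge0 // ltW.
Qed.

Lemma scalelim_mono y z : 0 <= y -> y <= z -> scalelim y <= scalelim z.
Proof.
move=> y0 yz; have z0 := le_trans y0 yz.
apply: scalelim_le => // N; apply: le_trans (scalesum_le_lim N z0).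
apply: lerD; apply: ler_sum => k _.
  by rewrite ler_wpM2l ?aX // kappa_mono ?qX.
by rewrite ler_wpM2l ?bX // kappa_mono ?qV.
Qed.

Lemma scalelim1_gt0 : 0 < scalelim 1.
Proof.
apply: lt_le_trans (scalesum_le_lim 1 ler01).
rewrite /scalesum /upsum /downsum !big_ord_recl !big_ord0 !addr0 expr0 mul1r.
by rewrite ltr_wpDr ?kappa11_gt0 // mulr_ge0 ?bX // kappa_ge0 ?qV.
Qed.

Lemma scalelim0 : scalelim 0 = 0.
Proof.
have h := scalelim_homogeneous (lexx 0); rewrite mulr0 in h.
have b1 : b - 1 != 0.
  rewrite subr_eq0 gt_eqF // /b -(powRr0 q); apply: gt1_ltr_powR => //.
  by case/andP: r12 => r1 _; apply: lt_trans r1.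
have : (b - 1) * scalelim 0 = 0 by rewrite mulrBl mul1r -h subrr.
by move/eqP; rewrite mulf_eq0 (negPf b1) => /eqP.
Qed.

Lemma expn_unbounded (z : R) : exists n, z < q ^+ n.
Proof.
have p : 0 < q - 1 by rewrite subr_gt0.
have bern n : 1 + n%:R * (q - 1) <= q ^+ n.
  elim: n => [|n IH]; first by rewrite mul0r addr0 expr0.
  rewrite exprS; apply: le_trans (ler_wpM2l (ltW q0) IH).
  rewrite -natr1 -subr_ge0.
  have -> : q * (1 + n%:R * (q - 1)) - (1 + (n%:R + 1) * (q - 1)) = n%:R * (q - 1) ^+ 2 by ring.
  by rewrite mulr_ge0 // sqr_ge0.
pose n := (Num.Def.truncn (`|z| / (q - 1))).+1.
exists n; apply: lt_le_trans (bern n).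
have h : `|z| / (q - 1) < n%:R by rewrite truncnS_gt.
rewrite ltr_pdivrMr // in h.
apply: le_lt_trans (ler_norm z) _; lra.
Qed.

(** Exact homogeneity under [q] together with monotonicity pins the function
    down between two consecutive powers of [q]. *)
Lemma scalelim_power y : 0 <= y ->
  scalelim 1 / b * y `^ r <= scalelim y <= scalelim 1 * b * y `^ r.
Proof.
have r0 : 0 < r by case/andP: r12 => r1 _; apply: lt_trans r1.
have bqr n : b ^+ n = (q ^+ n) `^ r.
  elim: n => [|n IH]; first by rewrite !expr0 powR1.
  by rewrite !exprS powRM ?exprn_ge0 ?ltW // IH.
have c0 := scalelim1_gt0.
move=> yge0; have [->|yn] := eqVneq y 0.
  by rewrite scalelim0 powR0 ?gt_eqF // !mulr0 lexx.
have y0 : 0 < y by rewrite lt_def yn.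
have [n nP] := expn_unbounded y^-1.
have y1 : 1 <= q ^+ n * y by rewrite -(ler_pM2r (_ : 0 < y^-1)) ?invr_gt0 // mul1r mulfK ?gt_eqF // ltW.
(* After scaling by a power of [q] the argument exceeds 1 and lies between
   consecutive natural powers. *)
have [k /andP[k1 k2]] : exists k, (q ^+ k <= q ^+ n * y < q ^+ k.+1).
  have ex : exists k, q ^+ n * y < q ^+ k.+1.
    have [k kP] := expn_unbounded (q ^+ n * y); exists k.
    by apply: lt_le_trans kP _; rewrite ler_eXn2l.
  case: (ex_minnP ex) => -[|k] kP kmin; first by exists 0%N; rewrite kP andbT expr0.
  exists k.+1; rewrite kP andbT leNgt; apply/negP => /kmin; by rewrite ltnn.
have yn0 : 0 <= q ^+ n * y by apply: le_trans y1.
have qk0 m : 0 <= q ^+ m by rewrite exprn_ge0 // ltW.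
have yr : (q ^+ n * y) `^ r = b ^+ n * y `^ r by rewrite powRM ?(ltW y0) // bqr.
have Jy : scalelim (q ^+ n * y) = b ^+ n * scalelim y by rewrite scalelim_homogeneousX ?ltW.
have bn : 0 < b ^+ n by rewrite exprn_gt0.
have J1 m : scalelim (q ^+ m) = b ^+ m * scalelim 1.
  by rewrite -[q ^+ m]mulr1 scalelim_homogeneousX.
have lo : b ^+ k * scalelim 1 <= scalelim (q ^+ n * y).
  by rewrite -J1; apply: scalelim_mono.
have hi : scalelim (q ^+ n * y) <= b ^+ k.+1 * scalelim 1.
  by rewrite -J1; apply: scalelim_mono => //; exact: ltW.
have plo : b ^+ k <= (q ^+ n * y) `^ r.
  by rewrite bqr ge0_ler_powR ?nnegrE // ltW.
have phi : (q ^+ n * y) `^ r <= b ^+ k.+1.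
  by rewrite bqr ge0_ler_powR ?nnegrE // ltW.
rewrite -(ler_pM2l bn) -[X in _ && X](ler_pM2l bn) -Jy.
have -> : b ^+ n * (scalelim 1 / b * y `^ r) = scalelim 1 / b * (b ^+ n * y `^ r) by ring.
have -> : b ^+ n * (scalelim 1 * b * y `^ r) = scalelim 1 * b * (b ^+ n * y `^ r) by ring.
rewrite -yr; apply/andP; split.
  apply: le_trans lo; rewrite mulrAC ler_pdivrMr // mulrC [b ^+ k * _ * _]mulrAC.
  by rewrite ler_wpM2r ?(ltW c0) // -exprSr.
apply: le_trans hi _; rewrite mulrC -mulrA ler_wpM2l ?(ltW c0) //.
by rewrite exprS ler_wpM2l // ltW.
Qed.

End Scale.

Section Families.
Variables (I J : finType) (u : I -> R) (w : J -> R).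
Hypotheses (u0 : forall i, 0 <= u i) (w0 : forall j, 0 <= w j).
Hypothesis kap : forall s, 0 < s -> \sum_j kappa s (w j) <= \sum_i kappa s (u i).

(** The functions [scalelim q r] are between two multiples of the power function
    whose ratio is [b ^+ 2], and the sums of [scalelim] inherit the hypothesis.
    Letting [q] tend to 1 makes the ratio tend to 1. *)
Lemma kappa_to_power_strict r : 1 < r < 2 -> \sum_j w j `^ r <= \sum_i u i `^ r.
Proof.
move=> r12; have r0 : 0 < r by case/andP: r12 => r1 _; apply: lt_trans r1.
apply: (@ler_vanishing _ _ _ (\sum_i u i `^ r)) => N.
have N0 : 0 < N.+1%:R :> R by rewrite ltr0Sn.
pose x : R := 1 + N.+1%:R^-1.
have x1 : 1 < x by rewrite ltrDl invr_gt0.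
have x0 : 0 < x by apply: lt_trans x1.
(* This choice makes the ratio [b ^+ 2] of the two bounds in [scalelim_power]
   equal to [1 + 1 / (N + 1)]. *)
pose q := x `^ (2 * r)^-1.
have q1 : 1 < q.
  rewrite -(powRr0 x); apply: gt1_ltr_powR => //; by rewrite invr_gt0 mulr_gt0.
pose b := q `^ r.
have b0 : 0 < b by rewrite powR_gt0 // (lt_trans _ q1).
have bb : b * b = x.
  rewrite /b /q -powRrM -powRD; last by rewrite (gt_eqF x0) implybT.
  have -> : (2 * r)^-1 * r + (2 * r)^-1 * r = 1 by field; rewrite gt_eqF.
  by rewrite powRr1 // ltW.
have q0 : 0 < q by apply: lt_trans q1.
have c0 := scalelim1_gt0 q1 r12.
have Ssum M : \sum_j scalesum q r M (w j) <= \sum_i scalesum q r M (u i).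
  rewrite !big_split /=; apply: lerD; rewrite exchange_big [leRHS]exchange_big;
  apply: ler_sum => k _; rewrite -!mulr_sumr ler_wpM2l ?exprn_ge0 ?invr_ge0 ?(ltW b0) //;
  apply: kap; by rewrite ?invr_gt0 exprn_gt0.
have limsum : \sum_j scalelim q r (w j) <= \sum_i scalelim q r (u i).
  apply: (@ler_vanishing _ _ _ #|J|%:R) => M.
  have M0 : 0 < M.+1%:R^-1 :> R by rewrite invr_gt0.
  have app j : exists n, scalelim q r (w j) - M.+1%:R^-1 < scalesum q r n (w j).
    have [z [n ->] h] := sup_adherent M0 (scalelim_has_sup q1 r12 (w0 j)).
    by exists n.
  pose n j := xchoose (app j).
  pose n0 := (\max_j n j)%N.
  have h j : scalelim q r (w j) <= scalesum q r n0 (w j) + M.+1%:R^-1.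
    rewrite -lerBlDr; apply: le_trans (ltW (xchooseP (app j))) _.
    by apply: scalesum_mono => //; exact: leq_bigmax.
  apply: le_trans (ler_sum _ (fun j _ => h j)) _.
  rewrite big_split /= sumr_const; apply: lerD; last by rewrite -[leLHS]mulr_natl.
  apply: le_trans (Ssum n0) _; apply: ler_sum => i _; exact: scalesum_le_lim.
have step : scalelim q r 1 / b * \sum_j w j `^ r <= scalelim q r 1 * b * \sum_i u i `^ r.
  rewrite !mulr_sumr; apply: le_trans (_ : \sum_j scalelim q r (w j) <= _).
    by apply: ler_sum => j _; have /andP[] := scalelim_power q1 r12 (w0 j).
  apply: le_trans limsum _.
  by apply: ler_sum => i _; have /andP[] := scalelim_power q1 r12 (u0 i).
have {}step : \sum_j w j `^ r <= x * \sum_i u i `^ r.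
  rewrite -(ler_pM2l (_ : 0 < scalelim q r 1 / b)); last by rewrite divr_gt0.
  apply: le_trans step _; rewrite -bb le_eqVlt; apply/orP; left; apply/eqP.
  by field; rewrite gt_eqF.
by apply: le_trans step _; rewrite /x mulrDl mul1r mulrC.
Qed.

(** For large [s] the logarithm is negligible against the linear term; the bound
    [ln (1 + c ^+ 2) <= 2 * c] makes this quantitative. *)
Lemma kappa_to_sum : \sum_j w j <= \sum_i u i.
Proof.
apply: (@ler_vanishing _ _ _ (\sum_j 2 * Num.sqrt (w j))) => N.
have N0 : 0 < N.+1%:R :> R by rewrite ltr0Sn.
pose M : R := N.+1%:R.
have s0 : 0 < M ^+ 2 by rewrite exprn_gt0.
have hw j : M ^+ 2 * w j - 2 * (M * Num.sqrt (w j)) <= kappa (M ^+ 2) (w j).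
  rewrite /kappa lerD2l lerN2.
  pose c := M * Num.sqrt (w j).
  have c0 : 0 <= c by rewrite mulr_ge0 ?sqrtr_ge0 // ltW.
  have -> : M ^+ 2 * w j = c ^+ 2 by rewrite exprMn sqr_sqrtr.
  have pc : 0 < 1 + c by lra.
  apply: le_trans (_ : ln ((1 + c) ^+ 2) <= _).
    rewrite ler_ln ?posrE ?exprn_gt0 ?ltr_wpDr ?sqr_ge0 //.
    have -> : (1 + c) ^+ 2 = 1 + c ^+ 2 + c *+ 2 by rewrite mulr2n; ring.
    by rewrite lerDl mulrn_wge0.
  rewrite lnXn // mulr_natl ler_pMn2r //.
  by apply: le_ln1Dx; lra.
have : \sum_j (M ^+ 2 * w j - 2 * (M * Num.sqrt (w j))) <= \sum_i M ^+ 2 * u i.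
  apply: le_trans (ler_sum _ (fun j _ => hw j)) _.
  apply: le_trans (kap s0) _; apply: ler_sum => i _.
  by apply: kappa_le_lin => //; exact: ltW.
rewrite sumrB -!mulr_sumr => h.
rewrite -(ler_pM2l s0) mulrDr.
have -> : M ^+ 2 * (2 * (\sum_j Num.sqrt (w j)) / M) = 2 * (M * \sum_j Num.sqrt (w j)).
  by field; rewrite /M addrC natr1 gt_eqF.
lra.
Qed.

Lemma kappa_to_power r : 1 <= r < 2 -> \sum_j w j `^ r <= \sum_i u i `^ r.
Proof.
case/andP; rewrite le_eqVlt => /orP[/eqP<-|r1] r2; last by rewrite kappa_to_power_strict // r1.
have -> : \sum_j w j `^ 1 = \sum_j w j by apply: eq_bigr => j _; rewrite powRr1.
have -> : \sum_i u i `^ 1 = \sum_i u i by apply: eq_bigr => i _; rewrite powRr1.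
exact: kappa_to_sum.
Qed.
End Families.

End KernelToPower.

(** * Trees and stars for exponents below four *)

Section Comparison.
Variable R : realType.
Implicit Types (s p : R) (T : finType).

Lemma kappa_to_power_seq (U W : seq R) r : 1 <= r < 2 ->
  all (fun y => 0 <= y) U -> all (fun y => 0 <= y) W ->
  (forall s, 0 < s -> \sum_(y <- W) kappa s y <= \sum_(y <- U) kappa s y) ->
  \sum_(y <- W) y `^ r <= \sum_(y <- U) y `^ r.
Proof.
move=> r12 U0 W0 h; rewrite (big_nth 0) [leRHS](big_nth 0) !big_mkord.
apply: kappa_to_power => // [i|j|s s0].
- by apply: (allP U0); rewrite mem_nth.
- by apply: (allP W0); rewrite mem_nth.
by have := h s s0; rewrite (big_nth 0) [leRHS](big_nth 0) !big_mkord.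
Qed.

(** Squared eigenvalues as a list, since those of several kernels have to be
    collected for [star_numeric]. *)
Definition sqspec T (a : T -> T -> R) : seq R := [seq x ^+ 2 | x <- eigenvalues (kernel_mx a)].

Lemma sqspec_ge0 T (a : T -> T -> R) : all (fun y => 0 <= y) (sqspec a).
Proof. by apply/allP => y /mapP[x _ ->]; exact: sqr_ge0. Qed.

Lemma sum_sqspec T (a : T -> T -> R) f : \sum_(y <- sqspec a) f y = energy (fun x => f (x ^+ 2)) a.
Proof. by rewrite big_map. Qed.

Lemma sqspec_power (T : finType) (a : T -> T -> R) (j : T -> R) p : 0 < p ->
  symmetric_kernel a -> (forall x, j x * j x = 1) ->
  (forall x y, j x * j y * a x y = - a x y) ->
  \sum_(y <- sqspec a) y `^ (p / 2) = 2 * energy (posp p) a.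
Proof.
move=> p0 sa j1 jN; rewrite sum_sqspec -(energy_square p sa j1 jN).
have [u [d eb]] := eigenbasis_exists sa.
rewrite (energyE _ (square_eigenbasis eb) (square_symmetric sa)) (energyE _ eb sa).
apply: eq_bigr => i _; have [->|d0] := eqVneq (d i ^+ 2) 0.
  by rewrite posp0 powR0 // gt_eqF // divr_gt0.
by rewrite pospE // lt_def d0 sqr_ge0.
Qed.

Lemma path_power m p : 0 < p ->
  \sum_(y <- sqspec (@adjk R (path_graph m))) y `^ (p / 2) = 2 * alpha p m.
Proof.
move=> p0; apply: (sqspec_power (j := fun i : path_graph m => (-1) ^+ i)) => //.
- exact: adjk_symmetric.
- by move=> x; rewrite -expr2 sqrr_sign.
- exact: path_sign.
Qed.

Lemma path_sqspec_kappa m s : 0 < s ->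
  \sum_(y <- sqspec (@adjk R (path_graph m))) kappa s y =
  2 * s * (m.-1)%:R - 2 * ln (pmatch s m).
Proof.
move=> s0; rewrite sum_sqspec.
have [u [d eb]] := eigenbasis_exists (@adjk_symmetric R (path_graph m)).
by rewrite (energyE _ eb (@adjk_symmetric _ _)) (path_kappa s0 eb).
Qed.

(** Twice the energy is a power sum of squared eigenvalues with exponent in [1,
    2), so [kappa_to_power] applies: [S] has at least the trace of a path, and
    [forest_det] bounds its determinant by that of a path. *)
Lemma tree_energy (T : finType) (S : T -> T -> R) (j : T -> R) (lev : T -> nat)
    (par : T -> T) (X : {set T}) p : 2 <= p < 4 ->
  symmetric_kernel S -> (forall x, j x * j x = 1) ->
  (forall x y, j x * j y * S x y = - S x y) -> (forall x y, S x y ^+ 2 <= 1) ->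
  (forall x y, x \in X -> y \in X -> (lev y <= lev x)%N -> S x y != 0 -> y = par x) ->
  2 * (#|X|.-1)%:R <= \sum_(x in X) \sum_(y in X) S x y ^+ 2 ->
  alpha p #|X| <= energy (posp p) (induced X S).
Proof.
move=> /andP[p2 p4] sS j1 jS S1 Spar trS.
have p0 : 0 < p by lra.
have jSX x y : j x * j y * induced X S x y = - induced X S x y.
  by rewrite /induced; case: ifP => _; rewrite ?jS // mulr0 oppr0.
have sSX : symmetric_kernel (induced X S) by exact: induced_symmetric.
rewrite -(ler_pM2l (ltr0Sn R 1)) -path_power // -(sqspec_power p0 sSX j1 jSX).
apply: kappa_to_power_seq.
- by rewrite ler_pdivlMr // ltr_pdivrMr //; apply/andP; split; lra.
- exact: sqspec_ge0.
- exact: sqspec_ge0.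
move=> s s0; rewrite path_sqspec_kappa // sum_sqspec.
have [u [d eb]] := eigenbasis_exists sSX.
rewrite (energyE _ eb sSX).
have t0 : 0 < Num.sqrt s by rewrite sqrtr_gt0.
have /andP[D0 D1] := forest_det t0 sS j1 jS S1 Spar (subxx X).
rewrite sqr_sqrtr ?(ltW s0) // in D1.
rewrite (kappa_bipartite s0 sS j1 jS eb D0).
have lnD : ln (kdet (idk (fun x y => j x * S x y) (Num.sqrt s) X)) <= ln (pmatch s #|X|).
  by rewrite ler_ln ?posrE ?pmatch_gt0 //.
have := ler_wpM2l (ltW s0) trS; rewrite mulrA [s * 2]mulrC.
by move: lnD; lra.
Qed.

Arguments pmatch : simpl never.

(** Matchings of a path that is cut at one edge: the edge is absent or present.
    *)
Lemma pmatch_add s a b : pmatch s (a.+1 + b.+1) =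
  pmatch s a.+1 * pmatch s b.+1 + s * pmatch s a * pmatch s b.
Proof.
suff : pmatch s (a.+1 + b.+1) =
  pmatch s a.+1 * pmatch s b.+1 + s * pmatch s a * pmatch s b /\
  pmatch s (a.+2 + b.+1) =
  pmatch s a.+2 * pmatch s b.+1 + s * pmatch s a.+1 * pmatch s b by case.
elim: a => [|a [IH1 IH2]].
  have d1 : pmatch s 1 = 1 by []. have d0 : pmatch s 0 = 1 by [].
  rewrite !addSn !add0n; split; first by rewrite pmatchSS d1 d0; ring.
  by rewrite [pmatch s b.+3]pmatchSS [pmatch s b.+2]pmatchSS [pmatch s 2]pmatchSS d1 d0; ring.
split=> //; rewrite [(a.+3 + b.+1)%N]addSn [(a.+2 + b.+1)%N]addSn pmatchSS.
rewrite -[((a.+1 + b.+1).+1)%N]/((a.+2 + b.+1)%N) IH2 IH1.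
by rewrite [pmatch s a.+3]pmatchSS [pmatch s a.+2]pmatchSS; ring.
Qed.

Lemma pmatch_ratio s a : 0 < s -> pmatch s a.+1 <= (1 + s) * pmatch s a.
Proof.
move=> s0; case: a => [|a]; first by rewrite mulr1 lerDl ltW.
by rewrite pmatchSS mulrDl mul1r lerD2l ler_pM2l // pmatch_mono.
Qed.

(** Induction on [d] from 3, either inserting a vertex of the star alone or
    together with one of the components; both steps use [pmatch_ratio] to bound
    the loss. *)
Lemma pmatch_star s (ms : seq nat) d : 0 < s -> (2 < d)%N -> (size ms < d)%N ->
  all (fun m => 0 < m)%N ms ->
  (1 + s * (size ms + d.-1)%:R) * \prod_(m <- ms) pmatch s m <= pmatch s (d + sumn ms).
Proof.
move=> s0; have gt0 n : 0 < pmatch s n by exact: pmatch_gt0.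
have ratio a : s / (1 + s) * pmatch s a.+1 <= s * pmatch s a.
  by rewrite mulrAC ler_pdivrMr ?addr_gt0 // -mulrA ler_pM2l // mulrC pmatch_ratio.
have sp : 0 < 1 + s by rewrite addr_gt0.
have v1 : pmatch s 1 = 1 by [].
have v2 : pmatch s 2 = 1 + s by rewrite pmatchSS v1 mulr1.
have v3 : pmatch s 3 = 1 + 2 * s by rewrite pmatchSS v2 v1; ring.
elim: d ms => // d IH ms; rewrite ltnS leq_eqVlt => /orP[/eqP<-|d2].
  case: ms => [|m1 [|m2 [|//]]] _ /=.
  - by move=> _; rewrite big_nil v3; lra.
  - move=> /andP[]; case: m1 => // m1 _ _; rewrite big_seq1 addn0.
    rewrite (pmatch_add s 2 m1) v3 v2.
    have h := pmatch_ratio m1 s0; have := ler_wpM2l (ltW s0) h.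
    move: (pmatch s m1) (pmatch s m1.+1) => x y; nra.
  - move=> /and3P[]; case: m1 => // m1 _; case: m2 => // m2 _ _.
    rewrite big_cons big_seq1 addn0 addnA.
    rewrite (pmatch_add s (2 + m1.+1)%N m2).
    have h1 := pmatch_ratio m1 s0; have h2 := pmatch_ratio m2 s0.
    have e1 : pmatch s (2 + m1.+1).+1 = (1 + 2 * s) * pmatch s m1.+1 + s * (1 + s) * pmatch s m1.
      by rewrite (pmatch_add s 2 m1) v3 v2; ring.
    have e2 : pmatch s (2 + m1.+1) = (1 + s) * pmatch s m1.+1 + s * pmatch s m1.
      by rewrite (pmatch_add s 1 m1) v2 v1; ring.
    rewrite e1 e2.
    have := gt0 m1; have := gt0 m2; have := gt0 m1.+1; have := gt0 m2.+1.
    move: (pmatch s m1) (pmatch s m1.+1) (pmatch s m2) (pmatch s m2.+1) h1 h2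
      => x1 y1 x2 y2 h1 h2 y20 y10 x20 x10.
    have k1 : s * y1 * y2 <= s * ((1 + s) * x1) * y2.
      by rewrite ler_pM2r // ler_pM2l.
    have k2 : s * y1 * y2 <= s * y1 * ((1 + s) * x2).
      by rewrite ler_pM2l // mulr_gt0.
    have k3 : 0 <= s * (s * x1) * x2 by rewrite !mulr_ge0 // ltW.
    have -> : (1 + s * (2 + 2)%:R) * (y1 * y2) = y1 * y2 + 4 * (s * y1 * y2) by ring.
    have -> : ((1 + 2 * s) * y1 + s * (1 + s) * x1) * y2 +
       s * ((1 + s) * y1 + s * x1) * x2 = y1 * y2 + 2 * (s * y1 * y2) +
       s * ((1 + s) * x1) * y2 + s * y1 * ((1 + s) * x2) + s * (s * x1) * x2 by ring.
    lra.
rewrite ltnS leq_eqVlt => /orP[/eqP sz|sz]; last first.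
  move=> msP; have := IH ms d2 sz msP.
  rewrite addSn; case Xn : (d + sumn ms)%N => [|n]; first by move: Xn; lia.
  rewrite pmatchSS; have h := ratio n; move=> h1.
  set P := \prod_(m <- ms) _; rewrite -/P in h1.
  have P0 : 0 <= P by apply: prodr_ge0 => m _; exact: ltW.
  set c : R := (size ms + d.-1)%:R in h1 *.
  have -> : (size ms + d.+1.-1)%:R = c + 1 by rewrite /c natr1; congr (_%:R); lia.
  have c1 : 1 <= c by rewrite ler1n; lia.
  have k1 := lerD h1 h.
  apply: le_trans (_ : pmatch s n.+1 + s / (1 + s) * pmatch s n.+1 <= _); last by lra.
  rewrite -[X in _ <= X + _]mul1r -[leRHS]mulrDl.
  have q0 : 0 <= 1 + s / (1 + s) by rewrite addr_ge0 // divr_ge0 // ltW.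
  apply: le_trans (ler_wpM2l q0 h1); rewrite mulrA ler_wpM2r //.
  rewrite -(ler_pM2r sp).
  have -> : (1 + s / (1 + s)) * (1 + s * c) * (1 + s) = (1 + s + s) * (1 + s * c).
    by field; rewrite gt_eqF.
  rewrite -subr_ge0.
  have -> : (1 + s + s) * (1 + s * c) - (1 + s * (c + 1)) * (1 + s) = s * s * (c - 1) by ring.
  by rewrite mulr_ge0 ?subr_ge0 // ltW // !mulr_gt0.
case: ms sz => [|m ms] /= sz; first by lia.
case/andP=> m0 msP; have szd : (size ms < d)%N by lia.
have := IH ms d2 szd msP; case: m m0 => // m _.
have -> : (d.+1 + (m.+1 + sumn ms) = (d + sumn ms).+1 + m.+1)%N by lia.
case Xn : (d + sumn ms)%N => [|n]; first by move: Xn; lia.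
rewrite pmatch_add pmatchSS big_cons => h1.
set P := \prod_(m <- ms) _; rewrite -/P in h1.
have P0 : 0 <= P by apply: prodr_ge0 => k _; exact: ltW.
set c : R := (size ms + d.-1)%:R in h1 *.
have -> : ((size ms).+1 + d)%:R = c + 2 by rewrite /c -natrD; congr (_%:R); lia.
have c1 : 1 <= c by rewrite ler1n; lia.
have q0 : 0 <= 1 + 2 * (s / (1 + s)) by rewrite addr_ge0 // mulr_ge0 // divr_ge0 // ltW.
apply: le_trans (_ : (1 + 2 * (s / (1 + s))) * pmatch s n.+1 * pmatch s m.+1 <= _); last first.
  have h2 := ler_wpM2r (ltW (gt0 m.+1)) (ratio n).
  have h3 := ler_wpM2l (ltW (gt0 n.+1)) (ratio m).
  move: h2 h3; move: (s / (1 + s)) (pmatch s n.+1) (pmatch s m.+1) (pmatch s n) (pmatch s m) => *; lra.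
apply: le_trans (ler_wpM2r (ltW (gt0 m.+1)) (ler_wpM2l q0 h1)).
rewrite [pmatch s m.+1 * P]mulrC [leLHS]mulrA (ler_wpM2r (ltW (gt0 m.+1))) // [leRHS]mulrA ler_wpM2r //.
rewrite -(ler_pM2r sp).
have -> : (1 + 2 * (s / (1 + s))) * (1 + s * c) * (1 + s) = (1 + s + 2 * s) * (1 + s * c).
  by field; rewrite gt_eqF.
rewrite -subr_ge0.
have -> : (1 + s + 2 * s) * (1 + s * c) - (1 + s * (c + 2)) * (1 + s) = 2 * (s * s) * (c - 1) by ring.
by rewrite mulr_ge0 ?subr_ge0 // ltW // !mulr_gt0.
Qed.

(** The complete graph contributes the eigenvalue [d.-1] alone, taken twice
    because energies of bipartite graphs count squared eigenvalues twice.  After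
    [kappa_to_power] the comparison is one between determinants, and
    [pmatch_star] supplies it up to the linear term [s * (N - N')], which the
    traces compensate. *)
Lemma star_numeric (ms : seq nat) d p : 2 <= p < 4 -> (2 < d)%N -> (size ms < d)%N ->
  all (fun m => 0 < m)%N ms ->
  alpha p (d + sumn ms) <= posp p d.-1%:R + \sum_(m <- ms) alpha p m.
Proof.
move=> /andP[p2 p4] d2 sz msP; have p0 : 0 < p by lra.
have D0 : 0 < d.-1%:R :> R by rewrite ltr0n; lia.
pose N : R := d.-1%:R ^+ 2.
have N0 : 0 < N by rewrite exprn_gt0.
pose U := N :: N :: flatten [seq sqspec (@adjk R (path_graph m)) | m <- ms].
have sumU (f : R -> R) : \sum_(y <- U) f y =
    2 * f N + \sum_(m <- ms) \sum_(y <- sqspec (@adjk R (path_graph m))) f y.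
  by rewrite !big_cons big_flatten big_map addrA; congr (_ + _); ring.
rewrite -(ler_pM2l (ltr0Sn R 1)) mulrDr -path_power // mulr_sumr.
have -> : 2 * posp p d.-1%:R + \sum_(m <- ms) 2 * alpha p m = \sum_(y <- U) y `^ (p / 2).
  rewrite sumU -(posp_sqr _ D0) (pospE _ N0); congr (_ + _).
  by apply: eq_bigr => m _; rewrite path_power.
apply: kappa_to_power_seq.
- by rewrite ler_pdivlMr // ltr_pdivrMr //; apply/andP; split; lra.
- rewrite /= ltW //=; apply/allP => y /flattenP[_ /mapP[m _ ->]].
  by move/(allP (sqspec_ge0 _)).
- exact: sqspec_ge0.
move=> s s0; rewrite path_sqspec_kappa // sumU.
have -> : \sum_(m <- ms) \sum_(y <- sqspec (@adjk R (path_graph m))) kappa s y =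
   2 * s * (sumn ms)%:R - 2 * s * (size ms)%:R - 2 * ln (\prod_(m <- ms) pmatch s m).
  elim: ms msP {sz U sumU} => [|m ms IH] /=; first by move=> _; rewrite !big_nil ln1; ring.
  case/andP=> m0 /IH {}IH; rewrite !big_cons IH path_sqspec_kappa //.
  rewrite lnM ?posrE ?pmatch_gt0 ?prodr_gt0 //; last by move=> k _; exact: pmatch_gt0.
  by case: m m0 => // m _; rewrite natrD -!natr1; ring.
have P0 : 0 < \prod_(m <- ms) pmatch s m by apply: prodr_gt0 => m _; exact: pmatch_gt0.
pose N' : R := (size ms + d.-1)%:R.
have N'0 : 0 <= N' by [].
have hD := pmatch_star s0 d2 sz msP; rewrite -/N' in hD.
have p1 : 0 < 1 + s * N' by rewrite ltr_pwDl // mulr_ge0 // ltW.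
have lnD : ln (1 + s * N') + ln (\prod_(m <- ms) pmatch s m) <= ln (pmatch s (d + sumn ms)).
  by rewrite -lnM ?posrE // ler_ln ?posrE ?mulr_gt0 ?pmatch_gt0.
have NN : N' <= N.
  rewrite /N /N' -natrX ler_nat; case: d d2 sz {hD lnD D0 N N0 U sumU N' N'0 p1} => // d /=; nia.
have pN : 0 < 1 + s * N by rewrite ltr_wpDr // mulr_ge0 // ltW.
have lnN : ln (1 + s * N) <= ln (1 + s * N') + s * (N - N').
  have := @ln_le_sub1 R ((1 + s * N) / (1 + s * N')).
  rewrite divr_gt0 // => /(_ isT); rewrite lnM ?posrE ?invr_gt0 // lnV ?posrE //.
  have : (1 + s * N) / (1 + s * N') - 1 <= s * (N - N').
    rewrite lerBlDr ler_pdivrMr // -subr_ge0.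
    have -> : (s * (N - N') + 1) * (1 + s * N') - (1 + s * N) = s * (N - N') * (s * N') by ring.
    by rewrite !mulr_ge0 ?subr_ge0 // ltW.
  lra.
have -> : (d + sumn ms).-1%:R = N' + (sumn ms)%:R - (size ms)%:R :> R.
  have -> : ((d + sumn ms).-1 = d.-1 + sumn ms)%N by rewrite -{1}(ltn_predK d2).
  by rewrite /N' !natrD; ring.
rewrite /kappa; lra.
Qed.

End Comparison.

(** * A trigonometric inequality *)

Section Trig.
Variable R : realType.
Implicit Types (x y l : R).

Lemma sin_mvt x y : x <= y -> exists2 c, x <= c <= y & sin y - sin x = cos c * (y - x).
Proof.
move=> xy; have [|c] := @MVT_segment R sin cos x y xy (fun y _ => is_derive_sin y).
  by apply/continuous_subspaceT => z; exact: continuous_sin.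
by rewrite in_itv /= => cxy e; exists c.
Qed.

Lemma cos_mvt x y : x <= y -> exists2 c, x <= c <= y & cos y - cos x = - sin c * (y - x).
Proof.
move=> xy; have [|c] := @MVT_segment R cos (fun z => - sin z) x y xy (fun y _ => is_derive_cos y).
  by apply/continuous_subspaceT => z; exact: continuous_cos.
by rewrite in_itv /= => cxy e; exists c.
Qed.

Lemma cos_decr x y : 0 <= x -> x <= y -> y <= pi -> cos y <= cos x.
Proof.
move=> x0 xy yp; have [c /andP[c1 c2]] := cos_mvt xy => e.
have : 0 <= sin c by rewrite sin_ge0_pi // (le_trans x0 c1) (le_trans c2).
move=> s0; rewrite -subr_le0 e mulNr oppr_le0 mulr_ge0 // subr_ge0 //.
Qed.

(** Concavity of the sine between 0 and pi. *)
Lemma sin_scale l x : 0 <= l <= 1 -> 0 <= x <= pi -> l * sin x <= sin (l * x).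
Proof.
move=> /andP[l0 l1] /andP[x0 xp].
have lx0 : 0 <= l * x by rewrite mulr_ge0.
have lxx : l * x <= x by rewrite ler_piMl.
have [c /andP[c1 c2] e1] := sin_mvt lx0; have [d /andP[d1 d2] e2] := sin_mvt lxx.
rewrite sin0 !subr0 in e1.
have cd : cos d <= cos c by apply: cos_decr => //; [exact: le_trans d1|exact: le_trans d2 xp].
have h : 0 <= l * x * (1 - l) by rewrite mulr_ge0 // subr_ge0.
have := ler_wpM2r h cd; apply: ler_rearrange.
have -> : sin x = sin (l * x) + cos d * (x - l * x) by rewrite -e2 addrC subrK.
by rewrite {1 2}e1; ring.
Qed.

(** By the mean value theorem [sin x] is [x] times the cosine at a smaller
    angle. *)
Lemma mul_cos_le_sin x : 0 <= x <= pi -> x * cos x <= sin x.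
Proof.
move=> /andP[x0 xp]; have [c /andP[c1 c2]] := sin_mvt x0; rewrite sin0 !subr0 => ->.
by rewrite mulrC ler_wpM2r // cos_decr.
Qed.

Lemma sin_piquarter : sin (pi / 4) = cos (pi / 4) :> R.
Proof.
by rewrite -cosN -sinDpihalf; congr (sin _); lra.
Qed.

(** Otherwise [tan (pi / 16)] is at least 1/5; doubling the angle twice, as in
    Machin's formula, the tangent of [pi / 8] is at least 5/12 and that of [pi /
    4] exceeds 1. *)
Lemma pi_le : pi <= 16 / 5 :> R.
Proof.
rewrite leNgt; apply/negP => big.
pose x : R := pi / 16; have x5 : 1 / 5 < x by rewrite /x; lra.
have xpi : 0 <= x <= pi by have := @pi_gt0 R; rewrite /x => h; apply/andP; split; lra.
have c0 : 0 < cos x by rewrite cos_gt0_pihalf //; have := @pi_gt0 R; rewrite /x => h; apply/andP; split; lra.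
have c20 : 0 < cos (x *+ 2).
  by rewrite cos_gt0_pihalf // [x *+ 2]mulr2n; have := @pi_gt0 R; rewrite /x => h; apply/andP; split; lra.
have sc : cos x / 5 <= sin x.
  apply: le_trans (mul_cos_le_sin xpi); rewrite [leLHS]mulrC ler_wpM2r ?(ltW c0) //; lra.
have s2 : sin x ^+ 2 = 1 - cos x ^+ 2 by rewrite sin2cos2.
have S2 : sin (x *+ 2) = 2 * (cos x * sin x) by rewrite sin_mulr2n mulr2n; ring.
have C2 : cos (x *+ 2) = cos x ^+ 2 - sin x ^+ 2 by rewrite cos_mulr2n s2 mulr2n; ring.
have h2 : 5 / 12 * cos (x *+ 2) <= sin (x *+ 2).
  by rewrite S2 C2; nra.
have x4 : x *+ 2 *+ 2 = pi / 4 by rewrite -mulrnA -[LHS]mulr_natr /x; field.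
have := sin_piquarter; rewrite -x4.
move: (x *+ 2) c20 h2 => y c20 h2; rewrite sin_mulr2n cos_mulr2n.
have := cos2Dsin2 y; move: (cos y) (sin y) c20 h2 => c s c20 h2 e1 e2.
have h3 : 5 / 12 * c * c <= s * c by rewrite ler_wpM2r // ltW.
have h4 : (5 / 12 * c) ^+ 2 <= s ^+ 2 by rewrite ler_pXn2r ?nnegrE //; lra.
have h5 : 0 < c * c by rewrite mulr_gt0.
rewrite !mulr2n !expr2 in e1 e2 h4; nra.
Qed.

Lemma cos_diff x y : cos x - cos y = 2 * sin ((x + y) / 2) * sin ((y - x) / 2).
Proof.
have -> : cos x = cos ((x + y) / 2 - (y - x) / 2) by congr (cos _); field.
have -> : cos y = cos ((x + y) / 2 + (y - x) / 2) by congr (cos _); field.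
by rewrite cosB cosD; ring.
Qed.

Lemma sin_diff x y : sin x - sin y = 2 * cos ((x + y) / 2) * sin ((x - y) / 2).
Proof.
have -> : sin x = sin ((x + y) / 2 + (x - y) / 2) by congr (sin _); field.
have -> : sin y = sin ((x + y) / 2 - (x - y) / 2) by congr (sin _); field.
by rewrite sinB sinD; ring.
Qed.

(** With [e = pi / m] and [h = pi / (m + 1)] one has [e = h + h / m], so the
    left side uses slightly smaller steps.  For [a = 4] a second order estimate
    suffices.  Otherwise, after expanding differences of cosines into products,
    the claim reduces to [tau * sin Th' <= sin (T - 3 * h)] with [tau = a / m]
    and [T = tau * pi]; for [tau <= 3 / 4] this follows from concavity, and for
    larger [tau] from [T] being closer to [pi] than to [0]. *)
Lemma cycle_path_pair (m a : R) : 4 <= a <= m -> a = 4 \/ 8 <= a ->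
  cos ((a - 2) * (pi / (m + 1))) + cos (a * (pi / (m + 1))) <=
  cos ((a - 4) * (pi / m)) + cos (a * (pi / m)).
Proof.
move=> /andP[a4 am] acase; have m0 : 0 < m by lra.
have m10 : 0 < m + 1 by lra.
have p0 := @pi_gt0 R.
pose e := pi / m; pose h := pi / (m + 1); rewrite -/e -/h.
have mh : (m + 1) * h = pi by rewrite /h mulrC divfK // gt_eqF.
have me : m * e = pi by rewrite /e mulrC divfK // gt_eqF.
have h0 : 0 < h by rewrite divr_gt0.
have e0 : 0 < e by rewrite divr_gt0.
have eh : e = h + h / m by rewrite /e /h; field; rewrite !gt_eqF.
have he : h <= e by rewrite eh lerDl divr_ge0 // ltW.
have hk k : 0 < k -> k <= m + 1 -> h <= pi / k.
  by move=> k0 km; rewrite /h ler_pM2l // lef_pV2 ?posrE.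
clearbody h e.
case: acase => [->|a8].
  have h4 : h <= pi / 4 by apply: hk; lra.
  have -> : (4 - 2) * h = h *+ 2 by rewrite -mulr_natl; ring.
  rewrite subrr mul0r cos0 cos_mulr2n -lerBrDr.
  have -> : 1 + cos (4 * e) - cos (4 * h) = 1 - 2 * sin (2 * (e + h)) * sin (2 * (h / m)).
    have := cos_diff (4 * h) (4 * e).
    have -> : (4 * h + 4 * e) / 2 = 2 * (e + h) by field.
    have -> : (4 * e - 4 * h) / 2 = 2 * (h / m) by rewrite eh; field; rewrite gt_eqF.
    by move=> k; lra.
  have s2 : sin h ^+ 2 = 1 - cos h ^+ 2 by rewrite sin2cos2.
  have hm0 : 0 <= 2 * (h / m) by rewrite mulr_ge0 // divr_ge0 // ltW.
  have n1 := norm_sin_le hm0; have n2 := sin_max (2 * (e + h)).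
  have prod : sin (2 * (e + h)) * sin (2 * (h / m)) <= 2 * (h / m).
    apply: le_trans (ler_norm _) _; rewrite normrM -[leRHS]mul1r.
    by apply: ler_pM.
  (* Here [1 - cos] of the doubled angle dominates the error caused by replacing
     [m] with [m + 1]. *)
  suff lower : 2 * (h / m) <= sin h ^+ 2 by rewrite mulr2n; lra.
  have sh : 4 / pi * h * sin (pi / 4) <= sin h.
    have hE : 4 / pi * h * (pi / 4) = h.
      by move: (pi : R) p0 {mh me hk h4 he eh h0} => P P0; field; rewrite gt_eqF.
    rewrite -[X in _ <= sin X]hE.
    apply: sin_scale; last by apply/andP; split; lra.
    apply/andP; split; first by rewrite mulr_ge0 ?divr_ge0 ?pi_ge0 // ltW.
    by rewrite [4 / pi * h]mulrAC ler_pdivrMr // mul1r mulrC -ler_pdivlMr.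
  have sq : sin (pi / 4) ^+ 2 = 1 / 2 :> R.
    have := cos2Dsin2 (pi / 4 : R); rewrite -sin_piquarter; lra.
  have sp : 0 <= sin (pi / 4) :> R by rewrite sin_ge0_pi //; apply/andP; split; lra.
  have l0 : 0 <= 4 / pi * h * sin (pi / 4) by rewrite !mulr_ge0 // ?invr_ge0 ltW.
  have : (4 / pi * h * sin (pi / 4)) ^+ 2 <= sin h ^+ 2.
    by rewrite ler_pXn2r ?nnegrE // (le_trans l0).
  apply: le_trans; rewrite exprMn sq.
  have -> : (4 / pi * h) ^+ 2 * (1 / 2) = h * (8 / (pi * (m + 1))).
    have : (m + 1) * h = pi by [].
    by move: (pi : R) p0 {mh me hk h4 he eh l0 sp sq sh} => P P0 <-; field; rewrite !gt_eqF.
  have -> : 2 * (h / m) = h * (2 / m) by ring.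
  rewrite ler_pM2l // ler_pdivrMr // mulrAC ler_pdivlMr ?mulr_gt0 //.
  have := pi_le => pl.
  have : pi * (m + 1) <= 16 / 5 * (m + 1) by rewrite ler_pM2r.
  lra.
pose tau := a / m; pose T := a * e.
have tau1 : tau <= 1 by rewrite /tau ler_pdivrMr // mul1r.
have tau0 : 0 < tau by rewrite divr_gt0 //; lra.
have tm : tau * m = a by rewrite /tau divfK // gt_eqF.
have Tpi : T = tau * pi by rewrite /T -me mulrA tm.
have Th : T = tau * (m + 1) * h by rewrite Tpi -mulrA mh.
have ah : a * h = T - tau * h by rewrite Th -{1}tm; ring.
have -> : (a - 2) * h = T - 2 * h - tau * h by rewrite mulrBl ah; ring.
rewrite ah -/T.
have T0 : 0 <= (a - 4) * e by rewrite mulr_ge0 // ?ltW //; lra.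
have Tle : T <= pi by rewrite Tpi ler_piMl // ltW.
have c4 : cos (T - 4 * h) <= cos ((a - 4) * e).
  apply: cos_decr => //; rewrite ?mulrBl -/T; first by rewrite lerD2l lerN2 ler_pM2l.
  by lra.
apply: le_trans (_ : cos (T - 4 * h) + cos T <= _); last by rewrite lerD2r.
pose Th' := T - h - tau * h / 2.
have k1 : cos (T - 4 * h) - cos (T - 2 * h) = 2 * (sin (T - 3 * h) * sin h).
  rewrite cos_diff -mulrA; congr (_ * (sin _ * sin _)); by field.
have k2 : cos (T - 2 * h - tau * h) + cos (T - tau * h) - cos T - cos (T - 2 * h) =
    4 * (sin (tau * h / 2) * cos h * sin Th').
  have -> : cos (T - 2 * h - tau * h) + cos (T - tau * h) - cos T - cos (T - 2 * h) =
    (cos (T - tau * h) - cos T) + (cos (T - 2 * h - tau * h) - cos (T - 2 * h)) by ring.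
  rewrite !cos_diff.
  have -> : (T - (T - tau * h)) / 2 = tau * h / 2 by field.
  have -> : (T - 2 * h - (T - 2 * h - tau * h)) / 2 = tau * h / 2 by field.
  have -> : (T - tau * h + T) / 2 = Th' + h by rewrite /Th'; field.
  have -> : (T - 2 * h - tau * h + (T - 2 * h)) / 2 = Th' - h by rewrite /Th'; field.
  by rewrite sinB sinD; ring.
have h9 : h <= pi / 9 by apply: hk; lra.
have hpi : 0 <= h <= pi by apply/andP; split; lra.
have th0 : 0 < tau * h by rewrite mulr_gt0.
have thh : tau * h <= h by rewrite ler_piMl // ltW.
have tm8 : 8 <= tau * m by rewrite tm.
have T8 : 8 * h <= T by rewrite Th ler_pM2r // mulrDr mulr1; lra.
have Thpi : 0 <= Th' <= pi by rewrite /Th'; apply/andP; split; lra.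
have sT : 0 <= sin Th' by rewrite sin_ge0_pi.
have main : tau * sin Th' <= sin (T - 3 * h).
  have [t34|t34] := leP tau (3 / 4).
    pose l := (T - 3 * h) / Th'.
    have Tp : 0 < Th' by rewrite /Th'; lra.
    have lE : T - 3 * h = l * Th' by rewrite /l divfK // gt_eqF.
    have l1 : l <= 1 by rewrite /l ler_pdivrMr // mul1r /Th'; lra.
    have lt : tau <= l.
      rewrite /l ler_pdivlMr // /Th' -subr_ge0.
      have -> : T - 3 * h - tau * (T - h - tau * h / 2) =
         h * ((tau * m + tau) * (1 - tau) - 3 + tau + tau ^+ 2 / 2) by rewrite Th; field.
      apply: mulr_ge0; first exact: ltW.
      have : (8 + tau) * (1 - tau) <= (tau * m + tau) * (1 - tau).
        by apply: ler_wpM2r; lra.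
      have : 0 <= (3 / 4 - tau) * tau by apply: mulr_ge0; lra.
      rewrite expr2; lra.
    rewrite lE; apply: le_trans (sin_scale _ Thpi); last by apply/andP; split; lra.
    by rewrite ler_wpM2r.
  apply: le_trans (_ : sin Th' <= _); first by rewrite ler_piMl.
  rewrite -subr_ge0.
  rewrite sin_diff.
  have m8 : 8 <= m by lra.
  have big : 4 + tau / 2 <= (2 * tau - 1) * (m + 1).
    have : (1 / 2) * (m + 1) <= (2 * tau - 1) * (m + 1) by apply: ler_wpM2r; lra.
    lra.
  have big' := ler_wpM2r (ltW h0) big.
  have s1 : pi / 2 <= (T - 3 * h + Th') / 2.
    rewrite /Th'; have : pi <= T - 3 * h + (T - h - tau * h / 2); last by lra.
    rewrite -{1}mh Th; lra.
  have cN : cos ((T - 3 * h + Th') / 2) <= 0.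
    by rewrite -(cos_pihalf R); apply: cos_decr; rewrite ?divr_ge0 ?pi_ge0 // /Th'; lra.
  have sN : sin ((T - 3 * h - Th') / 2) <= 0.
    rewrite -oppr_ge0 -sinN sin_ge0_pi // /Th'; apply/andP; split; lra.
  by rewrite -mulrA mulr_ge0 // mulr_le0.
have hc : h * cos h <= sin h by exact: mul_cos_le_sin.
have ch : 0 <= cos h by rewrite cos_ge0_pihalf //; apply/andP; split; lra.
have sth : sin (tau * h / 2) <= tau * h / 2.
  by apply: le_trans (ler_norm _) (norm_sin_le _); rewrite divr_ge0 // ltW.
have fin1 : 2 * (sin (tau * h / 2) * cos h) <= tau * sin h.
  have h1 := ler_wpM2r ch sth; have h2 := ler_wpM2l (ltW tau0) hc; lra.
have sh0 : 0 <= sin h by rewrite sin_ge0_pi.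
have fin2 := ler_wpM2r sT fin1; have fin3 := ler_wpM2r sh0 main.
lra.
Qed.

End Trig.

(** * Spectra of paths and cycles *)

Section Cycle.
Variable R : realType.
Implicit Types (p : R).

Lemma eigen_orthogonal (T : finType) (a : T -> T -> R) v w l k : symmetric_kernel a ->
  (forall x, \sum_y a x y * v y = l * v x) -> (forall x, \sum_y a x y * w y = k * w x) ->
  l != k -> \sum_x v x * w x = 0.
Proof.
move=> sa av aw lk; have : l * \sum_x v x * w x = k * \sum_x v x * w x.
  rewrite !mulr_sumr; transitivity (\sum_x \sum_y a x y * v y * w x).
    by apply: eq_bigr => x _; rewrite mulrA -av mulr_suml.
  rewrite exchange_big; apply: eq_bigr => y _ /=.
  rewrite mulrCA -aw mulr_sumr; apply: eq_bigr => x _; rewrite sa; ring.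
by move/eqP; rewrite -subr_eq0 -mulrBl mulf_eq0 subr_eq0 (negPf lk) => /eqP.
Qed.

(** As many orthogonal eigenvectors as points form, after normalisation, an
    eigenbasis. *)
Lemma energy_eigenbasis_orthogonal (T : finType) (a : T -> T -> R) (v : T -> T -> R) l f :
  symmetric_kernel a -> (forall i j, i != j -> \sum_x v i x * v j x = 0) ->
  (forall i, 0 < \sum_x v i x ^+ 2) ->
  (forall i x, \sum_y a x y * v i y = l i * v i x) ->
  energy f a = \sum_i f (l i).
Proof.
move=> sa ov vp av; pose n i := Num.sqrt (\sum_x v i x ^+ 2).
have n0 i : n i != 0 by rewrite gt_eqF // sqrtr_gt0.
have nn i : n i * n i = \sum_x v i x ^+ 2 by rewrite -expr2 sqr_sqrtr // ltW.
apply: (@energyE _ _ f a (fun i x => v i x / n i)) => //; split.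
  move=> i j; transitivity ((\sum_x v i x * v j x) / (n i * n j)).
    by rewrite mulr_suml; apply: eq_bigr => x _; rewrite invfM; ring.
  have [<-|ij] := eqVneq i j; last by rewrite ov ?mul0r.
  by rewrite nn; under eq_bigr do rewrite -expr2; rewrite divff // gt_eqF.
move=> i x; under eq_bigr do rewrite mulrA.
by rewrite -mulr_suml av mulrA.
Qed.

Lemma path_apply m (W : nat -> R) (i : path_graph m) : W 0%N = 0 -> W m.+1 = 0 ->
  \sum_(j : path_graph m) @adjk R (path_graph m) i j * W (j : 'I_m).+1 =
  W (i : 'I_m) + W (i : 'I_m).+2.
Proof.
move=> W0 Wm.
transitivity (\sum_(j < m) (j.+1 == i :> nat)%:R * W j.+1 +
              \sum_(j < m) (i.+1 == j :> nat)%:R * W j.+1).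
  rewrite -big_split; apply: eq_bigr => j _ /=; rewrite -mulrDl; congr (_ * _).
  rewrite /adjk /= /path_adj; have [/eqP h|_] /= := boolP (i.+1 == j :> nat).
    by have -> : (j.+1 == i :> nat) = false; [apply/eqP; lia|rewrite add0r].
  by rewrite addr0.
congr (_ + _).
  case: i => -[|k] km /=.
    by rewrite W0 big1 // => j _; rewrite mul0r.
  have kl : (k < m)%N by exact: ltnW.
  rewrite (bigD1 (Ordinal kl)) //= eqxx mul1r big1 ?addr0 // => j.
  by rewrite -val_eqE /= eqSS => /negPf->; rewrite mul0r.
have [im|im] := ltnP i.+1 m.
  rewrite (bigD1 (Ordinal im)) //= eqxx mul1r big1 ?addr0 // => j.
  by rewrite -val_eqE /= eq_sym => /negPf->; rewrite mul0r.
have -> : (i.+2 = m.+1)%N by have := ltn_ord (i : 'I_m); lia.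
rewrite Wm big1 // => j _; have -> : (i.+1 == j :> nat) = false; last by rewrite mul0r.
by apply/eqP; have := ltn_ord (j : 'I_m); lia.
Qed.

Definition pathev m (l : nat) : R := 2 * cos (l%:R * (pi / (m%:R + 1))).

(** The vectors [sin (k l pi / (m + 1))] vanish at both virtual end points [0]
    and [m + 1]. *)
Lemma path_spectrum m f :
  energy f (@adjk R (path_graph m)) = \sum_(l < m) f (pathev m l.+1).
Proof.
pose t : R := pi / (m%:R + 1).
have m0 : 0 < m%:R + 1 :> R by rewrite ltr_wpDl.
have mt : (m%:R + 1) * t = pi by rewrite /t mulrC divfK // gt_eqF.
have p0 : 0 < pi :> R by exact: pi_gt0.
have t0 : 0 < t by rewrite divr_gt0.
have lt_pi (l : 'I_m) : 0 < l.+1%:R * t < pi.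
  rewrite mulr_gt0 ?ltr0Sn //= -mt ltr_pM2r // natr1 ltr_nat ltnS; exact: ltn_ord.
pose v (l i : path_graph m) : R := sin (((i : 'I_m).+1)%:R * ((l : 'I_m).+1%:R * t)).
have av (l i : path_graph m) : \sum_j @adjk R (path_graph m) i j * v l j = pathev m l.+1 * v l i.
  rewrite (@path_apply m (fun k => sin (k%:R * ((l : 'I_m).+1%:R * t)))) ?mul0r ?sin0 //.
    rewrite /v /pathev -/t; set y := _ * t; rewrite -natr1.
    have -> : (i : 'I_m)%:R * y = ((i : 'I_m).+1)%:R * y - y by rewrite -natr1; ring.
    have -> : (((i : 'I_m).+1)%:R + 1) * y = ((i : 'I_m).+1)%:R * y + y by ring.
    by rewrite sinB sinD; ring.
  have -> : m.+1%:R * ((l : 'I_m).+1%:R * t) = 0 + pi *+ (l : 'I_m).+1.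
    have M1 : m.+1%:R * t = pi by rewrite -natr1.
    by rewrite mulrCA M1 add0r mulr_natl.
  by rewrite (alternatingn (@sinDpi R)) sin0 mulr0.
apply: (@energy_eigenbasis_orthogonal _ _ v) => //.
- exact: adjk_symmetric.
- move=> i j ij; apply: (eigen_orthogonal (@adjk_symmetric R _) (av i) (av j)).
  rewrite /pathev -/t; apply: contraNneq ij => /(mulfI _) h.
  have /h {}h : 2 != 0 :> R by rewrite pnatr_eq0.
  have /andP[i1 i2] := lt_pi i; have /andP[j1 j2] := lt_pi j.
  have := cos_inj _ _ h; rewrite !in_itv /= !ltW // => /(_ isT isT) /(mulIf _).
  by rewrite gt_eqF // => /(_ isT) /eqP; rewrite eqr_nat eqSS => /eqP/val_inj->.
- move=> l; have m1 : (0 < m)%N by exact: leq_ltn_trans (ltn_ord (l : 'I_m)).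
  rewrite (bigD1 (Ordinal m1 : path_graph m)) //= ltr_pwDl //.
    by rewrite exprn_gt0 // /v /= mul1r sin_gt0_pi.
  by apply: sumr_ge0 => x _; exact: sqr_ge0.
Qed.

(** The adjacency kernel of the cycle on [m] vertices, for [m > 2]. *)
Definition cyck m (i j : 'I_m) : R := ((i.+1 %% m == j)%N || (j.+1 %% m == i)%N)%:R.

Lemma cyck_symmetric m : symmetric_kernel (@cyck m).
Proof. by move=> i j; rewrite /cyck orbC. Qed.

Lemma cycle_apply m (W : nat -> R) (i : 'I_m) : (2 < m)%N -> (forall k, W (k + m)%N = W k) ->
  \sum_j @cyck m i j * W j = W i.+1 + W (i + m.-1)%N.
Proof.
move=> m2 per; have m0 : (0 < m)%N by lia.
have Wmod k : W (k %% m)%N = W k.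
  rewrite {2}(divn_eq k m) addnC; elim: (k %/ m)%N => [|q IH]; first by rewrite mul0n addn0.
  by rewrite mulSn addnCA addnC per.
pose j1 : 'I_m := Ordinal (ltn_pmod i.+1 m0); pose j2 : 'I_m := Ordinal (ltn_pmod (i + m.-1) m0).
have im := ltn_ord i.
have j2P (j : 'I_m) : (j.+1 %% m == i)%N = (j == j2).
  rewrite -val_eqE /=; have jm := ltn_ord j; apply/eqP/eqP => h.
    rewrite -h; have [e|ne] := eqVneq j.+1 m.
      by rewrite e modnn add0n modn_small; lia.
    have jm' : (j.+1 < m)%N by lia.
    by rewrite (modn_small jm') -[(_ + _)%N]/((j.+1 + m.-1)%N)
      (_ : (j.+1 + m.-1 = j + m)%N) ?modnDr ?modn_small //; lia.
  rewrite h -addn1 modnDml (_ : (i + m.-1 + 1 = i + m)%N) ?modnDr ?modn_small //; lia.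
have j12 : j1 != j2.
  rewrite -val_eqE /=; apply/eqP => h.
  have h1 : ((i.+1 %% m).+1 %% m = i)%N by have := j2P j2; rewrite eqxx /= -h => /eqP.
  have [e|ne] := eqVneq i.+1 m; first by move: h1; rewrite e modnn modn_small; lia.
  have lm : (i.+1 < m)%N by lia.
  move: h1; rewrite (modn_small lm); have [e|ne'] := eqVneq i.+2 m.
    by rewrite e modnn; lia.
  by rewrite modn_small; lia.
have cE j : @cyck m i j = (j == j1)%:R + (j == j2)%:R.
  rewrite /cyck j2P -[(i.+1 %% m)%N]/(nat_of_ord j1) eq_sym val_eqE.
  have [->|_] /= := eqVneq j j1; last by rewrite add0r.
  by rewrite (negPf j12) addr0.
under eq_bigr do rewrite cE mulrDl ![_%:R * _]mulrC.
by rewrite big_split /= !sum_delta /= !Wmod.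
Qed.

(** Weak majorisation of a pair: the larger entry grows and the sum does not
    decrease. *)
Lemma convex_pair_le (F G : R -> R) u1 u2 v1 v2 : tangent F G -> (forall x, 0 <= G x) ->
  v1 <= u1 -> v2 <= v1 -> v1 + v2 <= u1 + u2 -> F v1 + F v2 <= F u1 + F u2.
Proof.
move=> tF G0 h1 h2 h3; have t1 := tF v1 u1; have t2 := tF v2 u2.
have Gm : G v2 <= G v1 by exact: tangent_mono tF _ _ h2.
have d0 : 0 <= u1 - v1 by rewrite subr_ge0.
have k1 := ler_wpM2r d0 Gm.
have k2 : 0 <= G v2 * ((u1 - v1) + (u2 - v2)) by apply: mulr_ge0 => //; lra.
rewrite mulrDr in k2; lra.
Qed.

Definition cycev m (j : nat) : R := 2 * cos (j%:R * (2 * pi / m%:R)).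

(** The constant vector, and one cosine and one sine for each positive frequency
    whose eigenvalue is nonnegative, are orthogonal eigenvectors; [None] indexes
    the constant one. *)
Lemma cycle_spectrum_lower m p : (2 < m)%N ->
  posp p 2 + \sum_(j < m %/ 4) 2 * posp p (cycev m j.+1) <= energy (posp p) (@cyck m).
Proof.
move=> m2; pose x : R := 2 * pi / m%:R.
have m0 : 0 < m%:R :> R by rewrite ltr0n; lia.
have mx : m%:R * x = pi *+ 2 by rewrite /x mulrC divfK ?gt_eqF // mulr_natl.
have p0 : 0 < pi :> R by exact: pi_gt0.
have x0 : 0 < x by rewrite divr_gt0 // mulr_gt0.
pose W (i : option ('I_(m %/ 4) * bool)) (k : nat) : R :=
  if i is Some (j, b) then (if b then sin (k%:R * (j.+1%:R * x)) else cos (k%:R * (j.+1%:R * x)))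
  else 1.
pose l (i : option ('I_(m %/ 4) * bool)) : R := if i is Some (j, b) then cycev m j.+1 else 2.
have jb (j : 'I_(m %/ 4)) : 0 < j.+1%:R * x <= pi / 2.
  rewrite mulr_gt0 ?ltr0Sn //=.
  have h : (j.+1 * 4 <= m)%N by have := ltn_ord j; have := leq_trunc_div m 4; lia.
  have : (j.+1 * 4)%N%:R * x <= pi *+ 2 by rewrite -mx ler_wpM2r ?ler_nat // ltW.
  by rewrite natrM mulr2n; move: (_%:R) => t; rewrite -!mulrA [4 * x]mulrC mulrA; lra.
have per i k : W i (k + m)%N = W i k.
  case: i => [[j b]|] //=; rewrite natrD mulrDl.
  have -> : m%:R * (j.+1%:R * x) = pi *+ 2 *+ j.+1 by rewrite mulrCA mx mulr_natl.
  by case: b; rewrite ?(periodicn (@sinD2pi R)) ?(periodicn (@cosD2pi R)).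
have cE (i : 'I_m) (y : R) j : y = j.+1%:R * x ->
    (i + m.-1)%:R * y = i%:R * y - y + pi *+ 2 *+ j.+1.
  move=> ->; have -> : pi *+ 2 *+ j.+1 = m%:R * (j.+1%:R * x) by rewrite mulrCA mx mulr_natl.
  have -> : m%:R = m.-1%:R + 1 :> R by rewrite natr1 prednK //; lia.
  by rewrite natrD; ring.
have av i (k : 'I_m) : \sum_y @cyck m k y * W i y = l i * W i k.
  rewrite cycle_apply //; case: i => [[j b]|] /=; last by rewrite mulr1.
  rewrite /cycev -/x; set y := j.+1%:R * x; rewrite (cE k y j) // -natr1 mulrDl mul1r.
  by case: b; rewrite ?(periodicn (@sinD2pi R)) ?(periodicn (@cosD2pi R)) ?sinB ?sinD ?cosB ?cosD; ring.
have sumsin (y : R) j : y = j.+1%:R * x -> \sum_(k < m) sin (k%:R * (y *+ 2)) = 0.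
  move=> yE; have my : m%:R * (y *+ 2) = pi *+ 2 *+ (j.+1 * 2).
    by rewrite yE mulrnAr mulrCA mx mulr_natl mulrnA.
  rewrite -(big_mkord xpredT (fun k => sin (k%:R * (y *+ 2)))).
  have mp : (0 < m)%N by lia.
  rewrite -{1}(prednK mp) big_nat_recl // mul0r sin0 add0r.
  set S := \sum_(0 <= i < _) _.
  (* Reversing the order of summation changes the sign of every term. *)
  suff : S = - S by move=> h; lra.
  rewrite {1}/S big_nat_rev -sumrN; apply: eq_big_nat => k /andP[_ km] /=.
  have -> : (0 + m.-1 - k.+1).+1%:R = m%:R - k.+1%:R :> R.
    by rewrite -natrB; [congr (_%:R); lia|lia].
  rewrite mulrBl my addrC (periodicn (@sinD2pi R)) sinN //.
have ev_inj (i j : 'I_(m %/ 4)) : i != j -> cycev m i.+1 != cycev m j.+1.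
  apply: contraNneq; rewrite /cycev -/x => /(mulfI _) h.
  have /h {}h : 2 != 0 :> R by rewrite pnatr_eq0.
  have /andP[i1 i2] := jb i; have /andP[j1 j2] := jb j.
  have le_pi z : z <= pi / 2 -> z <= pi :> R by move=> hz; lra.
  have := cos_inj _ _ h; rewrite !in_itv /= !(ltW i1, ltW j1, le_pi _ i2, le_pi _ j2).
  move=> /(_ isT isT) /(mulIf _); rewrite gt_eqF // => /(_ isT) /eqP.
  by rewrite eqr_nat eqSS => /eqP/val_inj->.
have ev_lt2 (j : 'I_(m %/ 4)) : cycev m j.+1 != 2.
  rewrite /cycev -/x; have /andP[j1 j2] := jb j.
  apply/negP => /eqP h; have {}h : cos (j.+1%:R * x) = cos 0 by rewrite cos0; lra.
  have := cos_inj _ _ h; rewrite !in_itv /= lexx (ltW p0) (ltW j1) /=.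
  have -> : j.+1%:R * x <= pi by lra.
  by move=> /(_ isT isT) e; rewrite e ltxx in j1.
have key := @energy_ge_orthogonal R _ _ (@cyck m) (fun i k => W i k) l (posp p)
  (@cyck_symmetric m) (@posp_ge0 R p) _ _ av.
have <- : \sum_i posp p (l i) = posp p 2 + \sum_(j < m %/ 4) 2 * posp p (cycev m j.+1).
  rewrite sum_option; congr (_ + _).
  transitivity (\sum_(jb : 'I_(m %/ 4) * bool) posp p (cycev m jb.1.+1)).
    by apply: eq_bigr => -[j b] _.
  rewrite -(pair_bigA _ (fun (j : 'I_(m %/ 4)) (b : bool) => posp p (cycev m j.+1))) /=.
  apply: eq_bigr => j _.
  by rewrite big_bool /= mulrDl mul1r.
apply: key.
- move=> [[i b]|] [[j c]|] //= ne.
  + have [ij|ij] := eqVneq i j; last first.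
      exact: (eigen_orthogonal (@cyck_symmetric m) (av (Some (i, b))) (av (Some (j, c)))) (ev_inj _ _ ij).
    subst j; pose y := i.+1%:R * x.
    have := @sumsin y i erefl.
    have -> : \sum_(k < m) sin (k%:R * (y *+ 2)) = 2 * \sum_(k < m) sin (k%:R * y) * cos (k%:R * y).
      rewrite mulr_sumr; apply: eq_bigr => k _; rewrite mulrnAr sin_mulr2n mulr2n; ring.
    move=> /eqP; rewrite mulf_eq0 pnatr_eq0 /= => /eqP s0.
    case: b c ne => [] [] //= ne; rewrite ?eqxx // in ne *.
    by rewrite -[RHS]s0; apply: eq_bigr => k _; rewrite mulrC.
  + exact: (eigen_orthogonal (@cyck_symmetric m) (av (Some (i, b))) (av None)) (ev_lt2 _).
  + apply: (eigen_orthogonal (@cyck_symmetric m) (av None) (av (Some (j, c)))).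
    by rewrite eq_sym; exact: ev_lt2.
have m1 : (1 < m)%N by lia.
have m0' : (0 < m)%N by lia.
move=> [[j b]|] /=; last first.
  by rewrite (bigD1 (Ordinal m0')) //= expr1n ltr_pwDl // sumr_ge0 // => k _; rewrite sqr_ge0.
case: b.
  rewrite (bigD1 (Ordinal m1)) //= mul1r ltr_pwDl //; last first.
    by rewrite sumr_ge0 // => k _; rewrite sqr_ge0.
  by have /andP[j1 j2] := jb j; rewrite exprn_gt0 // sin_gt0_pi // j1 /=; lra.
rewrite (bigD1 (Ordinal m0')) //= mul0r cos0 expr1n ltr_pwDl // sumr_ge0 // => k _.
by rewrite sqr_ge0.
Qed.

(** The nonnegative eigenvalues of the path are grouped into consecutive pairs,
    and each pair is compared with two consecutive eigenvalues of the cycle.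
    Squaring doubles the angles and leaves the convex function [posp (p / 2)],
    so that [convex_pair_le] and [cycle_path_pair] apply. *)
Lemma cycle_energy m p : 2 <= p -> (2 < m)%N -> alpha p m <= energy (posp p) (@cyck m).
Proof.
move=> p2 m2; apply: le_trans (cycle_spectrum_lower p m2).
rewrite /alpha path_spectrum.
have p0 : 0 <= p by lra.
have m0 : 0 < m%:R :> R by rewrite ltr0n; lia.
have m10 : 0 < m%:R + 1 :> R by rewrite ltr_wpDl.
have pi0 : 0 < pi :> R by exact: pi_gt0.
pose J := (m %/ 4)%N.
have J4 : (4 * J <= m < 4 * J + 4)%N.
  by have := divn_eq m 4; have := ltn_pmod m (isT : (0 < 4)%N); rewrite -/J; lia.
pose F := posp (p / 2).
have tF : tangent F (dposp (p / 2)).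
  by apply: posp_tangent; rewrite ler_pdivlMr ?mul1r // ltr0n.
have G0 z : 0 <= dposp (p / 2) z by apply: dposp_ge0; lra.
have sqF z : 0 <= z -> posp p z = F (z ^+ 2).
  rewrite le_eqVlt => /orP[/eqP<-|z0]; first by rewrite expr0n posp0 /F posp0.
  by rewrite /F posp_sqr.
have dbl (z : R) : (2 * cos z) ^+ 2 = 2 + 2 * cos (2 * z).
  have -> : 2 * z = z *+ 2 by rewrite mulr_natl.
  by rewrite cos_mulr2n -[_ *+ 2]mulr_natl; ring.
(* Path eigenvalues beyond the first [2 * J + 1] are nonpositive, where [J] is a
   quarter of [m] rounded down. *)
have pathneg l : (2 * J + 2 <= l)%N -> (l <= m)%N -> posp p (pathev m l) = 0.
  move=> lJ lm; rewrite posp_neg // /pathev.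
  suff : cos (l%:R * (pi / (m%:R + 1))) <= 0 :> R by lra.
  rewrite -(cos_pihalf R); apply: cos_decr; first by rewrite divr_ge0 ?pi_ge0.
    rewrite mulrA ler_pdivlMr // mulrAC ler_pdivrMr //.
    have : (m%:R + 1 <= l%:R * 2 :> R) by rewrite natr1 -natrM ler_nat; lia.
    by move/(ler_wpM2l (ltW pi0)); lra.
  rewrite mulrA ler_pdivrMr // mulrC ler_wpM2l ?(ltW pi0) // natr1 ler_nat; lia.
have pathpos l : (l <= 2 * J)%N -> 0 <= pathev m l.
  move=> lJ; rewrite /pathev mulr_ge0 // cos_ge0_pihalf //; apply/andP; split.
    apply: le_trans (_ : 0 <= _); first by rewrite oppr_le0 divr_ge0 ?pi_ge0.
    by rewrite mulr_ge0 // divr_ge0 ?pi_ge0 // ltW.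
  rewrite mulrA ler_pdivlMr // mulrAC ler_pdivrMr //.
  have : (l%:R * 2 <= m%:R + 1 :> R) by rewrite natr1 -natrM ler_nat; lia.
  by move/(ler_wpM2l (ltW pi0)); lra.
have cycpos j : (j <= J)%N -> 0 <= cycev m j.
  move=> jJ; rewrite /cycev mulr_ge0 // cos_ge0_pihalf //; apply/andP; split.
    apply: le_trans (_ : 0 <= _); first by rewrite oppr_le0 divr_ge0 ?pi_ge0.
    by rewrite mulr_ge0 // divr_ge0 ?mulr_ge0 ?pi_ge0 // ltW.
  rewrite mulrA ler_pdivlMr // mulrAC ler_pdivrMr //.
  have : (j%:R * 4 <= m%:R :> R) by rewrite -natrM ler_nat; lia.
  by move/(ler_wpM2l (ltW pi0)); lra.
have path_le_cyc l j : (2 * j < l)%N -> (l <= m)%N -> pathev m l <= cycev m j.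
  move=> jl lm; rewrite /pathev /cycev ler_pM2l //; apply: cos_decr.
  - by rewrite mulr_ge0 // divr_ge0 ?mulr_ge0 ?pi_ge0 // ltW.
  - rewrite mulrA [leRHS]mulrA ler_pdivrMr // mulrAC ler_pdivlMr //.
    have : (j%:R * 2 * (m%:R + 1) <= l%:R * m%:R :> R).
      by rewrite natr1 -!natrM ler_nat; nia.
    by move/(ler_wpM2l (ltW pi0)); lra.
  - rewrite mulrA ler_pdivrMr // mulrC ler_wpM2l ?(ltW pi0) // natr1 ler_nat; lia.
have pair n : (n < J)%N ->
  posp p (pathev m (2 * n).+1) + posp p (pathev m (2 * n).+2) <=
  posp p (cycev m n) + posp p (cycev m n.+1).
  move=> nJ; rewrite !sqF ?pathpos ?cycpos //; [|by lia..].
  apply: (convex_pair_le tF) => //.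
  - rewrite ler_pXn2r ?nnegrE ?pathpos ?cycpos //; [|by lia..]; apply: path_le_cyc; lia.
  - rewrite ler_pXn2r ?nnegrE ?pathpos //; [|by lia..].
    rewrite /pathev ler_pM2l //; apply: cos_decr.
    + by rewrite mulr_ge0 // divr_ge0 ?pi_ge0 // ltW.
    + by rewrite ler_wpM2r ?ler_nat // divr_ge0 ?pi_ge0 // ltW.
    + rewrite mulrA ler_pdivrMr // mulrC ler_wpM2l ?(ltW pi0) // natr1 ler_nat; lia.
  rewrite /pathev /cycev !dbl.
  have n4 : (4 * n.+1 <= m)%N by move: J4 nJ => /andP[]; lia.
  have h4 : ((4 : R) <= (4 * n.+1)%N%:R) && ((4 * n.+1)%N%:R <= m%:R :> R).
    by rewrite !ler_nat n4 andbT; lia.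
  have hc : ((4 * n.+1)%N%:R = 4 :> R) \/ (8 <= (4 * n.+1)%N%:R :> R).
    by case: (n) => [|k]; [left; rewrite muln1|right; rewrite ler_nat; lia].
  have := cycle_path_pair h4 hc.
  have e1 : (4 * n.+1)%N%:R - 2 = 2 * (2 * n)%N.+1%:R :> R.
    have -> : (4 * n.+1 = 2 * (2 * n).+1 + 2)%N by lia.
    by rewrite natrD natrM addrK.
  have e2 : (4 * n.+1)%N%:R = 2 * (2 * n)%N.+2%:R :> R.
    have -> : (4 * n.+1 = 2 * (2 * n).+2)%N by lia.
    by rewrite natrM.
  have e3 : (4 * n.+1)%N%:R - 4 = 4 * n%:R :> R.
    have -> : (4 * n.+1 = 4 * n + 4)%N by lia.
    by rewrite natrD natrM addrK.
  have e4 : (4 * n.+1)%N%:R = 4 * n.+1%:R :> R by rewrite natrM.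
  rewrite e1 e3 {1}e2 e4.
  have -> : 2 * (n%:R * (2 * pi / m%:R)) = 4 * n%:R * (pi / m%:R) :> R by ring.
  have -> : 2 * (n.+1%:R * (2 * pi / m%:R)) = 4 * n.+1%:R * (pi / m%:R) :> R by ring.
  rewrite !mulrA; lra.
(* The cycle eigenvalue 2 is simple and the others are used twice, once in each
   of two consecutive pairs; the last one is left for the middle path
   eigenvalue. *)
have main n : (n <= J)%N ->
  \sum_(l < 2 * n) posp p (pathev m l.+1) + posp p (cycev m n) <=
  posp p 2 + \sum_(j < n) 2 * posp p (cycev m j.+1).
  elim: n => [|n IH] nJ.
    by rewrite muln0 !big_ord0 /cycev mul0r cos0 mulr1 add0r addr0.
  have -> : (2 * n.+1 = (2 * n).+2)%N by lia.
  rewrite !big_ord_recr /=; have h1 := IH (ltnW nJ); have h2 := pair n nJ; lra.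
have mJ : (2 * J < m)%N by lia.
apply: le_trans (main J (leqnn J)).
rewrite -(big_mkord xpredT (fun l => posp p (pathev m l.+1))).
rewrite (big_cat_nat (n := (2 * J).+1)) //= big_mkord.
rewrite [X in _ + X]big_nat [X in _ + X]big1 ?addr0 => [|k /andP[k1 k2]]; last by apply: pathneg; lia.
rewrite big_ord_recr /= lerD2l; apply: posp_le => //; apply: path_le_cyc; lia.
Qed.

End Cycle.

(** * Connected sets, components and degree at most two *)

Section Connectivity.
Variable L : sgraph.
Implicit Types (X Y C : {set L}) (x y z : L).

(** Adjacency restricted to [X], a relation on all of [L] so that no subtype is
    needed. *)
Definition radj X : rel L := fun x y => [&& x \in X, y \in X & adj x y].
(** Connectedness of the subgraph induced on [X]; the empty set qualifies. *)
Definition lconn X := forall x y, x \in X -> y \in X -> connect (radj X) x y.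

Lemma radj_sym X : symmetric (radj X).
Proof. by move=> x y; rewrite /radj adj_sym andbCA. Qed.

Lemma connect_radj_sym X : connect_sym (radj X).
Proof. exact: sym_connect_sym (radj_sym X). Qed.

Lemma connect_stays C X x y : C \subset X ->
  (forall z t, z \in C -> t \in X -> adj z t -> t \in C) ->
  x \in C -> connect (radj X) x y -> y \in C /\ connect (radj C) x y.
Proof.
move=> CX Ccl xC /connectP[q pq ->]; elim: q x xC pq => [|z q IH] x xC /=.
  by split=> //; exact: connect0.
case/andP=> /and3P[xX zX xz] pq; have zC := Ccl _ _ xC zX xz.
have [yC cy] := IH z zC pq; split=> //; apply: connect_trans cy.
by apply: connect1; rewrite /radj xC zC.
Qed.

Definition comp Y x := [set y in Y | connect (radj Y) x y].
Definition comps Y := [set comp Y x | x in Y].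

Lemma comp_closed Y x z t : z \in comp Y x -> t \in Y -> adj z t -> t \in comp Y x.
Proof.
rewrite !inE => /andP[zY cz] tY zt; rewrite tY; apply: connect_trans cz _.
by apply: connect1; rewrite /radj zY tY.
Qed.

Lemma comp_refl Y x : x \in Y -> x \in comp Y x.
Proof. by move=> xY; rewrite inE xY connect0. Qed.

Lemma comp_sub Y x : comp Y x \subset Y.
Proof. by apply/subsetP=> y; rewrite inE => /andP[]. Qed.

Lemma comp_eq Y x y : y \in comp Y x -> comp Y y = comp Y x.
Proof.
rewrite inE => /andP[yY cy]; apply/setP=> z; rewrite !inE; case: (z \in Y) => //=.
apply/idP/idP; first exact: connect_trans.
by apply: connect_trans; rewrite connect_radj_sym.
Qed.

Lemma comp_lconn Y x : x \in Y -> lconn (comp Y x).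
Proof.
move=> xY y z yC zC; rewrite -(comp_eq yC) in zC *.
have yY : y \in Y by apply: (subsetP (comp_sub Y x)).
have := @connect_stays (comp Y y) Y y z (comp_sub _ _) _ (comp_refl yY).
case=> //; first by move=> a b; exact: comp_closed.
by move: zC; rewrite inE => /andP[].
Qed.

Lemma compsP Y C : C \in comps Y ->
  [/\ C \subset Y, (0 < #|C|)%N, lconn C &
      forall z t, z \in C -> t \in Y -> adj z t -> t \in C].
Proof.
case/imsetP=> x xY ->; split; first exact: comp_sub.
- by apply/card_gt0P; exists x; exact: comp_refl.
- exact: comp_lconn.
- by move=> z t; exact: comp_closed.
Qed.

Lemma comps_uniq Y C D x : C \in comps Y -> D \in comps Y -> x \in C -> x \in D -> C = D.
Proof.
by case/imsetP=> a aY -> /imsetP[b bY ->] xa xb; rewrite -(comp_eq xa) -(comp_eq xb).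
Qed.

Lemma comps_partition Y : partition (comps Y) Y.
Proof.
apply/and3P; split.
- apply/eqP/setP=> x; apply/bigcupP/idP => [[C /compsP[CY _ _ _]]|xY].
    exact: (subsetP CY).
  by exists (comp Y x); [exact: imset_f|exact: comp_refl].
- apply/trivIsetP=> C D CP DP CD; rewrite -setI_eq0; apply/eqP/setP=> x; rewrite !inE.
  apply/negP=> /andP[xC xD]; case/eqP: CD; exact: (comps_uniq CP DP xC xD).
- by apply/negP=> /compsP[_]; rewrite cards0.
Qed.

Lemma pinching_trivIset (R : realType) (a : L -> L -> R) (P : {set {set L}}) f g :
  symmetric_kernel a -> tangent f g -> f 0 = 0 -> (forall t, 0 <= f t) -> trivIset P ->
  \sum_(C in P) energy f (induced C a) <= energy f (induced (cover P) a).
Proof.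
move=> sa fg f0 fge; have [n] := ubnP #|P|; elim: n P => // n IH P Pn tP.
have [->|[C CP]] := set_0Vmem P.
  by rewrite big_set0 /energy sumr_ge0.
rewrite (big_setD1 C) //=.
have tP' : trivIset (P :\ C) by apply: trivIsetS tP; exact: subsetDl.
have Pn' : (#|P :\ C| < n)%N by move: Pn; rewrite (cardsD1 C) CP.
apply: le_trans (lerD (lexx _) (IH _ Pn' tP')) _.
apply: (pinching sa fg f0 fge).
- exact: bigcup_sup.
- by apply/bigcupsP=> D; rewrite inE => /andP[_ DP]; exact: bigcup_sup.
rewrite -setI_eq0; apply/eqP/setP=> x; rewrite !inE; apply/negP=> /andP[xC /bigcupP[D]].
rewrite !inE => /andP[DC DP] xD; move/trivIsetP: tP => /(_ _ _ CP DP).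
by rewrite eq_sym => /(_ DC) /disjointFr /(_ xC); rewrite xD.
Qed.

Lemma comps_energy (R : realType) (a : L -> L -> R) Y f g :
  symmetric_kernel a -> tangent f g -> f 0 = 0 -> (forall t, 0 <= f t) ->
  \sum_(C in comps Y) energy f (induced C a) <= energy f (induced Y a).
Proof.
move=> sa fg f0 fge; have /and3P[/eqP cY tY _] := comps_partition Y.
by rewrite -[in leRHS]cY; exact: (pinching_trivIset sa fg f0 fge tY).
Qed.

Definition simple_path X x q := [&& uniq (x :: q), all [in X] (x :: q) & path (@adj L) x q].

Lemma maximal_path X x : x \in X -> exists z q, simple_path X z q /\
  forall y, y \in X -> y \notin z :: q -> ~~ adj y z && ~~ adj (last z q) y.
Proof.
move=> xX; have : simple_path X x [::] by rewrite /simple_path /= xX.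
have [n] := ubnP (#|X| - size (x :: [::]))%N.
elim: n x {xX} [::] => // n IH x q lt sp.
have [/existsP[y /and3P[yX yq]]|] :=
    boolP [exists y, [&& y \in X, y \notin x :: q & adj y x || adj (last x q) y]]; last first.
  rewrite negb_exists => /forallP h; exists x, q; split=> // y yX yq.
  by have := h y; rewrite yX yq /= negb_or.
have /and3P[uq /allP qX pq] := sp.
have sz : (size (x :: q) < #|X|)%N.
  have : (#|y :: x :: q| <= #|X|)%N.
    by apply/subset_leq_card/subsetP=> z; rewrite inE => /orP[/eqP->//|/qX].
  have /card_uniqP -> : uniq (y :: x :: q) by rewrite cons_uniq yq uq.
  by [].
case/orP=> h.
  apply: (IH y (x :: q)); first by move: lt sz => /=; lia.
  apply/and3P; split; first by rewrite cons_uniq yq uq.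
    by apply/allP=> z; rewrite inE => /orP[/eqP->//|/qX].
  by rewrite /= h pq.
apply: (IH x (rcons q y)); first by move: lt sz => /=; rewrite size_rcons; lia.
apply/and3P; split; first by rewrite -rcons_cons rcons_uniq yq uq.
  by apply/allP=> z; rewrite -rcons_cons mem_rcons inE => /orP[/eqP->//|/qX].
by rewrite rcons_path pq.
Qed.

Section DegreeTwo.
Variables (X : {set L}) (x0 : L) (q : seq L).
Hypotheses (Xc : lconn X) (sp : simple_path X x0 q).
Hypothesis maxp : forall y, y \in X -> y \notin x0 :: q -> ~~ adj y x0 && ~~ adj (last x0 q) y.
Hypothesis deg2 : forall z, z \in X -> (#|[set y in X | adj z y]| <= 2)%N.
Let s := x0 :: q.
Let m := size s.
Let v i := nth x0 s i.

Let us : uniq s. Proof. by case/and3P: sp. Qed.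
Let sX z : z \in s -> z \in X. Proof. by case/and3P: sp => _ /allP h _ /h. Qed.
Let vin i : (i < m)%N -> v i \in s. Proof. exact: mem_nth. Qed.
Let vinj i j : (i < m)%N -> (j < m)%N -> v i = v j -> i = j.
Proof. by move=> im jm /eqP; rewrite /v nth_uniq // => /eqP. Qed.
Let vadj i : (i.+1 < m)%N -> adj (v i) (v i.+1).
Proof.
have /and3P[_ _ /(pathP x0) h] := sp; rewrite /m /= ltnS => im.
by have := h i im; rewrite /v /s /=; case: i {im} => [|i] //=.
Qed.

Let interior i y : (0 < i)%N -> (i.+1 < m)%N -> y \in X -> adj (v i) y -> y = v i.-1 \/ y = v i.+1.
Proof.
move=> i0 im yX ay; have im1 : (i < m)%N by apply: ltnW.
have im2 : (i.-1 < m)%N by lia.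
have ne : v i.-1 != v i.+1 by apply/eqP => /(vinj im2 im); lia.
have sub : [set v i.-1; v i.+1] \subset [set y in X | adj (v i) y].
  apply/subsetP=> z; rewrite !inE => /orP[/eqP->|/eqP->].
    rewrite (sX (vin im2)) /= adj_sym -{2}(prednK i0); apply: vadj; lia.
  by rewrite (sX (vin im)) /= vadj.
have : y \in [set v i.-1; v i.+1].
  have /eqP-> : [set v i.-1; v i.+1] == [set y in X | adj (v i) y].
    by rewrite eqEcard sub cards2 ne /= deg2 // (sX (vin im1)).
  by rewrite inE yX.
by rewrite !inE => /orP[/eqP|/eqP]; [left|right].
Qed.

(** Interior points of the path have both their neighbours on it, and the ends
    have none outside by maximality. *)
Lemma simple_path_covers : X = [set z in s].
Proof.
apply/setP=> y; rewrite inE; apply/idP/idP => [yX|]; last exact: sX.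
have x0s : x0 \in [set z in s] by rewrite inE mem_head.
have x0X : x0 \in X by apply: sX; rewrite mem_head.
have := @connect_stays [set z in s] X x0 y _ _ x0s (Xc x0X yX).
case; rewrite ?inE //; first by apply/subsetP=> z; rewrite inE => /sX.
move=> z t; rewrite !in_set => zs tX zt; apply/negPn/negP => tns.
have /andP[m1 m2] := maxp tX tns.
have [i im zE] : exists2 i, (i < m)%N & z = v i.
  by exists (index z s); [rewrite /m index_mem|rewrite /v nth_index].
have [i0|i0] := posnP i.
  by move: zt m1; rewrite zE i0 /v /= adj_sym => ->.
have [im1|im1] := ltnP i.+1 m.
  have zt' : adj (v i) t by rewrite -zE.
  by case: (interior i0 im1 tX zt') => e; move: tns; rewrite e vin //;
    exact: leq_ltn_trans (leq_pred i) im.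
have im' : i = size q.
  by apply/eqP; rewrite eqn_leq; apply/andP; split; [exact: im|exact: im1].
by move: zt m2; rewrite zE /v im' -[size q]/((size s).-1) nth_last /= => ->.
Qed.

Lemma path_adjacency i j : (i < j < m)%N ->
  adj (v i) (v j) -> j = i.+1 \/ (i = 0%N /\ j = m.-1).
Proof.
move=> /andP[ij jm] a; have im : (i < m)%N by lia.
have [jl|jl] := ltnP j.+1 m; last first.
  have [i0|i0] := posnP i; first by right; split=> //; lia.
  have im1 : (i.+1 < m)%N by lia.
  have jX : v j \in X by apply: sX; exact: vin.
  case: (interior i0 im1 jX a) => e; [|left; exact: vinj e].
  by have im2 : (i.-1 < m)%N by [lia]; have := vinj jm im2 e; lia.
have j0 : (0 < j)%N by lia.
have iX : v i \in X by apply: sX; exact: vin.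
rewrite adj_sym in a; left.
have jm2 : (j.-1 < m)%N by lia.
case: (interior j0 jl iX a) => e; first by have := vinj im jm2 e; lia.
by have := vinj im jl e; lia.
Qed.

Lemma degree_two_energy (R : realType) (p : R) : 2 <= p ->
  alpha p #|X| <= energy (posp p) (induced X (@adjk R L)).
Proof.
move=> p2; have cX : #|X| = m.
  by rewrite simple_path_covers cardsE; apply/card_uniqP.
pose h (i : 'I_m) := v i.
have hi : injective h.
  by move=> i j e; apply/val_inj; exact: vinj e.
have hX i : h i \in X by apply: sX; exact: vin.
have hcod x : x \notin codom h -> x \notin X.
  apply: contra; rewrite simple_path_covers inE => xs.
  have xm : (index x s < m)%N by rewrite index_mem.
  by apply/codomP; exists (Ordinal xm); rewrite /h /v nth_index.
have sym := @adjk_symmetric R L.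
have ind (b : 'I_m -> 'I_m -> R) : (forall i j, b i j = (adj (h i) (h j))%:R) ->
    energy (posp p) (induced X (@adjk R L)) = energy (posp p) b.
  move=> bE; apply: (@energy_injective R _ _ h) => //.
  - exact: induced_symmetric.
  - by move=> i j; rewrite /induced !hX bE.
  - by move=> x y /hcod xX; rewrite /induced (negPf xX).
  - exact: posp0.
have adjE (i j : 'I_m) : (i < j)%N ->
    adj (h i) (h j) = (i.+1 == j :> nat) || [&& i == 0%N :> nat, j == m.-1 :> nat & adj (v 0) (v m.-1)].
  move=> ij; apply/idP/orP => [a|[/eqP e|/and3P[/eqP e1 /eqP e2 a]]].
  - have ijm : (i < j < m)%N by rewrite ij /=.
    case: (path_adjacency ijm a) => [->|[e1 e2]]; first by left.
    by right; rewrite e1 e2 !eqxx -{1}e1 -e2.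
  - by rewrite /h -e; apply: vadj; rewrite e.
  - by rewrite /h e1 e2.
rewrite cX.
have [m3|m3] := boolP ((2 < m)%N && adj (v 0) (v m.-1)).
  have /andP[m2 a0] := m3.
  rewrite (ind (@cyck R m)); first exact: cycle_energy.
  move=> i j; rewrite /cyck; congr ((_ : bool)%:R).
  have cyc (k l : 'I_m) : (k < l)%N ->
      ((k.+1 %% m == l) || (l.+1 %% m == k))%N = adj (h k) (h l).
    move=> kl; rewrite adjE // a0 andbT.
    have lm := ltn_ord l; rewrite modn_small; last by lia.
    congr (_ || _); have [e|ne] := eqVneq l.+1 m.
      by rewrite e modnn; apply/eqP/andP => [<-|[/eqP->//]]; split=> //; apply/eqP; lia.
    rewrite modn_small; last by lia.
    by apply/eqP/andP => [|[_ /eqP]]; lia.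
  have [ij|ij|/val_inj->] := ltngtP i j.
  - exact: cyc.
  - by rewrite orbC adj_sym cyc.
  - rewrite adj_irr orbb; apply/eqP; have jm := ltn_ord j.
    have [e|ne] := eqVneq j.+1 m; first by rewrite e modnn; lia.
    rewrite modn_small; lia.
rewrite (ind (@adjk R (path_graph m))) //.
move=> i j; rewrite /adjk; congr ((_ : bool)%:R); rewrite /= /path_adj.
have pth (k l : 'I_m) : (k < l)%N ->
    ((k.+1 == l :> nat) || (l.+1 == k :> nat)) = adj (h k) (h l).
  move=> kl; rewrite adjE //; have lm := ltn_ord l.
  have -> : (l.+1 == k :> nat) = false by apply/eqP; lia.
  rewrite orbF; apply/idP/orP => [->|]; first by left.
  case=> // /and3P[/eqP k0 /eqP l1 a]; move: m3; rewrite a andbT -leqNgt => m2.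
  by apply/eqP; lia.
have [ij|ij|/val_inj->] := ltngtP i j.
- exact: pth.
- by rewrite orbC adj_sym pth.
- by rewrite adj_irr orbb; apply/eqP; lia.
Qed.

End DegreeTwo.
End Connectivity.

(** A maximal simple path covers [X], and the only further adjacency it allows
    is the one between its ends. *)
Lemma alpha_le_degree_two (R : realType) (L : sgraph) (X : {set L}) (p : R) : 2 <= p ->
  (0 < #|X|)%N -> lconn X -> (forall z, z \in X -> (#|[set y in X | adj z y]| <= 2)%N) ->
  alpha p #|X| <= energy (posp p) (induced X (@adjk R L)).
Proof.
move=> p2 /card_gt0P[x xX] Xc deg2; have [z [q [sp maxp]]] := maximal_path xX.
exact: degree_two_energy Xc sp maxp deg2 _ _ p2.
Qed.

(** * Stars in a line graph, and large exponents *)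

Section LineGraphs.
Variable G : sgraph.
Notation L := (line_graph G).
Implicit Types (X Y C : {set L}) (x y z e : L) (v w : G).

Lemma edge_ends x v : v \in val x -> exists w, w != v /\ val x = [set v; w].
Proof.
have : val x \in edges G := valP x.
rewrite inE => /existsP[a /existsP[b /andP[ab /eqP->]]].
have nab : a != b by apply: contraTneq ab => ->; rewrite adj_irr.
rewrite !inE => /orP[/eqP->|/eqP->].
  by exists b; rewrite eq_sym.
by exists a; split=> //; rewrite setUC.
Qed.

Lemma edge_ends_ex x : exists v, v \in val x.
Proof.
have : val x \in edges G := valP x.
rewrite inE => /existsP[a /existsP[b /andP[ab /eqP->]]].
by exists a; rewrite !inE eqxx.
Qed.

Lemma line_adjE x y : adj x y = (x != y) && (val x :&: val y != set0).
Proof. by []. Qed.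

Lemma line_adj_common x y : adj x y -> exists v, (v \in val x) && (v \in val y).
Proof. by rewrite line_adjE => /andP[_ /set0Pn[v]]; rewrite inE => h; exists v. Qed.

Lemma common_line_adj x y v : x != y -> v \in val x -> v \in val y -> adj x y.
Proof.
by move=> xy vx vy; rewrite line_adjE xy; apply/set0Pn; exists v; rewrite inE vx.
Qed.

(** Edges of a simple graph are determined by two of their ends. *)
Lemma two_common x y v w : v != w -> v \in val x -> w \in val x ->
  v \in val y -> w \in val y -> x = y.
Proof.
move=> vw vx wx vy wy; apply/val_inj.
have ends z : v \in val z -> w \in val z -> val z = [set v; w].
  move=> vz wz; have [u [uv zE]] := edge_ends vz.
  by move: wz; rewrite zE !inE eq_sym (negPf vw) /= => /eqP->.
by rewrite (ends x) // (ends y).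
Qed.

(** The edges in [X] at the vertex [v]; they are pairwise adjacent in the line
    graph. *)
Definition star X v := [set x in X | v \in val x].

Lemma starP X v x : (x \in star X v) = (x \in X) && (v \in val x).
Proof. by rewrite inE. Qed.

Lemma star_sub X v : star X v \subset X.
Proof. by apply/subsetP=> x; rewrite starP => /andP[]. Qed.

Lemma star_adj X v x y : x \in star X v -> y \in star X v -> x != y -> adj x y.
Proof.
by rewrite !starP => /andP[_ vx] /andP[_ vy] xy; exact: common_line_adj vx vy.
Qed.

Lemma alpha0 (R : realType) p : alpha p 0 = 0 :> R.
Proof. by rewrite /alpha path_spectrum big_ord0. Qed.

Lemma energy_posp_ge0 (R : realType) p (T : finType) (a : T -> T -> R) : 0 <= energy (posp p) a.
Proof. by rewrite /energy sumr_ge0 // => x _; exact: posp_ge0. Qed.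

(** A walk that leaves [C] does so along some adjacency. *)
Lemma exit_edge X C (x e : L) : C \subset X -> x \in C -> e \notin C ->
  connect (radj X) x e -> exists z t, [/\ z \in C, t \in X, t \notin C & adj z t].
Proof.
move=> CX xC eC xe.
have [/existsP[z /existsP[t /and4P[zC tX tC zt]]]|] :=
    boolP [exists z, [exists t, [&& z \in C, t \in X, t \notin C & adj z t]]].
  by exists z, t.
rewrite negb_exists => /forallP h; case/negP: eC.
have [] := @connect_stays _ C X x e CX _ xC xe => //.
move=> z t zC tX zt; have := h z; rewrite negb_exists => /forallP /(_ t).
by rewrite zC tX zt /= andbT negbK.
Qed.

(** Let [A] be the component of [X - e] that contains the rest of the star, and
    [B] what is left.  Each component of [B] touches [e] at its end [w] other
    than [v], so there is at most one, and induction applies to [A] and to [B].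
    *)
Lemma large_degree_step (R : realType) (p : R) X v e : 3 <= p -> lconn X ->
  (2 < #|star X v|)%N -> e \in star X v ->
  (forall Y, (0 < #|Y| < #|X|)%N -> lconn Y ->
     alpha p #|Y| <= energy (posp p) (induced Y (@adjk R L))) ->
  alpha p #|X| <= energy (posp p) (induced X (@adjk R L)).
Proof.
move=> p3 Xc d3 eS IH; have p2 : 2 <= p by lra.
move: (eS); rewrite starP => /andP[eX ve].
have [w [wv eE]] := edge_ends ve.
have : (1 < #|star X v :\ e|)%N by move: d3; rewrite (cardsD1 e) eS.
case/card_gt1P => x1 [x2 [x1S x2S x12]].
pose X' := X :\ e.
have inX' x : x \in star X v :\ e -> x \in X'.
  by rewrite !inE => /andP[-> /andP[-> _]].
have inS x : x \in star X v :\ e -> x \in star X v by rewrite in_setD1 => /andP[].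
pose A := comp X' x1.
have SA x : x \in star X v :\ e -> x \in A.
  move=> xS; have [->|xx1] := eqVneq x x1; first by apply: comp_refl; exact: inX'.
  apply: comp_closed (comp_refl (inX' _ x1S)) (inX' _ xS) _.
  apply: (@star_adj X v); [exact: inS|exact: inS|by rewrite eq_sym].
have AX' : A \subset X' := comp_sub _ _.
have X'X : X' \subset X by exact: subsetDl.
have eA : e \notin A by apply/negP => /(subsetP AX'); rewrite !inE eqxx.
pose B := X' :\: A.
have BX : B \subset X by apply: subset_trans X'X; exact: subsetDl.
have AX : A \subset X by apply: subset_trans X'X.
have touch y : y \in B -> exists2 z, z \in comp X' y & w \in val z.
  rewrite inE => /andP[yA yX'].
  have CX : comp X' y \subset X by apply: subset_trans X'X; exact: comp_sub.
  have eC : e \notin comp X' y by apply/negP => /(subsetP (comp_sub _ _)); rewrite !inE eqxx.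
  have [z [t [zC tX tC zt]]] := exit_edge CX (comp_refl yX') eC (Xc _ _ (subsetP CX _ (comp_refl yX')) eX).
  have te : t = e.
    apply/eqP; apply: contraNT tC => te; apply: comp_closed zC _ zt; by rewrite !inE te.
  exists z => //; rewrite {}te in zt; have [u /andP[uz ue]] := line_adj_common zt.
  move: ue; rewrite eE !inE => /orP[/eqP uv|/eqP<-//].
  have zX' := subsetP (comp_sub _ _) _ zC.
  have zA : z \in A.
    by apply: SA; move: zX'; rewrite !inE -uv uz andbT.
  case/negP: yA; by rewrite /A -(comp_eq zA) (comp_eq zC) comp_refl.
have Bc : lconn B /\ alpha p #|B| <= energy (posp p) (induced B (@adjk R L)).
  have [B0|[y yB]] := set_0Vmem B.
    by split; [move=> a b; rewrite B0 inE|rewrite B0 cards0 alpha0 energy_posp_ge0].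
  have yX' : y \in X' by move: yB; rewrite inE => /andP[].
  have BE : B = comp X' y.
    apply/setP=> t; apply/idP/idP => [tB|tC].
      have tX' : t \in X' by move: tB; rewrite inE => /andP[].
      have [z zC wz] := touch y yB; have [z' zC' wz'] := touch t tB.
      have z'C : z' \in comp X' y.
        have [<-//|zz] := eqVneq z z'.
        apply: comp_closed zC _ (common_line_adj zz wz wz').
        exact: (subsetP (comp_sub _ _) _ zC').
      by rewrite -(comp_eq z'C) (comp_eq zC') comp_refl.
    rewrite inE (subsetP (comp_sub _ _) _ tC) andbT.
    apply/negP => tA; move: yB; rewrite inE => /andP[/negP yA _]; apply: yA.
    by rewrite /A -(comp_eq tA) (comp_eq tC) comp_refl.
  have Bl : lconn B by rewrite BE; exact: comp_lconn.
  split=> //; apply: IH => //; apply/andP; split; first by apply/card_gt0P; exists y.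
  by apply: proper_card; apply/properP; split=> //; exists e => //; rewrite !inE eqxx andbF.
have cX : #|X| = (#|A| + #|B|.+1)%N.
  have -> : #|X| = #|X'|.+1 by have := cardsD1 e X; rewrite eX.
  have := cardsID A X'; rewrite (setIidPr AX') -/B => <-; by rewrite addnS.
have x1A := SA _ x1S; have x2A := SA _ x2S.
have A0 : (0 < #|A|)%N by apply/card_gt0P; exists x1.
have IHA : alpha p #|A| <= energy (posp p) (induced A (@adjk R L)).
  apply: IH; last by apply: comp_lconn; exact: inX'.
  by rewrite A0 cX addnS ltnS leq_addr.
have sym := @adjk_symmetric R L.
have tf : tangent (posp p) (dposp p) by apply: posp_tangent; lra.
have pin : energy (posp p) (induced (e |: A) (@adjk R L)) + energy (posp p) (induced B (@adjk R L)) <=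
    energy (posp p) (induced X (@adjk R L)).
  apply: (pinching sym tf (posp0 p) (posp_ge0 p)) => //.
    by rewrite subUset sub1set eX.
  rewrite disjoint_subset; apply/subsetP=> z.
  rewrite in_setU1 => zA; change (z \notin X' :\: A); rewrite in_setD negb_and negbK.
  by case/orP: zA => [/eqP->|->//]; rewrite in_setD1 eqxx orbT.
have adj1 x : x \in star X v :\ e -> adj e x.
  rewrite !inE => /andP[xe /andP[xX vx]]; apply: (@star_adj X v); rewrite ?starP ?xX ?eX //.
  by rewrite eq_sym.
have adj12 : adj x1 x2.
  by apply: (@star_adj X v) => //; exact: inS.
have gain := attach_triangle p3 eA x1A x2A (adj1 _ x1S) (adj1 _ x2S) adj12.
have := alpha_concat #|B| p2 A0; rewrite -cX.
move: Bc IHA pin gain => [_]; lra.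
Qed.

End LineGraphs.

(** * Stars with fewer components than edges *)

Section StarCut.
Variable G : sgraph.
Notation L := (line_graph G).
Implicit Types (X Y C : {set L}) (x y z e : L) (v w : G).

(** Two different edges at [v] reach, from outside the star, the same component
    of the complement of the star. *)
Definition nonsep X v := exists e f a b : L,
  [/\ e \in star X v, f \in star X v & e != f] /\
  [/\ a \in X :\: star X v, b \in X :\: star X v, adj a e, adj b f &
      connect (radj (X :\: star X v)) a b].

Lemma off_star X v x : x \in X :\: star X v = (x \in X) && (v \notin val x).
Proof. by rewrite in_setD starP; case: (x \in X); rewrite //= andbT. Qed.

Lemma touch_other_end X v e x : e \in star X v -> x \in X :\: star X v -> adj x e ->
  exists w, [/\ w != v, val e = [set v; w] & w \in val x].
Proof.
rewrite starP off_star => /andP[eX ve] /andP[xX vx] /line_adj_common[u /andP[ux ue]].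
have [w [wv eE]] := edge_ends ve; exists w; split=> //.
by move: ue; rewrite eE !inE => /orP[/eqP uv|/eqP<-//]; rewrite uv (negPf vx) in ux.
Qed.

(** Off the star, an element adjacent to [e] contains the end of [e] other than
    [v]; all such elements are pairwise adjacent. *)
Lemma touch_uniq X v e C D x y : e \in star X v ->
  C \in comps (X :\: star X v) -> D \in comps (X :\: star X v) ->
  x \in C -> y \in D -> adj x e -> adj y e -> C = D.
Proof.
move=> eS CP DP xC yD xe ye; have [CY _ _ Ccl] := compsP CP; have [DY _ _ _] := compsP DP.
have [w [wv eE wx]] := touch_other_end eS (subsetP CY _ xC) xe.
have [w' [w'v eE' wy]] := touch_other_end eS (subsetP DY _ yD) ye.
have ww : w' = w.
  have : w' \in val e by rewrite eE' !inE eqxx orbT.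
  by rewrite eE !inE (negPf w'v) => /eqP.
rewrite {}ww in wy; apply: (comps_uniq CP DP _ yD).
have [<-//|xy] := eqVneq x y.
exact: Ccl xC (subsetP DY _ yD) (common_line_adj xy wx wy).
Qed.

(** Each component touches some edge of the star, and by [touch_uniq] no edge is
    touched by two components; an edge can be left out since one component
    touches two edges. *)
Lemma comps_lt_star X v : lconn X -> nonsep X v ->
  (#|comps (X :\: star X v)| < #|star X v|)%N.
Proof.
move=> Xc [e [f [a [b [[eS fS ef] [aY bY ae bf ab]]]]]].
pose touch C x := (x \in star X v) && [exists y in C, adj y x].
pose g C := odflt e [pick x | touch C x].
have gP C : C \in comps (X :\: star X v) -> touch C (g C).
  move=> CP; have [CY C0 _ Ccl] := compsP CP; rewrite /g; case: pickP => // none.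
  have /card_gt0P[x xC] := C0.
  have eX := subsetP (star_sub X v) _ eS.
  have eC : e \notin C.
    by apply/negP => /(subsetP CY); rewrite in_setD eS.
  have CX : C \subset X by apply: subset_trans CY (subsetDl _ _).
  have [z [t [zC tX tC zt]]] := exit_edge CX xC eC (Xc _ _ (subsetP CX _ xC) eX).
  have := none t; rewrite /touch => /negP[]; apply/andP; split; last first.
    by apply/existsP; exists z; rewrite zC.
  by apply: contraNT tC => tS; apply: Ccl zC _ zt; rewrite in_setD tS.
have uni C D x : C \in comps (X :\: star X v) -> D \in comps (X :\: star X v) ->
    touch C x -> touch D x -> C = D.
  move=> CP DP /andP[xS /existsP[y /andP[yC yx]]] /andP[_ /existsP[z /andP[zD zx]]].
  exact: touch_uniq xS CP DP yC zD yx zx.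
have ginj : {in comps (X :\: star X v) &, injective g}.
  by move=> C D CP DP gg; apply: (uni C D (g C)) => //; [|rewrite gg]; exact: gP.
rewrite -(card_in_imset ginj).
pose C0 := comp (X :\: star X v) a.
have C0P : C0 \in comps (X :\: star X v) by exact: imset_f.
have te : touch C0 e by rewrite /touch eS; apply/existsP; exists a; rewrite comp_refl.
have tf : touch C0 f.
  by rewrite /touch fS; apply/existsP; exists b; rewrite inE bY ab.
(* The component of [a] touches two edges, and [g] selects at most one of them.
   *)
suff sub h : h \in star X v -> touch C0 h -> g C0 != h ->
    (#|g @: comps (X :\: star X v)| < #|star X v|)%N.
  have [ge|ne] := eqVneq (g C0) e; last exact: sub ne.
  by apply: (sub f) => //; rewrite ge.
move=> hS th gh; rewrite (cardsD1 h (star X v)) hS ltnS; apply/subset_leq_card/subsetP => x.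
case/imsetP => C CP ->; rewrite in_setD1; have /andP[-> _] := gP _ CP; rewrite andbT.
apply: contraNneq gh => gC; have tC : touch C h by rewrite -gC; exact: gP.
by rewrite (uni _ _ _ C0P CP th tC) gC.
Qed.

Lemma star_energy (R : realType) (p : R) X v : (0 < #|star X v|)%N ->
  posp p (#|star X v|.-1)%:R <= energy (posp p) (induced (star X v) (@adjk R L)).
Proof.
set S := star X v => S0; have sa := @adjk_symmetric R L.
have sS : symmetric_kernel (induced S (@adjk R L)) by exact: induced_symmetric.
have sumS : \sum_x ((x \in S)%:R : R) ^+ 2 = #|S|%:R.
  rewrite -sum1_card natr_sum [RHS]big_mkcond; apply: eq_bigr => x _.
  by case: (x \in S); rewrite ?expr1n ?expr0n.
have := @energy_ge_orthogonal R L 'I_1 _ (fun _ x => (x \in S)%:R)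
  (fun=> (#|S|.-1)%:R) (posp p) sS (posp_ge0 p).
rewrite big_ord1; apply=> [i j|i|_ x]; first by rewrite !ord1.
  by rewrite sumS ltr0n.
rewrite /induced; have [xS|xS] := boolP (x \in S); last first.
  by rewrite big1 ?mulr0 // => y _; rewrite mul0r.
have -> : #|S|.-1 = #|S :\ x| by rewrite (cardsD1 x) xS.
rewrite mulr1 -sum1_card natr_sum [RHS]big_mkcond; apply: eq_bigr => y _ /=.
rewrite in_setD1 /adjk; have [->|yx] := eqVneq y x; first by rewrite adj_irr if_same mul0r.
have [yS|] := boolP (y \in S); last by rewrite mulr0.
by rewrite (star_adj xS yS) ?mulr1 // eq_sym.
Qed.

(** Pinching isolates the star and the components of its complement. *)
Lemma star_cut_step (R : realType) (p : R) X v : 2 <= p < 4 -> lconn X ->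
  (2 < #|star X v|)%N -> nonsep X v ->
  (forall Y, (0 < #|Y| < #|X|)%N -> lconn Y ->
     alpha p #|Y| <= energy (posp p) (induced Y (@adjk R L))) ->
  alpha p #|X| <= energy (posp p) (induced X (@adjk R L)).
Proof.
move=> p24 Xc d3 ns IH; have := comps_lt_star Xc ns.
set S := star X v in d3 *; set Y := X :\: S => few.
have S0 : (0 < #|S|)%N by apply: leq_trans d3.
have p1 : 1 <= p by move: p24 => /andP[]; lra.
have sa := @adjk_symmetric R L; have tf := posp_tangent p1.
have cX : #|X| = (#|S| + #|Y|)%N.
  by rewrite -(cardsID S X) (setIidPr (star_sub X v)).
have pin : energy (posp p) (induced S (@adjk R L)) + energy (posp p) (induced Y (@adjk R L))
    <= energy (posp p) (induced X (@adjk R L)).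
  apply: (pinching sa tf (posp0 p) (posp_ge0 p)); [exact: star_sub|exact: subsetDl|].
  by rewrite -setI_eq0 setIDA setDIl setDv set0I.
have comps_le := comps_energy Y sa tf (posp0 p) (posp_ge0 p).
pose ms := [seq #|C| | C <- enum (comps Y)].
have msE : sumn ms = #|Y|.
  by rewrite sumnE big_map big_enum /= -(card_partition (comps_partition Y)).
have msP : all (fun m => 0 < m)%N ms.
  by apply/allP=> m /mapP[C]; rewrite mem_enum => /compsP[_ ? _ _] ->.
have szms : (size ms < #|S|)%N by rewrite size_map -cardE.
have := star_numeric p24 d3 szms msP; rewrite msE -cX => /le_trans; apply.
apply: le_trans pin; apply: lerD; first exact: star_energy.
apply: le_trans comps_le; rewrite big_map big_enum /=; apply: ler_sum => C CP.
have [CY C0 Cc _] := @compsP L Y C CP.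
apply: IH => //; rewrite C0 cX /=; apply: leq_ltn_trans (subset_leq_card CY) _.
by rewrite -[ltnLHS]add0n ltn_add2r.
Qed.
End StarCut.

(** * Breadth-first trees *)

Section BreadthFirst.
Variables (L : sgraph) (X : {set L}) (r : L).
Hypotheses (rX : r \in X) (Xc : lconn X).

Let next (B : {set L}) := B :|: [set y in X | [exists x in B, adj x y]].
Let ball n := iter n next [set r].

Let ball_step n x y : x \in ball n -> y \in X -> adj x y -> y \in ball n.+1.
Proof.
move=> xB yX xy; rewrite /ball iterS -/(ball n) !inE yX /=; apply/orP; right.
by apply/existsP; exists x; rewrite xB.
Qed.

Let ball_reach x : exists n, (x \notin X) || (x \in ball n).
Proof.
have [xX|] := boolP (x \in X); last by exists 0%N.
have /connectP[q pq ->] := Xc rX xX => /=.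
have : exists n, r \in ball n by exists 0%N; rewrite inE.
elim: q r pq => //= y q IH z /andP[/and3P[_ yX zy] pq] [n zB].
by apply: IH pq _; exists n.+1; exact: ball_step zy.
Qed.

(** The level is the first index of a ball around [r] that contains the point,
    and the parent any neighbour one level up. *)
Lemma breadth_first : exists (lev : L -> nat) (par : L -> L), [/\
  forall x y, x \in X -> y \in X -> adj x y -> (lev y <= (lev x).+1)%N &
  forall x, x \in X -> x != r ->
    [/\ par x \in X, adj x (par x) & lev x = (lev (par x)).+1]].
Proof.
pose lev x := ex_minn (ball_reach x).
have levP x : x \in X -> x \in ball (lev x).
  by rewrite /lev; case: ex_minnP => n + _ xX; rewrite xX.
have levm x n : x \in ball n -> (lev x <= n)%N.
  by rewrite /lev; case: ex_minnP => k _ h xB; apply: h; rewrite xB orbT.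
pose good x y := [&& y \in X, adj x y & lev x == (lev y).+1].
pose par x := odflt x [pick y | good x y].
exists lev, par; split=> [x y xX yX xy|x xX xr].
  by apply: levm; exact: ball_step (levP _ xX) yX xy.
suff [y gy] : exists y, good x y.
  rewrite /par; case: pickP => [z /and3P[? ? /eqP ?] //|/(_ y)].
  by rewrite gy.
case E : (lev x) => [|n]; have := levP _ xX; rewrite E.
  by rewrite inE (negPf xr).
rewrite /ball iterS -/(ball n) !inE => /orP[/levm|]; first by rewrite E ltnn.
case/andP=> _ /existsP[y /andP[yB yx]]; exists y.
have yX : y \in X.
  elim: (n) yB {E yx xr xX} => [|k IH]; first by rewrite inE => /eqP->.
  by rewrite /ball iterS -/(ball k) !inE => /orP[/IH//|/andP[]].
rewrite /good yX adj_sym yx E eqSS eqn_leq (levm _ _ yB) andbT.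
by rewrite -ltnS -E; apply: levm; exact: ball_step (levP _ yX) xX yx.
Qed.

End BreadthFirst.

(** The root carries an arbitrary value of [par], which the first condition
    disregards. *)
Definition parent (T : eqType) (r : T) (par : T -> T) x y := (x != r) && (par x == y).

Section NoNonsep.
Variable G : sgraph.
Notation L := (line_graph G).
Implicit Types (X Y C : {set L}) (x y z e f : L) (v w : G).

(** Close the connection between [a] and [b] through [f], so that it links [f]
    to [a], which lies in the star of [w].  Where it first enters that star
    gives the second edge at [w]; the first one is [e], with [f] outside the
    star. *)
Lemma nonsep_other_end X v e f a b w : e \in star X v -> f \in star X v -> e != f ->
  a \in X :\: star X v -> b \in X :\: star X v -> adj a e -> adj b f ->
  connect (radj (X :\: star X v)) a b -> w != v -> w \in val e -> nonsep X w.
Proof.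
move=> eS fS ef aY bY ae bf ab wv we.
move: (eS) (fS); rewrite !starP => /andP[eX ve] /andP[fX vf].
have wf : w \notin val f by apply: contra ef => wf; rewrite (two_common wv we ve wf vf).
have wa : w \in val a.
  have [w' [w'v eE wa]] := touch_other_end eS aY ae.
  by move: we; rewrite eE !inE (negPf wv) => /eqP->.
have aX : a \in X by move: aY; rewrite off_star => /andP[].
pose X' := f |: (X :\: star X v); pose Y := X :\: star X w.
have X'X : X' \subset X by rewrite subUset sub1set fX subsetDl.
have fY : f \in Y by rewrite off_star fX.
have fX' : f \in X' by rewrite setU11.
have fa : connect (radj X') f a.
  apply: (@connect_trans _ _ b).
    by apply: connect1; rewrite /radj fX' setU1r // adj_sym.
  rewrite connect_radj_sym; apply: connect_sub ab => x y /and3P[xY yY xy].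
  by apply: connect1; rewrite /radj !setU1r.
pose C := comp Y f :&: X'.
have fC : f \in C by rewrite inE comp_refl.
have aC : a \notin C.
  by rewrite inE; apply/negP => /andP[/(subsetP (comp_sub _ _))]; rewrite off_star wa andbF.
have [z [t [zC tX' tC zt]]] := exit_edge (subsetIr _ _) fC aC fa.
move: zC; rewrite inE => /andP[zC _].
have tX := subsetP X'X _ tX'.
have tS : t \in star X w.
  apply: contraNT tC => tS; rewrite inE tX' andbT; apply: comp_closed zC _ zt.
  by rewrite in_setD tS.
have tf : t != f by apply: contraNneq wf => <-; move: tS; rewrite starP => /andP[].
have tv : v \notin val t.
  by move: tX'; rewrite in_setU1 (negPf tf) off_star => /andP[].
exists e, t, f, z; split; split.
- by rewrite starP eX.
- exact: tS.
- by apply: contraNneq tv => <-.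
- exact: fY.
- exact: (subsetP (comp_sub Y f)).
- by apply: (star_adj fS eS); rewrite eq_sym.
- exact: zt.
- by move: zC; rewrite inE => /andP[].
Qed.

(** At a vertex with [nonsep] there are exactly two edges, hence
    [nonsep_other_end] applies to each of them and the property spreads along
    [X]. *)
Lemma all_nonsep X v0 v : lconn X ->
  (forall v, (2 < #|star X v|)%N -> ~ nonsep X v) -> nonsep X v -> (#|star X v0| <= 2)%N.
Proof.
move=> Xc big ns; rewrite leqNgt; apply/negP => d3; apply: (big v0 d3).
have /card_gt0P[x0] : (0 < #|star X v0|)%N by exact: leq_trans d3.
rewrite starP => /andP[x0X v0x].
have ends u x w : nonsep X u -> x \in star X u -> w \in val x -> nonsep X w.
  move=> nu xS wx; have [->//|wu] := eqVneq w u.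
  have [e [f [a [b [[eS fS ef] [aY bY ae bf ab]]]]]] := nu.
  have : x \in [set e; f].
    have /eqP-> // : [set e; f] == star X u.
    rewrite eqEcard subUset !sub1set eS fS cards2 ef /= leqNgt.
    by apply/negP => /big.
  rewrite !inE => /orP[/eqP E|/eqP E]; subst x.
    exact: nonsep_other_end eS fS ef aY bY ae bf ab wu wx.
  apply: nonsep_other_end fS eS _ bY aY bf ae _ wu wx; first by rewrite eq_sym.
  by rewrite connect_radj_sym.
have [e [f [a [b [[eS _ _] _]]]]] := ns.
have eX : e \in X by move: eS; rewrite starP => /andP[].
have all_e w : w \in val e -> nonsep X w by exact: ends ns eS.
have /connectP[q pq x0E] := Xc e x0 eX x0X.
suff : forall w, w \in val (last e q) -> nonsep X w by apply; rewrite -x0E.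
elim: q e pq all_e {x0E ns eS eX} => //= y q IH e /andP[/and3P[eX yX ey] pq] all_e.
apply: IH pq _ => w wy; have [u /andP[ue uy]] := line_adj_common ey.
by apply: ends (all_e u ue) _ wy; rewrite starP yX.
Qed.

Lemma nonsepI X v e f a b : e \in star X v -> f \in star X v -> e != f ->
  a \in X :\: star X v -> b \in X :\: star X v -> adj a e -> adj b f ->
  connect (radj (X :\: star X v)) a b -> nonsep X v.
Proof. by move=> eS fS ef aY bY ae bf ab; exists e, f, a, b; split; split. Qed.

Section Tree.
Variables (X : {set L}) (r : L) (lev : L -> nat) (par : L -> L).
Hypothesis lev_adj : forall x y, x \in X -> y \in X -> adj x y -> (lev y <= (lev x).+1)%N.
Hypothesis par_up : forall x, x \in X -> x != r ->
    [/\ par x \in X, adj x (par x) & lev x = (lev (par x)).+1].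
Hypothesis sep : forall v, ~ nonsep X v.

(** Follow parents upwards from [par f]: entering the star again would, together
    with [f], contradict [sep]. *)
Lemma exit_to_root v f : f \in star X v -> f != r -> par f \notin star X v ->
  r \in X :\: star X v /\ connect (radj (X :\: star X v)) (par f) r.
Proof.
move=> fS fr pS; have fX := subsetP (star_sub X v) _ fS.
have [pX fp lf] := par_up fX fr; set Y := X :\: star X v.
have pY : par f \in Y by rewrite in_setD pS.
suff : forall n t, (lev t < n)%N -> (lev t < lev f)%N -> t \in Y -> connect (radj Y) (par f) t ->
    r \in Y /\ connect (radj Y) (par f) r.
  by move/(_ _ (par f) (ltnSn _)); apply=> //; rewrite lf.
elim=> // n IH t tn tf tY ct.
have tX : t \in X by move: tY; rewrite off_star => /andP[].
have [<-//|tr] := eqVneq t r.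
have [ptX tpt lt] := par_up tX tr.
have [ptS|ptS] := boolP (par t \in star X v).
  have ft : f != par t by apply: contraTneq tf => ->; rewrite lt -leqNgt.
  have pff : adj (par f) f by rewrite adj_sym.
  by case: (sep (nonsepI fS ptS ft pY tY pff tpt ct)).
have ptY : par t \in Y by rewrite in_setD ptS.
apply: (IH (par t)) => //.
- by rewrite -ltnS -lt.
- by apply: leq_ltn_trans tf; rewrite lt.
- by apply: connect_trans ct _; apply: connect1; rewrite /radj tY ptY.
Qed.

(** Two edges whose parents lie outside the star are linked outside it through
    the root. *)
Lemma exit_uniq v e f : e \in star X v -> f \in star X v ->
  (e == r) || (par e \notin star X v) -> (f == r) || (par f \notin star X v) -> e = f.
Proof.
move=> eS fS exe exf; apply/eqP/negPn/negP => ef.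
have [er|er] := eqVneq e r.
  have fr : f != r by rewrite -er eq_sym.
  move: exf; rewrite (negPf fr) /= => pf.
  by have [] := exit_to_root fS fr pf; rewrite in_setD -er eS.
move: exe; rewrite (negPf er) /= => pe.
have [fr|fr] := eqVneq f r.
  by have [] := exit_to_root eS er pe; rewrite in_setD -fr fS.
move: exf; rewrite (negPf fr) /= => pf.
have [rY ce] := exit_to_root eS er pe; have [_ cf] := exit_to_root fS fr pf.
have [peX epe _] := par_up (subsetP (star_sub X v) _ eS) er.
have [pfX fpf _] := par_up (subsetP (star_sub X v) _ fS) fr.
have peY : par e \in X :\: star X v by rewrite in_setD pe.
have pfY : par f \in X :\: star X v by rewrite in_setD pf.
rewrite adj_sym in epe; rewrite adj_sym in fpf.
apply: (sep (nonsepI eS fS ef peY pfY epe fpf _)).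
by apply: connect_trans ce _; rewrite connect_radj_sym.
Qed.

(** In a star, the element of lowest level is the only one whose parent is not
    in the star, so it is the parent of all others. *)
Lemma adj_parent_or_sibling x y : x \in X -> y \in X -> adj x y ->
  [|| parent r par x y, parent r par y x | [&& x != r, y != r & par x == par y]].
Proof.
move=> xX yX xy; have [v /andP[vx vy]] := line_adj_common xy.
have xS : x \in star X v by rewrite starP xX.
have yS : y \in star X v by rewrite starP yX.
have nxy : x != y by apply: contraTneq xy => ->; rewrite adj_irr.
case: (arg_minnP lev xS) => e eS emin.
have eX := subsetP (star_sub X v) _ eS.
have exit z : z \in star X v -> (lev z <= lev e)%N -> z = e.
  move=> zS ze; apply: (exit_uniq zS eS).
    have [//|zr /=] := eqVneq z r; apply/negP => /emin.
    have [_ _ lz] := par_up (subsetP (star_sub X v) _ zS) zr.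
    by rewrite leqNgt -lz ze.
  have [//|er /=] := eqVneq e r; apply/negP => /emin.
  by have [_ _ ->] := par_up eX er; rewrite ltnn.
have child z : z \in star X v -> z != e -> parent r par z e.
  move=> zS ze; have zX := subsetP (star_sub X v) _ zS; rewrite /parent.
  have [zr /=|] := boolP ((z == r) || (par z \notin star X v)).
    case/eqP: ze; apply: (exit_uniq zS eS zr).
    have [//|er /=] := eqVneq e r; apply/negP => /emin.
    by have [_ _ ->] := par_up eX er; rewrite ltnn.
  rewrite negb_or negbK => /andP[zr pS]; rewrite zr /=; apply/eqP; apply: exit => //.
  have [_ _ lz] := par_up zX zr.
  have ez : adj e z by apply: (star_adj eS zS); rewrite eq_sym.
  by have := lev_adj eX zX ez; rewrite lz ltnS.
have [xe|xe] := eqVneq x e.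
  by rewrite xe child ?orbT // -xe eq_sym.
have /andP[xr /eqP px] := child x xS xe.
have [ye|ye] := eqVneq y e; first by rewrite /parent xr px ye eqxx.
have /andP[yr /eqP py] := child y yS ye.
by rewrite xr yr px py eqxx !orbT.
Qed.

End Tree.
End NoNonsep.

(** * Tree kernels with sibling adjacencies *)

Section Branch.
Variables (R : realType) (T : finType).

(** The set [D] is joined to its complement by the single link from [x] to [c].
    An eigenvector of the part on [D] is therefore an eigenvector of the whole
    up to a defect at [c], and [slope_engine] applies to each of them. *)
Lemma branch_kcalc (S u w : T -> T -> R) (d l : T -> R) (D : {set T}) x c j phi
    (dphi : R -> R) : symmetric_kernel S ->
  (forall z t, z \in D -> t \notin D -> S z t = ((z == x) && (t == c))%:R) ->
  x \in D -> c \notin D -> j \notin D -> eigenbasis S u d -> supported_basis D S w l ->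
  kcalc phi u d j x = \sum_k w k x ^+ 2 * kcalc (slope phi dphi (l k)) u d j c.
Proof.
move=> sS cut xD cD jD eb [[ow wS] supp out].
have row k z : k \in D -> \sum_y S z y * w k y = l k * w k z + w k x * (z == c)%:R.
  move=> kD; have [zD|zD] := boolP (z \in D).
    have -> : (z == c) = false by apply: contraTF zD => /eqP->.
    rewrite mulr0 addr0 -wS; apply: eq_bigr => y _; rewrite /induced zD /=.
    by have [//|yD] := boolP (y \in D); rewrite supp // !mulr0.
  rewrite supp // mulr0 add0r -sum_delta mulrC mulr_sumr; apply: eq_bigr => y _.
  have [yD|yD] := boolP (y \in D); last first.
    have -> : (y == x) = false by apply: contraNF yD => /eqP->.
    by rewrite supp // !mulr0.
  rewrite sS cut //; case: eqP => [->|_]; case: eqP => _ /=; ring.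
have eng k : w k x * (\sum_y kcalc phi u d j y * w k y) =
    w k x ^+ 2 * kcalc (slope phi dphi (l k)) u d j c.
  have [kD|kD] := boolP (k \in D); last first.
    have [_ ->] := out k kD; have -> : (k == x) = false by apply: contraNF kD => /eqP->.
    by rewrite expr0n /= !mul0r.
  have := slope_engine (e := c) (k := j) (w := w k) (l := l k) (c := w k x)
    (phi := phi) (psi := slope phi dphi (l k)) eb sS.
  move=> ->; first by rewrite mulrA expr2.
  - by rewrite supp.
  - by move=> z; exact: row.
  - by move=> t; exact: slopeE.
transitivity (\sum_y kcalc phi u d j y * (x == y)%:R); first by rewrite sum_deltaC.
under [RHS]eq_bigr do rewrite -eng mulr_sumr.
rewrite exchange_big; apply: eq_bigr => y _; rewrite -(onb_dual ow) mulr_sumr.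
by apply: eq_bigr => k _; ring.
Qed.

End Branch.

Section TreeKernel.
Variables (R : realType) (T : finType) (X : {set T}) (r : T) (lev : T -> nat) (par : T -> T).
Hypothesis rX : r \in X.
Hypothesis par_up : forall x, x \in X -> x != r -> par x \in X /\ lev x = (lev (par x)).+1.

Definition tree_link x y := [&& x \in X, y \in X & parent r par x y || parent r par y x].
Let S x y : R := (tree_link x y)%:R.

Lemma tree_link_sym : symmetric tree_link.
Proof. by move=> x y; rewrite /tree_link andbCA orbC. Qed.

Let sS : symmetric_kernel S.
Proof. by move=> x y; rewrite /S tree_link_sym. Qed.

Let lev_par x y : x \in X -> parent r par x y -> lev x = (lev y).+1.
Proof. by move=> xX /andP[xr /eqP<-]; have [] := par_up xX xr. Qed.

(** The descendants of [x]. *)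
Definition below x := [set z in X | (lev x <= lev z)%N && (iter (lev z - lev x) par z == x)].

Lemma below_cut x z t : x \in X -> x != r -> z \in below x -> t \notin below x ->
  S z t = ((z == x) && (t == par x))%:R.
Proof.
move=> xX xr zB tB; have [pX lx] := par_up xX xr.
move: (zB); rewrite inE => /and3P[zX xz /eqP zx]; rewrite /S; congr ((_ : bool)%:R).
apply/idP/andP => [/and3P[_ tX /orP[zt|tz]]|[/eqP-> /eqP->]]; last first.
- by rewrite /tree_link xX pX /parent xr eqxx.
- case/negP: tB; rewrite inE tX (lev_par tX tz) (leqW xz) subSn // iterSr.
  by have /andP[_ /eqP->] := tz; rewrite zx eqxx.
have /andP[zr /eqP pz] := zt; have lz := lev_par zX zt.
case: (ltngtP (lev x) (lev z)) xz => // [xz _|xz _]; last first.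
  by move: zx; rewrite xz subnn /= => zx; rewrite -pz zx !eqxx.
case/negP: tB; rewrite inE tX; move: zx; rewrite lz subSn; last by rewrite -ltnS -lz.
by rewrite iterSr pz => ->; rewrite eqxx -ltnS -lz xz.
Qed.

Lemma below_self x : x \in X -> x \in below x.
Proof. by move=> xX; rewrite inE xX leqnn subnn /=. Qed.

Lemma par_notin_below x : x \in X -> x != r -> par x \notin below x.
Proof.
by move=> xX xr; have [_ lx] := par_up xX xr; rewrite inE lx ltnn andbF.
Qed.

Lemma sibling_notin_below x y : x \in X -> y \in X -> x != r -> y != r -> x != y ->
  par x = par y -> y \notin below x.
Proof.
move=> xX yX xr yr xy pp; have [_ lx] := par_up xX xr; have [_ ly] := par_up yX yr.
by rewrite inE lx ly pp subnn /= eq_sym (negPf xy) !andbF.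
Qed.

(** Apply [branch_kcalc] at both siblings.  The first application replaces [phi]
    by its divided differences, which are nondecreasing by convexity; the second
    takes divided differences of these, which are nonnegative, and leaves a
    diagonal entry at the common parent. *)
Lemma sibling_kcalc_ge0 (u : T -> T -> R) d phi (dphi : R -> R) x y : tangent phi dphi ->
  eigenbasis S u d ->
  x \in X -> y \in X -> x != r -> y != r -> x != y -> par x = par y ->
  0 <= kcalc phi u d x y.
Proof.
move=> tf eb xX yX xr yr xy pp; rewrite eq_sym in xy.
have [w [l sb]] := supported_basis_exists (below y) sS.
rewrite (branch_kcalc phi dphi sS (fun z t => @below_cut y z t yX yr) (below_self yX)
  (par_notin_below yX yr) (sibling_notin_below yX xX yr xr xy (esym pp)) eb sb).
apply: sumr_ge0 => k _; apply: mulr_ge0; first exact: sqr_ge0.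
have -> psi : kcalc psi u d x (par y) = kcalc psi u d (par y) x.
  by apply: eq_bigr => i _; rewrite mulrAC.
rewrite -pp; have [w' [l' sb']] := supported_basis_exists (below x) sS.
rewrite (branch_kcalc _ (fun=> 0) sS (fun z t => @below_cut x z t xX xr) (below_self xX)
  (par_notin_below xX xr) (par_notin_below xX xr) eb sb').
apply: sumr_ge0 => i _; apply: mulr_ge0; first exact: sqr_ge0.
apply: sumr_ge0 => t _; rewrite -mulrA -expr2 mulr_ge0 ?sqr_ge0 //.
rewrite [X in 0 <= X]/slope; case: eqVneq => // tl.
have mono := slope_mono (l k) tf.
have [lt|tlt] := leP (l' i) (d t).
  by rewrite divr_ge0 // subr_ge0 ?mono.
by rewrite -mulrNN -invrN !opprB divr_ge0 // subr_ge0 ?mono // ltW.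
Qed.

Lemma tree_kernel_energy p : 2 <= p < 4 -> alpha p #|X| <= energy (posp p) S.
Proof.
move=> p24.
have -> : energy (posp p) S = energy (posp p) (induced X S).
  apply: eq_energy => x y; rewrite /induced /S /tree_link.
  by case: (x \in X); case: (y \in X).
apply: (@tree_energy _ _ _ (fun x => (-1) ^+ lev x) lev par) => //.
- by move=> x; rewrite -expr2 sqrr_sign.
- move=> x y; rewrite /S; case: (boolP (tree_link x y)); last by rewrite mulr0 oppr0.
  move=> /and3P[xX yX /orP[/(lev_par xX)->|/(lev_par yX)->]]; rewrite exprS mulr1.
    by rewrite -mulrA -expr2 sqrr_sign mulr1.
  by rewrite mulrCA -expr2 sqrr_sign mulr1.
- by move=> x y; rewrite /S; case: tree_link; rewrite ?expr1n ?expr0n.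
- move=> x y xX yX yx; rewrite /S pnatr_eq0 eqb0 negbK => /and3P[_ _ /orP[]].
    by case/andP=> _ /eqP.
  by move/(lev_par yX) => e; move: yx; rewrite e ltnn.
(* Every element of [X] but the root has one parent. *)
have count : \sum_(x in X) \sum_(y in X) ((parent r par x y)%:R : R) = (#|X|.-1)%:R.
  have -> : #|X|.-1 = #|X :\ r| by rewrite (cardsD1 r X) rX.
  rewrite -sum1_card natr_sum [RHS]big_mkcond [LHS]big_mkcond; apply: eq_bigr => x _.
  rewrite in_setD1; have [xX|] := boolP (x \in X); last by rewrite andbF.
  rewrite andbT; have [->|xr] := eqVneq x r.
    by rewrite big1 // => y _; rewrite /parent eqxx.
  have [pX _] := par_up xX xr.
  rewrite (bigD1 (par x)) //= /parent xr eqxx big1 ?addr0 // => y /andP[_ yp].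
  by rewrite eq_sym (negPf yp).
rewrite mulr_natl mulr2n -[X in X + _ <= _]count -[X in _ + X <= _]count.
rewrite [X in _ + X <= _]exchange_big -big_split; apply: ler_sum => x xX.
rewrite -big_split; apply: ler_sum => y yX /=; rewrite /S /tree_link xX yX /=.
have [xy|_] := boolP (parent r par x y); have [yx|_] := boolP (parent r par y x) => /=.
- by exfalso; have := lev_par xX xy; have := lev_par yX yx; clear; lia.
- by rewrite addr0 expr1n.
- by rewrite add0r expr1n.
- by rewrite addr0 expr0n.
Qed.

(** Klein's inequality at the tree kernel: only sibling entries differ, and
    there the derivative is nonnegative. *)
Lemma tree_with_siblings (b : T -> T -> R) p : 2 <= p < 4 -> symmetric_kernel b ->
  (forall x y, S x y <= b x y) ->
  (forall x y, S x y < b x y ->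
    [/\ x \in X, y \in X, x != y & [&& x != r, y != r & par x == par y]]) ->
  alpha p #|X| <= energy (posp p) b.
Proof.
move=> p24 sb Sb sib; have /andP[p2 _] := p24; apply: le_trans (tree_kernel_energy p24) _.
have p1 : 1 <= p by lra.
have [u [d eb]] := eigenbasis_exists sS.
apply: le_trans (klein (posp_tangent p1) sS sb eb); rewrite lerDl.
apply: sumr_ge0 => x _; apply: sumr_ge0 => y _;
have := Sb x y; rewrite le_eqVlt => /orP[/eqP<-|lt]; first by rewrite subrr mulr0.
have [xX yX xy /and3P[xr yr /eqP pp]] := sib x y lt.
rewrite mulr_ge0 ?subr_ge0 ?Sb //.
exact: sibling_kcalc_ge0 (dposp_tangent p2) eb xX yX xr yr xy pp.
Qed.
End TreeKernel.

Section TreeStep.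
Variable G : sgraph.
Notation L := (line_graph G).

Lemma tree_step (R : realType) (p : R) (X : {set L}) : 2 <= p < 4 -> (0 < #|X|)%N -> lconn X ->
  (forall v, ~ nonsep X v) -> alpha p #|X| <= energy (posp p) (induced X (@adjk R L)).
Proof.
move=> p24 /card_gt0P[r rX] Xc sep; have [lev [par [lev_adj par_up]]] := breadth_first rX Xc.
apply: (@tree_with_siblings _ _ X r lev par) => //.
- by move=> x xX xr; have [] := par_up x xX xr.
- by apply: induced_symmetric; exact: adjk_symmetric.
- move=> x y; rewrite /induced /adjk /tree_link; case: ifP => [/andP[xX yX]|]; last first.
    by rewrite andbA => ->.
  rewrite xX yX !andTb; case: orP => [|_]; last exact: ler0n.
  have par_adj z t : z \in X -> parent r par z t -> adj z t.
    by move=> zX /andP[zr /eqP<-]; have [] := par_up z zX zr.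
  move=> h; suff -> : adj x y by [].
  by case: h => [/(par_adj _ _ xX)|/(par_adj _ _ yX)]; rewrite // adj_sym.
move=> x y; rewrite /induced /adjk /tree_link; case: ifP => [/andP[xX yX]|]; last first.
  by rewrite andbA => ->; rewrite ltxx.
rewrite xX yX ltr_nat !andTb; case: (boolP (adj x y)) => [xy|_]; last by [].
move=> h; split=> //; first by apply: contraTneq xy => ->; rewrite adj_irr.
have /or3P[h1|h1|//] := adj_parent_or_sibling lev_adj par_up sep xX yX xy.
  by rewrite h1 in h.
by rewrite h1 orbT in h.
Qed.

End TreeStep.

(** * The induction *)

Lemma line_degree_two (G : sgraph) (X : {set line_graph G}) :
  (forall v, #|star X v| <= 2)%N ->
  forall z, z \in X -> (#|[set y in X | adj z y]| <= 2)%N.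
Proof.
move=> d2 z zX; have [v vz] := edge_ends_ex z; have [w [wv zE]] := edge_ends vz.
have wz : w \in val z by rewrite zE !inE eqxx orbT.
have sub : [set y in X | adj z y] \subset (star X v :\ z) :|: (star X w :\ z).
  apply/subsetP=> y; rewrite inE => /andP[yX zy].
  have yz : y != z by apply: contraTneq zy => ->; rewrite adj_irr.
  have [u /andP[uz uy]] := line_adj_common zy.
  rewrite inE !in_setD1 !starP yz yX.
  by move: uz; rewrite zE !inE => /orP[/eqP<-|/eqP<-]; rewrite uy ?orbT.
apply: leq_trans (subset_leq_card sub) _.
apply: leq_trans (leq_card_setU _ _) _.
have one u : u \in val z -> (#|star X u :\ z| <= 1)%N.
  by move=> uz; have := d2 u; rewrite (cardsD1 z) starP zX uz.
exact: (@leq_add _ _ 1 1 (one v vz) (one w wz)).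
Qed.

(** The generalisation to connected sets of edges is what the induction needs,
    as the pieces left by pinching are again of this kind. *)
Theorem connected_edge_set_energy (R : realType) (G : sgraph) (p : R)
    (X : {set line_graph G}) : 2 <= p -> (0 < #|X|)%N -> lconn X ->
  alpha p #|X| <= energy (posp p) (induced X (@adjk R (line_graph G))).
Proof.
move=> p2; have [n] := ubnP #|X|; elim: n X => // n IHn X Xn X0 Xc.
have IH (Y : {set line_graph G}) : (0 < #|Y| < #|X|)%N -> lconn Y ->
    alpha p #|Y| <= energy (posp p) (induced Y (@adjk R (line_graph G))).
  by case/andP=> Y0 YX; apply: IHn => //; exact: leq_trans YX Xn.
have [/existsP[v d3]|] := boolP [exists v, (2 < #|star X v|)%N]; last first.
  rewrite negb_exists => /forallP d2; apply: alpha_le_degree_two => //.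
  by apply: line_degree_two => v; rewrite leqNgt.
have [p3|p3] := leP 3 p.
  have /card_gt0P[e eS] : (0 < #|star X v|)%N by exact: leq_trans d3.
  exact: large_degree_step p3 Xc d3 eS IH.
have p24 : 2 <= p < 4 by rewrite p2 /=; lra.
have [[u [d3' ns]]|sep] := boolp.pselect (exists u, (2 < #|star X u|)%N /\ nonsep X u).
  exact: star_cut_step p24 Xc d3' ns IH.
apply: tree_step => // u ns; have := all_nonsep v Xc _ ns; rewrite leqNgt d3.
by case/(_ _)/negP => // w dw nw; apply: sep; exists w.
Qed.

Lemma line_graph_lconn (G : sgraph) : (forall a b : G, connect (@adj G) a b) ->
  lconn [set: line_graph G].
Proof.
move=> Gc e f _ _; have [a ae] := edge_ends_ex e; have [b bf] := edge_ends_ex f.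
have meet (x y : line_graph G) v : v \in val x -> v \in val y -> connect (radj [set: _]) x y.
  move=> vx vy; have [->|xy] := eqVneq x y; first exact: connect0.
  by apply: connect1; rewrite /radj !in_setT; exact: common_line_adj xy vx vy.
have /connectP[q pq bE] := Gc a b; elim: q a e ae pq bE => [|c q IH] a e ae /=.
  by move=> _ ba; apply: meet ae _; rewrite -ba.
case/andP=> ac pq bE.
have acE : [set a; c] \in edges G.
  by rewrite inE; apply/existsP; exists a; apply/existsP; exists c; rewrite ac eqxx.
pose g : line_graph G := exist _ [set a; c] acE.
apply: (@connect_trans _ _ g); first by apply: meet ae _; rewrite !inE eqxx.
by apply: IH pq bE; rewrite !inE eqxx orbT.
Qed.

Theorem theorem3p18 (R : realType) (G : sgraph) (m : nat) (p : R) :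
  graph_connected G -> #|edges G| = m -> (1 <= m)%N -> 2 <= p ->
  pos_energy p (line_graph G) >= pos_energy p (path_graph m).
Proof.
move=> [_ Gc] Em m0 p2; have p0 : 1 <= p by lra.
pose L := line_graph G.
have cL : #|[set: L]| = m by rewrite cardsT card_sig Em.
rewrite !pos_energyE -/(alpha p m) -cL.
have -> : energy (posp p) (@adjk R L) = energy (posp p) (induced [set: L] (@adjk R L)).
  by apply: eq_energy => x y; rewrite /induced !in_setT.
by apply: connected_edge_set_energy => //; [rewrite cL|exact: line_graph_lconn].
Qed.
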